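(* Let $m>4$. Let $0<\varepsilon_0,\varepsilon_h<1$ with $\varepsilon_0^2+\varepsilon_h^2<1$, and let $\mathcal C^h_{\varepsilon_0,\varepsilon_h}$ be the cut-off hydrostatic collision operator. Then \[ \left\|\mathcal C^h_{\varepsilon_0,\varepsilon_h}(n^h)\right\|_{L^\infty_m}\le C_{\varepsilon_0,\varepsilon_h,m}\,\|n^h\|_{L^\infty_m}^2\qquad\text{for all } n^h\in L^\infty_m . \] Consequently, the cut-off hydrostatic wave kinetic equation $\partial_t n^h=\mathcal C^h_{\varepsilon_0,\varepsilon_h}(n^h)$ is locally well posed in $L^\infty_m$: for any $n_0\in L^\infty_m$ there exist $T>0$ and a unique solution $n^h\in C([0,T],L^\infty_m)$ with $n^h(0)=n_0$, depending continuously on $n_0$.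
   Context: Modes and notation. A mode is $\alpha=(\sigma_\alpha,k_\alpha)$, $\sigma_\alpha\in\{\pm1\}$, $k_\alpha=(k_\alpha^1,k_\alpha^2)\in\mathbb R^2$ (superscripts are components), $k_\alpha=|k_\alpha|(\cos\theta_\alpha,\sin\theta_\alpha)$; same for $\beta,\gamma$. $\langle k\rangle=(1+|k|^2)^{1/2}$ and $k\times k'=k^1k'^2-k^2k'^1$ (product of components). For $k_\alpha^2\neq0$ the hydrostatic frequency and slowness are \[ \omega^h_\alpha=\sigma_\alpha\frac{k_\alpha^1}{|k_\alpha^2|},\qquad s^h_\alpha=\sigma_\alpha|k_\alpha^2| . \] Define \[ \widetilde{\mathcal V}_\alpha^{\beta\gamma}=-\pi\,\frac{\sigma_\alpha\sigma_\beta\sigma_\gamma}{|k_\alpha^2||k_\beta^2||k_\gamma^2|}\,(k_\beta\times k_\gamma)\,(s^h_\beta-s^h_\gamma)\,(s^h_\alpha+s^h_\beta+s^h_\gamma). \] On the resonant set $k_\alpha+k_\beta+k_\gamma=0$, $\omega^h_\alpha+\omega^h_\beta+\omega^h_\gamma=0$ there is a coefficient $\Gamma^h_{\alpha\beta\gamma}$, symmetric under permutations of $(\alpha,\beta,\gamma)$, with $\widetilde{\mathcal V}_\alpha^{\beta\gamma}=\omega^h_\alpha\Gamma^h_{\alpha\beta\gamma}$, $\widetilde{\mathcal V}_\beta^{\alpha\gamma}=\omega^h_\beta\Gamma^h_{\alpha\beta\gamma}$, $\widetilde{\mathcal V}_\gamma^{\alpha\beta}=\omega^h_\gamma\Gamma^h_{\alpha\beta\gamma}$;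 thus $\Gamma^h_{\alpha\beta\gamma}=\widetilde{\mathcal V}_\alpha^{\beta\gamma}/\omega^h_\alpha$ where $\omega^h_\alpha\ne0$. Cut-off. $\chi^h=\chi^h_{\varepsilon_0,\varepsilon_h}$ is a fixed smooth $2\pi$-periodic function of $\theta$, $0\le\chi^h\le1$, invariant under $\theta\mapsto-\theta$ and $\theta\mapsto\theta+\pi$, supported in $\{|\cos\theta|\ge\varepsilon_0,\ |\sin\theta|\ge\varepsilon_h\}$. No localization near $|\cos\theta|=\tfrac12$ is imposed. Collision operator. Formally, with $\int d\beta=\sum_{\sigma_\beta=\pm1}\int_{\mathbb R^2}dk_\beta$ and $n^h_\alpha=n^h(\sigma_\alpha,k_\alpha)$, \[ \mathcal C^h_{\varepsilon_0,\varepsilon_h}(n^h)(\alpha)=\int\chi^h(\theta_\alpha)\chi^h(\theta_\beta)\chi^h(\theta_\gamma)(\Gamma^h_{\alpha\beta\gamma})^2\omega^h_\alpha\big(\omega^h_\alpha n^h_\beta n^h_\gamma+\omega^h_\gamma n^h_\alpha n^h_\beta+\omega^h_\beta n^h_\alpha n^h_\gamma\big)\delta(k_\alpha+k_\beta+k_\gamma)\delta(\omega^h_\alpha+\omega^h_\beta+\omega^h_\gamma)\,d\beta\,d\gamma . \] The delta functions are interpreted by the co-area formula: for each $(\sigma_\beta,\sigma_\gamma)$ eliminate $k_\gamma=-k_\alpha-k_\beta$, set $\widetilde\Xi^h_1(k_\beta)=\omega^h_\alpha+\omega^h_\beta+\omega^h_\gamma$ (defined where $k_\beta^2,k_\gamma^2\ne0$),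 integrate the remaining integrand over the curve $\{\widetilde\Xi^h_1=0\}$ in the $k_\beta$-plane against $d\mathcal H^1/|\nabla_{k_\beta}\widetilde\Xi^h_1|$, and sum over $\sigma_\beta,\sigma_\gamma\in\{\pm1\}$. The operator is set to $0$ at $k_\alpha=0$, and vanishes when $\chi^h(\theta_\alpha)=0$. Space. $L^\infty_m$ is the set of (Borel measurable) $n:\{\pm1\}\times\mathbb R^2\to\mathbb R_{\ge0}$ with $\|n\|_{L^\infty_m}=\sup_{\sigma=\pm1}\sup_{k\in\mathbb R^2}\langle k\rangle^m|n(\sigma,k)|<\infty$; the same formula defines the norm of the signed function $\mathcal C^h_{\varepsilon_0,\varepsilon_h}(n^h)$. *)

(* Defs.v *)
From HB Require Import structures.
From mathcomp Require Import all_boot all_order all_algebra.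
From mathcomp Require Import all_classical all_reals all_analysis.

Set Implicit Arguments.
Unset Strict Implicit.
Unset Printing Implicit Defensive.

Import Order.TTheory GRing.Theory Num.Theory.
Import numFieldNormedType.Exports.

Local Open Scope classical_set_scope.
Local Open Scope ring_scope.

Section Plane.
Variable R : realType.

(* The library's norm on a product is the sup norm, hence this definition. *)
Definition enorm (k : R * R) : R := Num.sqrt (k.1 ^+ 2 + k.2 ^+ 2).

Definition japanese (k : R * R) : R := Num.sqrt (1 + enorm k ^+ 2).

Definition cross (k k' : R * R) : R := k.1 * k'.2 - k.2 * k'.1.

(* Some polar angle; at the origin every real qualifies.  It is used only
   through functions that are 2 pi-periodic. *)
Definition angle (k : R * R) : R :=
  xget 0 [set t | k = (enorm k * cos t, enorm k * sin t)].

Definition gradient (f : R * R -> R) (k : R * R) : R * R :=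
  ((fun x => f (x, k.2))^`()%classic k.1, (fun y => f (k.1, y))^`()%classic k.2).

End Plane.

Section Hausdorff.
Variable R : realType.
Local Open Scope ereal_scope.

(* The point 0 is added so that the diameter of the empty set is 0. *)
Definition diam (A : set (R * R)) : \bar R :=
  ereal_sup (0 |` [set (enorm (p.1 - p.2)%R)%:E | p in A `*` A]).

Definition hausdorff1_pre (d : R) (A : set (R * R)) : \bar R :=
  ereal_inf [set \sum_(i <oo) diam (U i) | U in
    [set U : (set (R * R))^nat |
      (forall i, diam (U i) <= d%:E) /\ A `<=` \bigcup_i U i]].

Definition hausdorff1 (A : set (R * R)) : \bar R :=
  ereal_sup [set hausdorff1_pre d A | d in [set d : R | (0 < d)%R]].

Lemma diam_ge0 A : 0 <= diam A.
Proof. by apply: ereal_sup_ubound; left. Qed.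

Lemma diam0 : diam set0 = 0.
Proof.
apply/eqP; rewrite eq_le diam_ge0 andbT; apply: ge_ereal_sup => x /= [->//|].
by move=> [p [[]]].
Qed.

Let gauge (d : R) (A : set (R * R)) : \bar R :=
  if diam A <= d%:E then diam A else +oo.

Let gauge_ge0 d A : 0 <= gauge d A.
Proof. by rewrite /gauge; case: ifP => // _; exact: diam_ge0. Qed.

Let gauge0 d : (0 <= d)%R -> gauge d set0 = 0.
Proof. by move=> d0; rewrite /gauge diam0 lee_fin d0. Qed.

Let discrete : measurableType _ :=
  g_sigma_algebraType [set: set (R * R)%type].

Let hausdorff1_preE d (A : set discrete) :
  hausdorff1_pre d A = @mu_ext _ discrete R (gauge d) A.
Proof.
apply/eqP; rewrite eq_le; apply/andP; split.
- apply: le_ereal_inf_tmp => _ [U [_ AU] <-].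
  have [[i ioo]|Ud] := pselect (exists i, gauge d (U i) = +oo).
    rewrite (eseries_pinfty _ _ ioo) ?leey// => n _.
    by rewrite gt_eqF// (lt_le_trans _ (gauge_ge0 d (U n))).
  have {}Ud i : diam (U i) <= d%:E.
    apply: contrapT => /negP/negbTE Hi; apply: Ud; exists i.
    by rewrite /gauge Hi.
  apply: ereal_inf_lbound; exists U => //.
  by apply: eq_eseriesr => i _; rewrite /gauge Ud.
- apply: le_ereal_inf_tmp => _ [U [Ud AU] <-].
  apply: ereal_inf_lbound; exists U.
    by split => // i; exact: sub_sigma_algebra.
  by apply: eq_eseriesr => i _; rewrite /gauge Ud.
Qed.

Let hausdorff1_0 : hausdorff1 set0 = 0.
Proof.
rewrite /hausdorff1 (_ : [set _ | _ in _] = [set 0]) ?ereal_sup1//.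
apply/seteqP; split => x /=.
  move=> [d /= d0 <-]; rewrite hausdorff1_preE.
  by rewrite mu_ext0//; exact: gauge0 (ltW d0).
move=> ->; exists 1%R => //=; rewrite hausdorff1_preE.
by rewrite mu_ext0//; exact: gauge0.
Qed.

Let hausdorff1_ge0 A : 0 <= hausdorff1 A.
Proof.
apply: (@le_trans _ _ (hausdorff1_pre 1 A)).
  by rewrite hausdorff1_preE mu_ext_ge0.
by apply: ereal_sup_ubound; exists 1%R => //=.
Qed.

Let le_hausdorff1 : {homo hausdorff1 : A B / A `<=` B >-> A <= B}.
Proof.
move=> A B AB; apply: ge_ereal_sup => _ [d /= d0 <-].
apply: (@le_trans _ _ (hausdorff1_pre d B)).
  by rewrite !hausdorff1_preE; exact: le_mu_ext.
by apply: ereal_sup_ubound; exists d.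
Qed.

Let hausdorff1_sigma_subadditive : sigma_subadditive hausdorff1.
Proof.
move=> F; apply: ge_ereal_sup => _ [d /= d0 <-].
apply: (@le_trans _ _ (\sum_(i <oo) hausdorff1_pre d (F i))).
  rewrite hausdorff1_preE (eq_eseriesr (fun i _ => hausdorff1_preE d (F i))).
  by apply: mu_ext_sigma_subadditive; exact: gauge_ge0.
apply: lee_nneseries => i _.
  by rewrite hausdorff1_preE mu_ext_ge0.
by apply: ereal_sup_ubound; exists d.
Qed.

HB.instance Definition _ := isOuterMeasure.Build R (R * R)%type hausdorff1
  hausdorff1_0 hausdorff1_ge0 le_hausdorff1 hausdorff1_sigma_subadditive.

End Hausdorff.

Definition hausdorff1_outer (R : realType) :
    {outer_measure set (R * R) -> \bar R} := @hausdorff1 R.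

(* H^1 on its Caratheodory-measurable subsets of the plane. *)
Definition hausdorff1_measure (R : realType) :
    {measure set (caratheodory_type (@hausdorff1_outer R)) -> \bar R} :=
  [the measure _ _ of (@hausdorff1_outer R :
    set (caratheodory_type (@hausdorff1_outer R)) -> \bar R)].

(* A mode (sigma, k); the Boolean true stands for sigma = +1. *)
Definition mode (R : realType) : Type := (bool * (R * R))%type.

Section Modes.
Variable R : realType.
Implicit Types a b c : mode R.

Definition sgn (s : bool) : R := if s then 1 else -1.

Definition omegah a : R := sgn a.1 * (a.2.1 / `|a.2.2|).

Definition slowness a : R := sgn a.1 * `|a.2.2|.

Definition Vtilde a b c : R :=
  - pi * (sgn a.1 * sgn b.1 * sgn c.1 / (`|a.2.2| * `|b.2.2| * `|c.2.2|))
  * cross b.2 c.2 * (slowness b - slowness c)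
  * (slowness a + slowness b + slowness c).

(* On the resonant set this is the symmetric coefficient as long as
   omegah a != 0, which the cut-off at a guarantees wherever it is nonzero. *)
Definition Gammah a b c : R := Vtilde a b c / omegah a.

End Modes.

Section Collision.
Variable R : realType.

Record cutoff (eps0 epsh : R) (chi : R -> R) : Prop := Cutoff {
  cutoff_smooth : forall (i : nat) (t : R), derivable (chi^`(i)%classic) t 1 ;
  cutoff_periodic : forall t, chi (t + 2 * pi) = chi t ;
  cutoff_range : forall t, 0 <= chi t <= 1 ;
  cutoff_even : forall t, chi (- t) = chi t ;
  cutoff_pi : forall t, chi (t + pi) = chi t ;
  cutoff_support : closure [set t | chi t != 0] `<=`
    [set t | eps0 <= `|cos t| /\ epsh <= `|sin t|] }.

Variables (chi : R -> R) (n : mode R -> R).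

Definition chih (a : mode R) : R := chi (angle a.2).

Definition integrand (a b c : mode R) : R :=
  chih a * chih b * chih c * Gammah a b c ^+ 2 * omegah a *
  (omegah a * n b * n c + omegah c * n a * n b + omegah b * n a * n c).

(* k_gamma has been eliminated through k_alpha + k_beta + k_gamma = 0. *)
Section Curve.
Variables (a : mode R) (sb sc : bool).

Definition bmode (kb : R * R) : mode R := (sb, kb).
Definition cmode (kb : R * R) : mode R := (sc, - a.2 - kb).

Definition Xih (kb : R * R) : R :=
  omegah a + omegah (bmode kb) + omegah (cmode kb).

Definition resonant_curve : set (R * R) :=
  [set kb | [/\ (bmode kb).2.2 != 0, (cmode kb).2.2 != 0 & Xih kb = 0]].

(* The gradient does not vanish at the points of the curve where the cut-offs
   are nonzero, so the convention x / 0 = 0 plays no role. *)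
Definition curve_integral : \bar R :=
  (\int[hausdorff1_measure R]_(kb in resonant_curve)
    (integrand a (bmode kb) (cmode kb) / enorm (gradient Xih kb))%:E)%E.

End Curve.

(* Extended-real valued, so that a divergent integral is not hidden: since
   (+oo - oo)%E = -oo, a finite value means that all the integrals converge
   absolutely. *)
Definition collision (a : mode R) : \bar R :=
  (if a.2 == 0%R then 0 else \sum_(sb : bool) \sum_(sc : bool)
     curve_integral a sb sc)%E.

End Collision.

Section Space.
Variable R : realType.

Definition Lnorm_infty (m : R) (f : mode R -> \bar R) : \bar R :=
  ereal_sup [set ((japanese a.2 `^ m)%:E * `|f a|)%E | a in [set: mode R]].

Record Linfty (m : R) (n : mode R -> R) : Prop := LInfty {
  Linfty_measurable : forall s : bool,
    measurable_fun [set: R * R] (fun k : R * R => n (s, k)) ;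
  Linfty_ge0 : forall a, 0 <= n a ;
  Linfty_fin : (Lnorm_infty m (EFin \o n) < +oo)%E }.

Definition Ldist (m : R) (f g : mode R -> R) : \bar R :=
  Lnorm_infty m (fun a => (f a - g a)%:E).

(* Solutions in C([0, T], L^infty_m), the time derivative being that of an
   L^infty_m-valued function (one-sided at the end points). *)
Record solution (chi : R -> R) (m T : R) (n0 : mode R -> R)
    (n : R -> mode R -> R) : Prop := Solution {
  solution_space : forall t, 0 <= t <= T -> Linfty m (n t) ;
  solution_continuous : forall t, 0 <= t <= T ->
    Ldist m (n s) (n t) @[s --> within `[0, T] (nbhs t)] --> 0%E ;
  solution_derivative : forall t, 0 <= t <= T ->
    Lnorm_infty m (fun a => ((n s a - n t a) / (s - t))%:E
                            - collision chi (n t) a)%E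
      @[s --> within `[0, T] t^'] --> 0%E ;
  solution_initial : forall a, n 0 a = n0 a }.

(* Around every datum n0 there is a ball in which every datum g has exactly one
   solution S g on a common interval [0, T], and S is continuous from this ball
   to C([0, T], L^infty_m). *)
Definition locally_well_posed (chi : R -> R) (m : R) : Prop :=
  forall n0, Linfty m n0 -> exists (T r : R)
      (S : (mode R -> R) -> R -> mode R -> R),
    let near_n0 g := Linfty m g /\ (Ldist m g n0 < r%:E)%E in
    [/\ 0 < T, 0 < r,
        forall g, near_n0 g -> solution chi m T g (S g),
        forall g n, near_n0 g -> solution chi m T g n ->
          forall t, 0 <= t <= T -> forall a, n t a = S g t a &
        forall g, near_n0 g -> forall e : R, 0 < e -> exists2 d : R, 0 < d &
          forall h, near_n0 h -> (Ldist m h g < d%:E)%E ->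
          forall t, 0 <= t <= T -> (Ldist m (S h t) (S g t) <= e%:E)%E].

End Space.

(* Main.v *)
(* Fix a mode [a] and signs, and let [y] be the second component of the first
   integration variable [kb].  On the resonant curve the resonance function is
   affine in the first component of [kb], so the curve is the graph of
   [y |-> curve_x y] over an open set; computing [H^1] on a graph cancels the
   gradient and turns the co-area integral into a Lebesgue integral in [y] with
   weight 1 / |d Xi / d kb^1|.  Resonance, sum of omega = 0 and sum of omega * s = 0,
   makes omega proportional to the differences of the slownesses.  As the cut-offs
   bound |omega| above and below, this controls the sum of the slownesses by the
   smallest one, and the whole weight by min(|k_b^2|, |k_c^2|)^3.  The larger of
   [k_b], [k_c] absorbs the decay of order [m] at [a]; the other one leaves
   |y|^3 (1 + y^2)^(-m/2), which is integrable because m > 4.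

   The operator is therefore the diagonal of a bounded bilinear form [Q], and
   n' = Q(n, n) is solved on a short interval by the power series
   (j + 1) u_(j+1) = sum_(i <= j) Q(u_i, u_(j-i)).  Uniqueness, continuous
   dependence and positivity come from a pointwise barrier argument.  For positivity
   the loss term is a multiple of [n], so that where [n < 0] the time derivative is
   bounded below in terms of the negative part of [n] only. *)
Require Import Defs.
From mathcomp Require Import all_boot all_order all_algebra.
From mathcomp Require Import all_classical all_reals all_analysis.
From mathcomp Require Import measurable_realfun ring lra zify.
Import Order.TTheory GRing.Theory Num.Theory.
Import numFieldNormedType.Exports.
Local Open Scope classical_set_scope.
Local Open Scope ring_scope.
Set Implicit Arguments.
Unset Strict Implicit.
Unset Printing Implicit Defensive.

(** * Hausdorff measure of graphs *)

(** Two points decide whether the scheme closes. First, the weight 1 / |d Xi / d kb^1| blows up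
    where the slownesses of b and c coincide. But this slope is, up to sign, (s_b - s_c) / (|k_b^2|
    |k_c^2|), while Gamma^2 carries (s_b - s_c)^2, so the singularity cancels and one factor
    survives. The cross product of two wavevectors of a triad is the same for all pairs up to sign;
    it can therefore be estimated through |k_b^2| or through |k_c^2|, and using both estimates
    supplies the powers that cancel the remaining denominators. Second, the terms of the power
    series have no sign, so existence is proved among signed functions and positivity is recovered
    afterwards. All limits are pointwise with geometric error bounds, so closure of the space under
    bounded pointwise limits does the work of completeness. On the measure side, H^1 is an outer
    measure with its Caratheodory sigma-algebra. It is additive on sets at positive distance, which
    makes Lipschitz functions, hence both coordinates, measurable. *)

Section HausdorffMeasurable.
Variable R : realType.
Implicit Types (A B : set (R * R)) (c d : R).
Local Notation H1 := (@hausdorff1 R).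

Lemma enorm_diam A p q : A p -> A q -> ((enorm (p - q))%:E <= diam A)%E.
Proof. by move=> Ap Aq; apply: ereal_sup_ubound; right; exists (p, q). Qed.

Lemma diam_le A d : 0 <= d ->
  (forall p q, A p -> A q -> enorm (p - q) <= d) -> (diam A <= d%:E)%E.
Proof.
move=> d0 Ad; apply: ge_ereal_sup => _ [->|[[p q] [/= Ap Aq] <-]].
  by rewrite lee_fin.
by rewrite lee_fin; exact: Ad.
Qed.

Lemma hausdorff1_pre_le d A : 0 < d -> (hausdorff1_pre d A <= H1 A)%E.
Proof. by move=> d0; apply: ereal_sup_ubound; exists d. Qed.

Lemma hausdorff1_pre_anti d d' A : d <= d' ->
  (hausdorff1_pre d' A <= hausdorff1_pre d A)%E.
Proof.
move=> dd'; apply: le_ereal_inf => _ [U [Ud AU] <-]; exists U => //; split => // i.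
by rewrite (le_trans (Ud i))// lee_fin.
Qed.

(** A set of diameter at most [d] cannot meet both [A] and [B], so every admissible cover of the
    union splits into a cover of each. *)
Lemma hausdorff1_pre_separated d A B :
  (forall p q, A p -> B q -> d < enorm (p - q)) ->
  (hausdorff1_pre d A + hausdorff1_pre d B <= hausdorff1_pre d (A `|` B))%E.
Proof.
move=> AB; apply: le_ereal_inf_tmp => _ [U [Ud ABU] <-].
have [d0|d0] := leP 0 d; last first.
  by have := le_trans (diam_ge0 (U 0%N)) (Ud 0%N); rewrite lee_fin leNgt d0.
(* [V S] keeps the pieces that meet [S] and replaces the others by the empty set, of diameter 0. *)
pose V (S : set (R * R)) i := if `[< exists2 p, U i p & S p >] then U i else set0.
have V0 S i : (0 <= diam (V S i))%E by exact: diam_ge0.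
have Vd S i : (diam (V S i) <= d%:E)%E.
  by rewrite /V; case: ifP => // _; rewrite diam0 lee_fin.
have Vcov S : S `<=` \bigcup_i U i -> S `<=` \bigcup_i V S i.
  move=> SU p Sp; have [i _ Uip] := SU _ Sp; exists i => //.
  by rewrite /V; case: asboolP => // -[]; exists p.
apply: (@le_trans _ _ (\sum_(i <oo) diam (V A i) + \sum_(i <oo) diam (V B i))%E).
  apply: leeD; apply: ereal_inf_lbound.
  - by exists (V A) => //; split => //; apply: Vcov => p Ap; apply: ABU; left.
  - by exists (V B) => //; split => //; apply: Vcov => p Bp; apply: ABU; right.
rewrite -nneseriesD//; apply: lee_nneseries => i _; first by rewrite adde_ge0.
rewrite /V; case: asboolP => [[p Up Ap]|_]; case: asboolP => [[q Uq Bq]|_].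
- have := le_trans (enorm_diam Up Uq) (Ud i).
  by rewrite lee_fin leNgt AB.
- by rewrite diam0 adde0.
- by rewrite diam0 add0e.
- by rewrite diam0 adde0 diam_ge0.
Qed.

(** H^1 is a metric outer measure. The pre-measures split at scales below [e], and the scales [d]
    and [d'] are kept independent so that the two suprema can be taken one after the other. *)
Lemma hausdorff1_separated e A B : 0 < e ->
  (forall p q, A p -> B q -> e <= enorm (p - q)) ->
  (H1 A + H1 B <= H1 (A `|` B))%E.
Proof.
move=> e0 AB.
have key d d' : 0 < d -> 0 < d' ->
    (hausdorff1_pre d A + hausdorff1_pre d' B <= H1 (A `|` B))%E.
  move=> d0 d'0; pose d2 := Num.min (e / 2) (Num.min d d').
  have d20 : 0 < d2 by rewrite /d2 !lt_min d0 d'0 divr_gt0.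
  have d2e : d2 < e.
    by rewrite (@le_lt_trans _ _ (e / 2))// ?ge_min ?lexx// ltr_pdivrMr// ltr_pMr// ltr1n.
  apply: le_trans (hausdorff1_pre_le _ d20).
  apply: le_trans (hausdorff1_pre_separated _); last first.
    by move=> p q Ap Bq; apply: lt_le_trans d2e (AB _ _ Ap Bq).
  by apply: leeD; apply: hausdorff1_pre_anti; rewrite /d2 !ge_min lexx ?orbT.
have H0 X : (0 <= H1 X)%E by exact: (outer_measure_ge0 (hausdorff1_outer R)).
have pre0 d X : 0 < d -> (0 <= hausdorff1_pre d X)%E.
  move=> d0; apply: le_ereal_inf_tmp => _ [U [Ud _] <-].
  by apply: nneseries_ge0 => i _ _; exact: diam_ge0.
have [->|ABoo] := eqVneq (H1 (A `|` B)) +oo%E; first exact: leey.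
have HABf : H1 (A `|` B) \is a fin_num by rewrite ge0_fin_numE// ltey.
have HX X : X `<=` A `|` B -> H1 X \is a fin_num.
  move=> XAB; rewrite ge0_fin_numE//.
  apply: le_lt_trans (le_outer_measure (hausdorff1_outer R) _ _ XAB) _.
  by rewrite ltey.
have preB d : 0 < d -> hausdorff1_pre d B \is a fin_num.
  move=> d0; rewrite ge0_fin_numE ?pre0//.
  apply: le_lt_trans (hausdorff1_pre_le B d0) _.
  by rewrite -ge0_fin_numE//; apply: HX => x; right.
rewrite -leeBrDl; last by apply: HX => x; left.
apply: ge_ereal_sup => _ [d' d'0 <-]; rewrite leeBrDl; last by apply: HX => x; left.
rewrite -leeBrDr; last exact: preB.
by apply: ge_ereal_sup => _ [d d0 <-]; rewrite leeBrDr ?key//; exact: preB.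
Qed.

Lemma nneseries_fin_tail (u : nat -> \bar R) (e : R) : (forall k, (0 <= u k)%E) ->
  (\sum_(k <oo) u k < +oo)%E -> 0 < e -> exists n, (\sum_(n <= k <oo) u k < e%:E)%E.
Proof.
move=> u0 uoo e0.
have := nneseries_tail_cvg uoo (fun k _ => u0 k) => /fine_cvgP[_].
move=> /cvgrPdist_lt /(_ _ e0)[n _ /(_ n (leqnn n))]/=; rewrite sub0r normrN => un.
exists n; have un0 : (0 <= \sum_(n <= k <oo) u k)%E by apply: nneseries_ge0.
have unoo : (\sum_(n <= k <oo) u k < +oo)%E.
  apply: le_lt_trans uoo.
  rewrite (nneseries_split 0 n)// add0n leeDr// sume_ge0//.
rewrite -(@fineK _ (\sum_(n <= k <oo) u k)%E) ?ge0_fin_numE// lte_fin.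
by apply: le_lt_trans un; exact: ler_norm.
Qed.

End HausdorffMeasurable.

Section LipschitzImages.
Variable R : realType.

Section CaratheodoryLipschitz.
Variables (f : R * R -> R) (c : R) (X : set (R * R)).
Hypothesis f_lip : forall p q, `|f p - f q| <= enorm (p - q).
Local Notation H1 := (@hausdorff1 R).
Let level k : R := c + k.+1%:R^-1.
Let shell k := X `&` [set p | level k.+1 < f p <= level k].

Let level_decr k : level k.+1 < level k.
Proof. by rewrite ltrD2l ltf_pV2 ?posrE// ltr_nat. Qed.

Let level_anti k l : (k <= l)%N -> level l <= level k.
Proof. by move=> kl; rewrite lerD2l lef_pV2 ?posrE// ler_nat. Qed.

Lemma hausdorff1_level_separated s t A B : s < t ->
  (forall p, A p -> t <= f p) -> (forall p, B p -> f p <= s) ->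
  (H1 A + H1 B <= H1 (A `|` B))%E.
Proof.
move=> st At Bs; apply: (@hausdorff1_separated _ (t - s)); first by rewrite subr_gt0.
move=> p q Ap Bq; apply: le_trans (f_lip p q); apply: le_trans (ler_norm _).
by rewrite lerB// ?At ?Bs.
Qed.

Let H1_ge0 A : (0 <= H1 A)%E.
Proof. exact: (outer_measure_ge0 (hausdorff1_outer R)). Qed.

Let H1_le A B : A `<=` B -> (H1 A <= H1 B)%E.
Proof. exact: (le_outer_measure (hausdorff1_outer R)). Qed.

(* Shells of equal parity are at positive distance from one another, so [H1] is
   additive on them. *)
Let sum_alternate_shells b N :
  (\sum_(k < N) H1 (shell (k.*2 + b).+1)
     <= H1 (X `&` [set p | (level (N.*2 + b) < f p)%R]))%E.
Proof.
elim: N => [|N IH]; first by rewrite big_ord0.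
rewrite big_ord_recr/=.
apply: (@le_trans _ _ (H1 (X `&` [set p | (level (N.*2 + b) < f p)%R])
                       + H1 (shell (N.*2 + b).+1))%E); first exact: leeD.
apply: le_trans (hausdorff1_level_separated (level_decr (N.*2 + b)) _ _) _.
- by move=> p [_ /ltW].
- by move=> p [_ /andP[]].
rewrite doubleS !addSn.
apply: H1_le => p [[Xp pN]|[Xp /andP[pN _]]]; split=> //=.
by apply: le_lt_trans (level_anti _) pN; rewrite ltnW.
Qed.

Let sum_shells N : (\sum_(k < N) H1 (shell k.+1) <= H1 X + H1 X)%E.
Proof.
apply: (@le_trans _ _ (\sum_(k < N.*2) H1 (shell k.+1))%E).
  by apply: (@lee_sum_nneg_ord _ (fun k => H1 (shell k.+1)) xpredT) => //; rewrite -addnn leq_addr.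
have -> : (\sum_(k < N.*2) H1 (shell k.+1) = \sum_(k < N) H1 (shell (k.*2 + 0).+1)
    + \sum_(k < N) H1 (shell (k.*2 + 1).+1))%E.
  elim: N => [|N IH]; first by rewrite !big_ord0 adde0.
  by rewrite doubleS !big_ord_recr/= IH addn0 addn1 -!addeA; congr adde; rewrite addeCA.
apply: leeD; apply: le_trans (sum_alternate_shells _ _) _;
  by apply: H1_le => p [].
Qed.

(** Caratheodory's criterion: the part of [X] above [level n.+1] is at positive distance from the
    part where [f <= c], and what lies in between is a union of shells whose measures are the tail
    of a convergent series. *)
Lemma caratheodory_lipschitz_le :
  (H1 (X `&` [set p | (c < f p)%R]) + H1 (X `&` ~` [set p | (c < f p)%R]) <= H1 X)%E.
Proof.
have [->|Xoo] := eqVneq (H1 X) +oo%E; first exact: leey.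
have Xfin : H1 X \is a fin_num by rewrite ge0_fin_numE// ltey.
have shoo : (\sum_(k <oo) H1 (shell k.+1) < +oo)%E.
  apply: (@le_lt_trans _ _ (H1 X + H1 X)%E); last by rewrite -ge0_fin_numE ?adde_ge0// fin_numD Xfin.
  apply: lime_le; first by apply: is_cvg_nneseries.
  by apply: nearW => n; rewrite big_mkord.
apply/lee_addgt0Pr => e e0.
have [n tail] := nneseries_fin_tail (fun k => H1_ge0 (shell k.+1)) shoo e0.
pose B := X `&` [set p | level n.+1 < f p].
have cover : X `&` [set p | c < f p] `<=` B `|` \bigcup_k (if (n <= k)%N then shell k.+1 else set0).
  move=> p [Xp /= cfp].
  have [Bp|Bp] := ltP (level n.+1) (f p); [by left|right].
  have ex : exists k, level k < f p.
    exists (Num.bound (f p - c)^-1); rewrite /level -ltrBrDl invf_plt ?posrE ?subr_gt0//.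
    apply: lt_trans (archi_boundP _) _; last by rewrite ltr_nat.
    by rewrite invr_ge0 subr_ge0 ltW.
  case: (ex_minnP ex) => k kfp kmin.
  have nk : (n.+1 < k)%N.
    rewrite ltnNge; apply/negP => /level_anti kn.
    by have := lt_le_trans kfp Bp; rewrite ltNge kn.
  (* By minimality of [k] the point lies in [shell k.-1], which has index [k.-2] in the series of
     the [shell k.+1]. *)
  exists k.-2 => //; case: k nk kfp kmin => [|[|k]]// nk kfp kmin /=.
  have -> : (n <= k)%N by [].
  split => //=; apply/andP; split => //.
  by rewrite leNgt; apply/negP => /kmin; rewrite ltnn.
have HB : (H1 (X `&` [set p | (c < f p)%R]) <= H1 B + e%:E)%E.
  apply: le_trans (H1_le cover) _.
  apply: le_trans (outer_measureU2 (hausdorff1_outer R) _ _) _.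
  apply: leeD => //.
  apply: le_trans (outer_measure_sigma_subadditive (hausdorff1_outer R) _) _.
  apply: le_trans (ltW tail).
  rewrite le_eqVlt; apply/orP; left; apply/eqP.
  rewrite [RHS]eseries_cond/= [RHS]eseries_mkcond; apply: eq_eseriesr => k _.
  by case: ifP => //; rewrite outer_measure0.
apply: (@le_trans _ _ (H1 B + e%:E + H1 (X `&` ~` [set p | (c < f p)%R]))%E).
  exact: leeD.
rewrite addeAC leeD2r//.
apply: le_trans (@hausdorff1_level_separated c (level n.+1) _ _ _ _ _) _.
- by rewrite ltrDl.
- by move=> p [_ /ltW].
- by move=> p [_ /= /negP]; rewrite -leNgt.
- by apply: H1_le => p [] [].
Qed.

End CaratheodoryLipschitz.

Local Notation plane1 := (caratheodory_type (@hausdorff1_outer R)).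

Lemma measurable_lipschitz (f : R * R -> R) :
  (forall p q, `|f p - f q| <= enorm (p - q)) -> measurable_fun [set: plane1] f.
Proof.
move=> f_lip.
apply: (measurability _ (RGenOInfty.measurableE R)) => _ [_ [c ->] <-].
rewrite setTI; apply: le_caratheodory_measurable => X.
rewrite (_ : f @^-1` _ = [set p | c < f p]); last first.
  by apply/seteqP; split => p /=; rewrite in_itv/= andbT.
exact: caratheodory_lipschitz_le.
Qed.

Lemma ler_enorm1 (p : R * R) : `|p.1| <= enorm p.
Proof. by rewrite -sqrtr_sqr ler_sqrt ?addr_ge0 ?sqr_ge0// lerDl sqr_ge0. Qed.

Lemma ler_enorm2 (p : R * R) : `|p.2| <= enorm p.
Proof. by rewrite -sqrtr_sqr ler_sqrt ?addr_ge0 ?sqr_ge0// lerDr sqr_ge0. Qed.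

Lemma measurable_fst1 : measurable_fun [set: plane1] (fst : R * R -> R).
Proof. by apply: measurable_lipschitz => p q; exact: (ler_enorm1 (p - q)). Qed.

Lemma measurable_snd1 : measurable_fun [set: plane1] (snd : R * R -> R).
Proof. by apply: measurable_lipschitz => p q; exact: (ler_enorm2 (p - q)). Qed.

End LipschitzImages.

(** * Length of bilipschitz images of sets of reals *)

Section BilipschitzCurves.
Variable R : realType.

Section Bilipschitz.
Variables (g : R -> R * R) (c : R) (E : set R).
Hypotheses (c0 : 0 < c) (mE : measurable E).
Local Notation H1 := (@hausdorff1 R).

(** Each piece of a cover of the image pulls back to a subset of [E] of diameter at most [diam / c],
    hence into an interval of that length. The pre-measure at scale 1 suffices, as H^1 dominates
    it. *)
Lemma hausdorff1_expanding_ge :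
  (forall u v, E u -> E v -> c * `|u - v| <= enorm (g u - g v)) ->
  (c%:E * lebesgue_measure E <= H1 (g @` E))%E.
Proof.
move=> g_exp; apply: le_trans (hausdorff1_pre_le _ ltr01).
apply: le_ereal_inf_tmp => _ [U [Ud EU] <-].
pose r i := fine (diam (U i)) / c.
have dfin i : diam (U i) \is a fin_num.
  by rewrite ge0_fin_numE ?diam_ge0// (le_lt_trans (Ud i))// ltry.
have r0 i : 0 <= r i by rewrite divr_ge0// ?fine_ge0 ?diam_ge0// ltW.
pose S i := E `&` g @^-1` U i.
have Sd i u v : S i u -> S i v -> `|u - v| <= r i.
  move=> [Eu Uu] [Ev Uv]; rewrite ler_pdivlMr// mulrC.
  apply: le_trans (g_exp _ _ Eu Ev) _; rewrite -lee_fin fineK//.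
  exact: enorm_diam.
(* When [S i] is empty its infimum is a default value, but [K i] is still an interval of length
   [r i]. *)
pose K i : set R := `[inf (S i), inf (S i) + r i]%classic.
have SK i : S i `<=` K i.
  move=> u Su; have lb : lbound (S i) (u - r i).
    by move=> v Sv; have := Sd _ _ _ Su Sv; rewrite ler_norml => /andP[]; lra.
  rewrite /K/= in_itv/= ge_inf//=; last by exists (u - r i).
  by rewrite -lerBlDr; apply: lb_le_inf => //; exists u.
have EK : E `<=` \bigcup_i K i.
  by move=> u Eu; have [|i _ Ui] := EU (g u); [exists u|exists i => //; exact: SK].
rewrite -lee_pdivlMl//.
have mK i : measurable (K i) by exact: measurable_itv.
apply: le_trans (measure_sigma_subadditive (@lebesgue_measure R) mK mE EK) _.
rewrite -nneseriesZl; last by move=> i _; exact: diam_ge0.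
apply: lee_nneseries => i _; first by [].
have Kr : lebesgue_measure (K i) = (r i)%:E.
  rewrite /K lebesgue_measure_itv/= lte_fin ltrDl; have [ri|ri] := ltP 0 (r i).
    by rewrite EFinD addeAC subee// add0e.
  by congr EFin; apply/le_anti; rewrite r0 ri.
apply: (@le_trans _ _ (r i)%:E); first by rewrite -Kr.
by rewrite /r EFinM fineK// muleC.
Qed.

Hypothesis g_lip : forall u v, E u -> E v -> enorm (g u - g v) <= c * `|u - v|.

Lemma hausdorff1_lipschitz_itv (a b : R) : a <= b ->
  (H1 (g @` (E `&` `]a, b])) <= (c * (b - a))%:E)%E.
Proof.
move=> ab; apply: ge_ereal_sup => _ [d /= d0 <-].
(* Enough pieces for each image to have diameter [c * h <= d]; the successor keeps [N] positive when
   [a = b]. *)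
pose N := (Num.bound (c * (b - a) / d)).+1.
have N0 : (0 : R) < N%:R by rewrite ltr0n.
pose h := (b - a) / N%:R.
have h0 : 0 <= h by rewrite divr_ge0// subr_ge0.
have ch : c * h <= d.
  rewrite /h mulrA ler_pdivrMr// [d * _]mulrC -ler_pdivrMr//.
  apply: (@le_trans _ _ (Num.bound (c * (b - a) / d))%:R); last by rewrite ler_nat.
  by apply/ltW/archi_boundP; rewrite divr_ge0 ?mulr_ge0 ?subr_ge0// ltW.
pose U i := if (i < N)%N then g @` (E `&` `]a + i%:R * h, a + i.+1%:R * h]) else set0.
have Ud i : (diam (U i) <= (if (i < N)%N then c * h else 0)%:E)%E.
  rewrite /U; case: ifP => _; last by rewrite diam0.
  apply: diam_le; first by rewrite mulr_ge0// ltW.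
  move=> _ _ [u [Eu +] <-] [v [Ev +] <-].
  rewrite /= !in_itv/= => /andP[u1 u2] /andP[v1 v2].
  apply: le_trans (g_lip Eu Ev) _; rewrite ler_pM2l// ler_norml.
  move: u1 u2 v1 v2; rewrite -natr1 mulrDl mul1r; lra.
apply: (@le_trans _ _ (\sum_(i <oo) diam (U i))%E).
  apply: ereal_inf_lbound; exists U => //; split.
    move=> i; apply: le_trans (Ud i) _; rewrite lee_fin.
    by case: ifP => // _; exact: ltW.
  move=> _ [u [Eu]] /[swap] <-; rewrite /= in_itv/= => /andP[au ub].
  have hp : 0 < h by rewrite divr_gt0// subr_gt0 (lt_le_trans au).
  have ex : exists k, u <= a + k.+1%:R * h.
    by exists N.-1; rewrite /= /h mulrC divfK ?lt0r_neq0// addrC subrK.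
  case: (ex_minnP ex) => k uk kmin.
  have kN : (k < N)%N.
    rewrite /N ltnS; apply: kmin.
    by rewrite -/N /h mulrC divfK ?lt0r_neq0// addrC subrK.
  exists k => //; rewrite /U kN; exists u => //; split => //=.
  rewrite in_itv/= uk andbT.
  case: k kmin {kN uk} => [_|k kmin]; first by rewrite mul0r addr0.
  by rewrite ltNge; apply/negP => /kmin; rewrite ltnn.
apply: (@le_trans _ _ (\sum_(i <oo) (if (i < N)%N then c * h else 0)%:E)%E).
  by apply: lee_nneseries => i _; [move=> _; exact: diam_ge0|exact: Ud].
rewrite (nneseries_split 0 N); last first.
  by move=> i _; case: ifP => // _; rewrite lee_fin mulr_ge0// ltW.
rewrite add0n [X in (_ + X)%E]eseries0 ?adde0; last first.
  by move=> i Ni _; rewrite ltnNge Ni.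
rewrite big_nat (eq_bigr (fun=> (c * h)%:E)); last by move=> i /andP[_ ->].
rewrite -big_nat sumEFin lee_fin big_const_nat iter_addr_0 subn0 /h.
by rewrite -mulrnAr -(mulr_natr ((b - a) / N%:R)) divfK ?lt0r_neq0.
Qed.

Lemma hausdorff1_lipschitz_le : (H1 (g @` E) <= c%:E * lebesgue_measure E)%E.
Proof.
(* Lebesgue measure unfolds to an infimum over covers by half-open intervals, which reduces the
   claim to one interval. *)
rewrite -lee_pdivrMl//; apply: le_ereal_inf_tmp => _ [A [mA EA] <-].
rewrite lee_pdivrMl//.
have EgA : g @` E `<=` \bigcup_i g @` (E `&` A i).
  by move=> _ [u Eu <-]; have [i _ Ai] := EA _ Eu; exists i => //; exists u.
apply: le_trans (le_outer_measure (hausdorff1_outer R) _ _ EgA) _.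
apply: le_trans (outer_measure_sigma_subadditive (hausdorff1_outer R) _) _.
rewrite -nneseriesZl; last by move=> i _; exact: wlength_ge0.
apply: lee_nneseries => i _.
  by move=> _; exact: (outer_measure_ge0 (hausdorff1_outer R)).
have /ocitvP[->|[[a b /= ab ->]]] := mA i.
  rewrite setI0 image_set0 outer_measure0 mule_ge0 ?lee_fin ?wlength_ge0//.
  exact: ltW.
rewrite wlength_itv_bnd ?(ltW ab)// -EFinM.
exact: hausdorff1_lipschitz_itv (ltW ab).
Qed.

End Bilipschitz.
End BilipschitzCurves.

(** * The area formula for graphs of continuously differentiable functions *)

Section GraphIntegral.
Variable R : realType.

(** Stated for bare set functions because it is applied to indefinite integrals that are not
    packaged as measures. *)
Definition countably_additive (m : set R -> \bar R) := forall F : (set R)^nat,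
  (forall k, measurable (F k)) -> trivIset setT F ->
  m (\bigcup_k F k) = (\sum_(k <oo) m (F k))%E.

(** The intervals with rational end points on which the comparison holds form a countable cover of
    [D]. Once it is made disjoint, countable additivity sums the local inequalities. *)
Lemma le_of_local_le (m1 m2 : set R -> \bar R) (D : set R) (r : R) :
  0 <= r -> m1 set0 = 0%E -> (forall A, (0 <= m1 A)%E) -> (forall A, (0 <= m2 A)%E) ->
  countably_additive m1 -> countably_additive m2 ->
  (forall y, D y -> exists a b, [/\ a < y, y < b &
    forall A, measurable A -> A `<=` `]a, b[ -> (m1 A <= r%:E * m2 A)%E]) ->
  forall A, measurable A -> A `<=` D -> (m1 A <= r%:E * m2 A)%E.
Proof.
move=> r0 m1_0 m1_ge0 m2_ge0 add1 add2 loc A mA AD.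
pose good (p : rat * rat) := forall B, measurable B ->
  B `<=` `](ratr p.1 : R), ratr p.2[ -> (m1 B <= r%:E * m2 B)%E.
pose K n : set R := if unpickle n is Some p then
  if `[< good p >] then `](ratr p.1 : R), ratr p.2[%classic else set0 else set0.
have mI n : measurable (K n).
  by rewrite /K; case: unpickle => // p; case: ifP.
have DI : D `<=` \bigcup_n K n.
  move=> y Dy; have [a [b [ay yb mab]]] := loc _ Dy.
  have /rat_in_itvoo[q1 /itvP q1P] := ay; have /rat_in_itvoo[q2 /itvP q2P] := yb.
  exists (pickle (q1, q2)); first exact: I.
  rewrite /K pickleK asboolT; first by rewrite /= in_itv/= q1P q2P.
  move=> B mB BI; apply: mab => // z /BI /=.
  rewrite !in_itv/= => /andP[z1 z2].
  by rewrite (lt_trans _ z1) ?q1P// (lt_trans z2) ?q2P.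
pose B n := A `&` seqDU K n.
have mB n : measurable (B n) by apply: measurableI => //; exact: seqDU_measurable.
have tB : trivIset setT B by apply: trivIset_setIl; exact: trivIset_seqDU.
have AB : A = \bigcup_n B n.
  by rewrite /B -setI_bigcupr -seqDU_bigcup_eq setIidl//; exact: subset_trans DI.
have le_piece n : (m1 (B n) <= r%:E * m2 (B n))%E.
  have : B n `<=` K n by move=> y [_]; exact: subset_seqDU.
  have BT : B n `<=` set0 -> (m1 (B n) <= r%:E * m2 (B n))%E.
    by rewrite subset0 => ->; rewrite m1_0 mule_ge0.
  rewrite /K; case: unpickle => [p|//]; case: asboolP => // gp BI.
  exact: gp.
rewrite AB add1// add2// -nneseriesZl//.
by apply: lee_nneseries => i _.
Qed.

Lemma le_of_le_mul_gt1 (x y : \bar R) : (0 <= y)%E ->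
  (forall r : R, 1 < r -> (x <= r%:E * y)%E) -> (x <= y)%E.
Proof.
case: y => [y| |]// y0 xy; last exact: leey.
rewrite lee_fin in y0; apply/lee_addgt0Pr => e e0.
have y1 : 0 < y + 1 by rewrite ltr_wpDl.
apply: le_trans (xy (1 + e / (y + 1)) _) _; first by rewrite ltrDl divr_gt0.
rewrite -EFinM -EFinD lee_fin mulrDl mul1r lerD2l mulrAC ler_pdivrMr//.
by rewrite ler_pM2l// lerDl.
Qed.

Lemma le_integral_of_le_measure (m1 m2 : {measure set (measurableTypeR R) -> \bar R}) (k : {nonneg R})
    (A : set R) (f : R -> \bar R) :
  measurable A -> measurable_fun setT f -> (forall y, 0 <= f y)%E ->
  (forall B, measurable B -> B `<=` A -> (m1 B <= k%:num%:E * m2 B)%E) ->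
  (\int[m1]_(y in A) f y <= k%:num%:E * \int[m2]_(y in A) f y)%E.
Proof.
move=> mA mf f0 m12; rewrite -ge0_integral_mscale//; last exact: measurable_funTS.
rewrite [leLHS](eq_measure_integral (mrestr m1 mA)); last first.
  by move=> B mB BA; rewrite /= /mrestr setIidl.
rewrite [leRHS](eq_measure_integral (mrestr (mscale k m2) mA)); last first.
  by move=> B mB BA; rewrite /= /mrestr setIidl.
apply: ge0_le_measure_integral => // S mS.
by apply: m12; [exact: measurableI|exact: subIsetr].
Qed.

Section Graph.
Variables (D : set R) (x x' : R -> R).
Hypotheses (oD : open D) (dx : forall y, D y -> is_derive y 1 x (x' y))
  (cx' : forall y, D y -> {for y, continuous x'}).
Local Notation H1 := (@hausdorff1_measure R).
Local Notation plane1 := (caratheodory_type (@hausdorff1_outer R)).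
Local Notation lambda := (@lebesgue_measure R).
Let g y := (x y, y).
Let J y := Num.sqrt (1 + x' y ^+ 2).

Let J_ge1 y : 1 <= J y.
Proof. by rewrite -[leLHS]sqrtr1 ler_sqrt ?addr_ge0 ?sqr_ge0// lerDl sqr_ge0. Qed.

Let J_gt0 y : 0 < J y. Proof. exact: lt_le_trans ltr01 (J_ge1 y). Qed.

Let x_cont y : D y -> {for y, continuous x}.
Proof.
move=> Dy; have [dxy _] := dx Dy.
exact/differentiable_continuous/derivable1_diffP.
Qed.

Let J_cont y : D y -> {for y, continuous J}.
Proof.
move=> Dy; apply: continuous_comp; last exact: sqrt_continuous.
apply: cvgD; first exact: cvg_cst.
by rewrite /=; under eq_fun do rewrite expr2; rewrite expr2; apply: cvgM; exact: cx'.
Qed.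

Lemma measurable_graph_fun : measurable_fun D x.
Proof. by apply: open_continuous_measurable_fun => // y /set_mem; exact: x_cont. Qed.

Let mD : measurable D. Proof. exact: open_measurable. Qed.

Let mJ : measurable_fun D J.
Proof. by apply: open_continuous_measurable_fun => // y /set_mem; exact: J_cont. Qed.

Lemma graph_setI E : E `<=` D -> g @` E = (g @` D) `&` snd @^-1` E.
Proof.
move=> ED; apply/seteqP; split=> [_ [y Ey <-]|k [[y Dy <-] /= Ey]]; last by exists y.
by split => //; exists y => //; exact: ED.
Qed.

(** Over the strip above [D] the graph is the zero set of [k.1 - x k.2], a measurable function since
    both coordinates are Lipschitz. *)
Lemma measurable_graph : measurable (g @` D : set plane1).
Proof.
have -> : g @` D = (snd @^-1` D : set plane1)
    `&` ((fun k : plane1 => k.1 - x k.2) @^-1` [set 0]).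
  apply/seteqP; split=> [_ [y Dy <-]|[k1 k2] /= [Dk /eqP]].
    by split => //=; rewrite subrr.
  by rewrite subr_eq0 => /eqP ->; exists k2.
have mS : measurable (snd @^-1` D : set plane1).
  by rewrite -[X in measurable X]setTI; exact: measurable_snd1.
have /(_ mS [set 0]) : @measurable_fun _ _ plane1 R (snd @^-1` D) (fun k => k.1 - x k.2).
  apply: measurable_funB; first exact/measurable_funTS/measurable_fst1.
  apply: (measurable_comp mD _ measurable_graph_fun); first by move=> _ [k Dk <-].
  exact/measurable_funTS/measurable_snd1.
by apply; exact: measurable_set1.
Qed.

Lemma graph_chord a b u v : `]a, b[ `<=` D -> a < u -> u <= v -> v < b ->
  exists2 c, a < c < b & enorm (g v - g u) = J c * (v - u).
Proof.
move=> abD au uv vb.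
have sub z : z \in `[u, v] -> D z.
  rewrite in_itv/= => /andP[z1 z2]; apply: abD; rewrite /= in_itv/=.
  by rewrite (lt_le_trans au)//= (le_lt_trans z2).
have [||c cuv E] := @MVT_segment _ x x' u v uv.
- by move=> z /subset_itv_oo_cc/sub; exact: dx.
- apply: continuous_in_subspaceT => z /set_mem; exact: (fun h => x_cont (sub _ h)).
exists c.
  move: cuv; rewrite in_itv/= => /andP[c1 c2].
  by rewrite (lt_le_trans au)//= (le_lt_trans c2).
rewrite /enorm /= E exprMn -[X in _ + X]mul1r -mulrDl addrC sqrtrM.
  by rewrite sqrtr_sqr ger0_norm// subr_ge0.
by rewrite addr_ge0 ?sqr_ge0.
Qed.

(** Near [y] the function [J] stays within a factor [r] of [J y]. As a chord has length [J] at an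
    intermediate point times the increment, the graph map is bilipschitz there with constants
    [J y / r] and [J y * r]. *)
Lemma graph_local_bounds y r : D y -> 1 < r -> exists a b,
  [/\ a < y, y < b, `]a, b[ `<=` D, forall z, a < z < b -> J y / r <= J z <= J y * r &
   forall A, measurable A -> A `<=` `]a, b[ ->
     ((J y / r)%:E * lambda A <= hausdorff1 (g @` A))%E /\
     (hausdorff1 (g @` A) <= (J y * r)%:E * lambda A)%E].
Proof.
move=> Dy r1; have r0 : 0 < r by exact: lt_trans r1.
have : \forall z \near y, D z /\ J y / r < J z < J y * r.
  have nD : nbhs y D by apply: open_nbhs_nbhs.
  have n1 : \forall z \near y, J y / r < J z.
    have /cvgr_gt := J_cont Dy; apply.
    by rewrite ltr_pdivrMr// ltr_pMr// J_gt0.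
  have n2 : \forall z \near y, J z < J y * r.
    by have /cvgr_lt := J_cont Dy; apply; rewrite ltr_pMr// J_gt0.
  by near=> z; split; [near: z|apply/andP; split; near: z].
move=> /nbhs_ballP[e /= e0 ballD].
have inD z : y - e < z < y + e -> D z /\ J y / r < J z < J y * r.
  move=> /andP[z1 z2]; apply: ballD; rewrite /ball/= ltr_norml.
  by apply/andP; split; lra.
exists (y - e), (y + e); split; [lra|lra| | |].
- by move=> z; rewrite /= in_itv/= => /inD[].
- by move=> z /inD[_ /andP[/ltW -> /ltW ->]].
have abD : `]y - e, y + e[ `<=` D by move=> z; rewrite /= in_itv/= => /inD[].
have chord u v : u \in `]y - e, y + e[ -> v \in `]y - e, y + e[ ->
    J y / r * `|u - v| <= enorm (g u - g v) /\ enorm (g u - g v) <= J y * r * `|u - v|.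
  wlog uv : u v / v <= u => [H|].
    have [/H//|/ltW vu] := leP v u; move=> hu hv.
    have enormB p q : enorm (p - q) = @enorm R (q - p).
      by rewrite /enorm/= -(sqrrN (p.1 - q.1)) -(sqrrN (p.2 - q.2)) !opprB.
    by rewrite distrC enormB; exact: H.
  rewrite !in_itv/= => /andP[_ u2] /andP[v1 _].
  have [c cab ->] := graph_chord abD v1 uv u2.
  have [_ /andP[c1 c2]] := inD _ cab.
  rewrite ger0_norm ?subr_ge0//.
  by split; apply: ler_wpM2r; rewrite ?subr_ge0// ltW.
move=> A mA Aab; split.
  apply: hausdorff1_expanding_ge => //; first by rewrite divr_gt0.
  by move=> u v Au Av; have [] := chord u v (Aab _ Au) (Aab _ Av).
apply: hausdorff1_lipschitz_le => //; first by rewrite mulr_gt0.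
by move=> u v Au Av; have [] := chord u v (Aab _ Au) (Aab _ Av).
Unshelve. all: by end_near. Qed.

Let sndR : plane1 -> measurableTypeR R := snd.

Let msndR : measurable_fun [set: plane1] sndR.
Proof. exact: measurable_snd1. Qed.

(** Transporting H^1 on the graph to the line by the second projection turns the area formula into a
    comparison of two measures on the line. *)
Let nu : {measure set (measurableTypeR R) -> \bar R} :=
  measure_function_pushforward__canonical__measure_function_Measure
    (mrestr H1 measurable_graph) msndR.

Let nuE E : E `<=` D -> nu E = hausdorff1 (g @` E).
Proof. by move=> ED; rewrite graph_setI// setIC. Qed.

Section Area.
Variable f : R -> \bar R.
Hypotheses (mf : measurable_fun setT f) (f0 : forall y, (0 <= f y)%E).
Let fJ y := (f y * (J y)%:E)%E.

Let fJ0 y : (0 <= fJ y)%E.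
Proof. by rewrite mule_ge0// lee_fin ltW. Qed.

Let mfJ : measurable_fun D fJ.
Proof.
apply: emeasurable_funM; first exact: measurable_funTS.
exact/measurable_EFinP.
Qed.

Let additive_restr (m : {measure set (measurableTypeR R) -> \bar R}) (h : R -> \bar R) :
  measurable_fun D h -> (forall y, 0 <= h y)%E ->
  countably_additive (fun A => \int[m]_(y in A `&` D) h y)%E.
Proof.
move=> mh h0 F mF tF; have mFD k : measurable (F k `&` D) by exact: measurableI.
have sub : \bigcup_k (F k `&` D) `<=` D by move=> y [k _ []].
rewrite setI_bigcupl; apply: ge0_integral_bigcup => //.
  exact: (measurable_funS mD sub mh).
exact: trivIset_setIr.
Qed.

(** On a short interval [J] is constant up to a factor [r], and [nu] is [J y] times Lebesgue measure
    up to the same factor. The two errors multiply to [r * r], and [le_of_local_le] glues the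
    intervals. *)
Lemma graph_integral_le r : 1 < r ->
  (\int[nu]_(y in D) f y <= (r * r)%:E * \int[lambda]_(y in D) fJ y)%E /\
  (\int[lambda]_(y in D) fJ y <= (r * r)%:E * \int[nu]_(y in D) f y)%E.
Proof.
move=> r1; have r0 : 0 < r by exact: lt_trans r1.
have loc y : D y -> exists a b, [/\ a < y, y < b &
  forall A, measurable A -> A `<=` `]a, b[ ->
    (\int[nu]_(y in A `&` D) f y <= (r * r)%:E * \int[lambda]_(y in A `&` D) fJ y)%E /\
    (\int[lambda]_(y in A `&` D) fJ y <= (r * r)%:E * \int[nu]_(y in A `&` D) f y)%E].
  move=> Dy; have [a [b [ay yb abD Jab bnd]]] := graph_local_bounds Dy r1.
  exists a, b; split => // A mA Aab.
  have AD : A `<=` D by exact: subset_trans abD.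
  have inab z : A z -> a < z < b by move=> /Aab; rewrite /= in_itv.
  rewrite setIidl//; have k1 : 0 <= J y * r by rewrite ltW// mulr_gt0.
  have k2 : 0 <= r / J y by rewrite ltW// divr_gt0.
  have mfA : measurable_fun A f by exact: measurable_funTS.
  have mfJA : measurable_fun A fJ by exact: measurable_funS mfJ.
  have le1 : (\int[nu]_(y in A) f y <= (J y * r)%:E * \int[lambda]_(y in A) f y)%E.
    apply: (@le_integral_of_le_measure nu lambda (NngNum k1) A f mA mf f0) => B mB BA.
    by rewrite nuE; [apply: (bnd B mB _).2|]; exact: subset_trans BA _.
  have le2 : (\int[lambda]_(y in A) f y <= (r / J y)%:E * \int[nu]_(y in A) f y)%E.
    apply: (@le_integral_of_le_measure lambda nu (NngNum k2) A f mA mf f0) => B mB BA.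
    rewrite nuE; last exact: subset_trans BA _.
    rewrite /= -invf_div.
    by rewrite lee_pdivlMl ?divr_gt0//; apply: (bnd B mB _).1; exact: subset_trans BA _.
  have le3 : ((J y / r)%:E * \int[lambda]_(y in A) f y <= \int[lambda]_(y in A) fJ y)%E.
    rewrite -ge0_integralZl_EFin//; last by rewrite ltW// divr_gt0.
    apply: ge0_le_integral => //.
    - by move=> z _; rewrite mule_ge0// lee_fin ltW// divr_gt0.
    - exact: emeasurable_funM.
    - move=> z /inab/Jab /andP[h _].
      by rewrite /fJ muleC; apply: lee_wpmul2l => //; rewrite lee_fin.
  have le4 : (\int[lambda]_(y in A) fJ y <= (J y * r)%:E * \int[lambda]_(y in A) f y)%E.
    rewrite -ge0_integralZl_EFin//.
    apply: ge0_le_integral => //.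
    - exact: emeasurable_funM.
    - move=> z /inab/Jab /andP[_ h].
      by rewrite /fJ [leRHS]muleC; apply: lee_wpmul2l => //; rewrite lee_fin.
  split.
    apply: le_trans le1 _; rewrite (_ : J y * r = r * r * (J y / r)); last first.
      by field; rewrite gt_eqF.
    by rewrite [X in (X * _)%E]EFinM -muleA; apply: lee_wpmul2l => //; rewrite lee_fin mulr_ge0// ltW.
  apply: le_trans le4 _; rewrite (_ : r * r = J y * r * (r / J y)); last first.
    by field; rewrite gt_eqF.
  by rewrite [X in (_ <= X * _)%E]EFinM -muleA; apply: lee_wpmul2l.
have rr : 0 <= r * r by rewrite mulr_ge0// ltW.
have set0D (m : {measure set (measurableTypeR R) -> \bar R}) h : (\int[m]_(y in set0 `&` D) h y = 0)%E.
  by rewrite set0I integral_set0.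
rewrite -[D]setIid; split.
  apply: (@le_of_local_le (fun A => \int[nu]_(y in A `&` D) f y)%E
    (fun A => \int[lambda]_(y in A `&` D) fJ y)%E D _ rr (set0D _ _)) => //.
  - by move=> A; exact: integral_ge0.
  - by move=> A; exact: integral_ge0.
  - by apply: additive_restr => //; exact: measurable_funTS.
  - exact: additive_restr.
  - by move=> y /loc[a [b [ay yb h]]]; exists a, b; split => // A mA /(h _ mA)[].
apply: (@le_of_local_le (fun A => \int[lambda]_(y in A `&` D) fJ y)%E
  (fun A => \int[nu]_(y in A `&` D) f y)%E D _ rr (set0D _ _)) => //.
- by move=> A; exact: integral_ge0.
- by move=> A; exact: integral_ge0.
- exact: additive_restr.
- by apply: additive_restr => //; exact: measurable_funTS.
- by move=> y /loc[a [b [ay yb h]]]; exists a, b; split => // A mA /(h _ mA)[].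
Qed.

Lemma graph_integral :
  (\int[H1]_(k in g @` D) f k.2 = \int[lambda]_(y in D) (f y * (J y)%:E))%E.
Proof.
pose mu1 : {measure set plane1 -> \bar R} := mrestr H1 measurable_graph.
have mS : measurable (sndR @^-1` D : set plane1).
  by rewrite -[X in measurable X]setTI; exact: msndR.
have mfD : @measurable_fun _ _ (measurableTypeR R) _ D f by exact: measurable_funTS.
have fD0 : {in D, forall y, (0 <= f y)%E} by move=> y _; exact: f0.
have E1 := @ge0_integral_pushforward _ _ plane1 (measurableTypeR R) R sndR msndR
  mu1 D f mD mfD fD0.
(* The pushforward integrates over the whole strip above [D]; the strip off the graph is null for
   the restricted measure. *)
pose N : set plane1 := (sndR @^-1` D) `\` (g @` D).
have mN : measurable N by apply: measurableD => //; exact: measurable_graph.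
have mfS : @measurable_fun _ _ plane1 _ (sndR @^-1` D) (f \o sndR).
  by apply: measurable_funTS; exact: measurableT_comp msndR.
have N0 : mu1 N = 0%E.
  rewrite /mu1/= /mrestr (_ : N `&` _ = set0) ?measure0//.
  by apply/seteqP; split=> // k [[_ +] gk].
have E2 := ge0_negligible_integral mN mS mfS (fun k _ => f0 (sndR k)) N0.
have gS : g @` D `<=` sndR @^-1` D by move=> _ [y Dy <-].
have SN : (sndR @^-1` D) `\` N = g @` D by rewrite setDD setIidr.
have -> : (\int[H1]_(k in g @` D) f k.2 = \int[nu]_(y in D) f y)%E.
  refine (etrans _ (esym (etrans E1 E2))); rewrite SN.
  by apply: eq_measure_integral => A mA Ag; rewrite /mu1/= /mrestr setIidl.
have nu0 : (0 <= \int[nu]_(y in D) f y)%E by exact: integral_ge0.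
have lam0 : (0 <= \int[lambda]_(y in D) fJ y)%E by exact: integral_ge0.
(* Taking the factor [Num.sqrt s] makes the error [r * r] an arbitrary [s > 1]. *)
have sq (s : R) : 1 < s -> 1 < Num.sqrt s /\ Num.sqrt s * Num.sqrt s = s.
  move=> s1; rewrite -expr2 sqr_sqrtr; last by rewrite ltW// (lt_trans ltr01).
  by split => //; rewrite -[ltLHS]sqrtr1 ltr_sqrt// (lt_trans ltr01).
apply/le_anti/andP; split; apply: le_of_le_mul_gt1 => // s /sq[/graph_integral_le + sE];
  by rewrite sE => -[].
Qed.

End Area.
End Graph.
End GraphIntegral.

(** * Resonant triads and the kernel bound *)

Section Angles.
Variable R : realType.
Implicit Types (k : R * R) (a b c : mode R).

Lemma enorm_ge0 k : 0 <= enorm k. Proof. exact: sqrtr_ge0. Qed.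

Lemma enorm_sqr k : enorm k ^+ 2 = k.1 ^+ 2 + k.2 ^+ 2.
Proof. by rewrite sqr_sqrtr// addr_ge0 ?sqr_ge0. Qed.

Lemma enorm_eq0 k : (enorm k == 0) = (k == 0).
Proof.
case: k => k1 k2; rewrite sqrtr_eq0 -[RHS]/((k1 == 0) && (k2 == 0)) /=.
have := sqr_ge0 k1; have := sqr_ge0 k2 => h2 h1.
apply/idP/idP => [h|/andP[/eqP-> /eqP->]]; last by rewrite expr0n/= addr0.
rewrite -(sqrf_eq0 k1) -(sqrf_eq0 k2) !eq_le h1 h2 !andbT; apply/andP; split; lra.
Qed.

Lemma polar_exists k : exists t, k = (enorm k * cos t, enorm k * sin t).
Proof.
have [/eqP k0|k0] := boolP (k == 0).
  exists 0; have := eqxx (0 : R * R); rewrite -enorm_eq0 k0 => /eqP ->.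
  by rewrite !mul0r.
have n0 : 0 < enorm k by rewrite lt0r enorm_eq0 k0 enorm_ge0.
have c2 : (k.1 / enorm k) ^+ 2 + (k.2 / enorm k) ^+ 2 = 1.
  by rewrite !expr_div_n -mulrDl -enorm_sqr divff// sqrf_eq0 gt_eqF.
have cle : -1 <= k.1 / enorm k <= 1.
  rewrite -ler_norml -(@ler_pXn2r _ 2) ?nnegrE// -normrX expr1n.
  by rewrite ger0_norm ?sqr_ge0// -c2 lerDl sqr_ge0.
have sE : sin (acos (k.1 / enorm k)) = `|k.2 / enorm k|.
  by rewrite sin_acos// -sqrtr_sqr; congr Num.sqrt; move: c2; lra.
have kE : k = (enorm k * (k.1 / enorm k), enorm k * (k.2 / enorm k)).
  by rewrite !(mulrC (enorm k)) !divfK ?gt_eqF//; case: (k).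
have [k2|k2] := leP 0 k.2.
  exists (acos (k.1 / enorm k)).
  by rewrite acosK ?in_itv/= ?cle// sE ger0_norm// divr_ge0// ltW.
exists (- acos (k.1 / enorm k)).
rewrite cosN sinN acosK ?in_itv/= ?cle// sE ltr0_norm ?opprK//.
by rewrite pmulr_llt0 ?invr_gt0.
Qed.

Lemma angleP k : k = (enorm k * cos (angle k), enorm k * sin (angle k)).
Proof.
exact: (@xgetPex _ 0 [set t | k = (enorm k * cos t, enorm k * sin t)] (polar_exists k)).
Qed.

Section Cutoff.
Variables (eps0 epsh : R) (chi : R -> R).
Hypotheses (e00 : 0 < eps0) (eh0 : 0 < epsh) (chiP : cutoff eps0 epsh chi).

Lemma chih_bounds a : 0 <= chih chi a <= 1.
Proof. exact: (cutoff_range chiP). Qed.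

Lemma chih_support a : chih chi a != 0 ->
  eps0 * enorm a.2 <= `|a.2.1| /\ epsh * enorm a.2 <= `|a.2.2|.
Proof.
move=> chia; have [c s] : eps0 <= `|cos (angle a.2)| /\ epsh <= `|sin (angle a.2)|.
  by apply: (cutoff_support chiP); exact: subset_closure.
rewrite [X in `|X.1|](angleP a.2) [X in `|X.2|](angleP a.2)/= !normrM.
by rewrite !(mulrC _ (enorm _)) (ger0_norm (enorm_ge0 _)) !ler_wpM2l ?enorm_ge0.
Qed.

Lemma sgn_norm (s : bool) : `|sgn R s| = 1.
Proof. by case: s; rewrite /= ?normrN normr1. Qed.

Lemma sgn_sqr (s : bool) : sgn R s * sgn R s = 1.
Proof. by case: s; rewrite /= ?mulrNN mulr1. Qed.

(** [omegah] has modulus |cos| / |sin| of the polar angle, and the cut-off keeps both terms of this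
    quotient away from 0. *)
Lemma omegah_bounds a : chih chi a != 0 -> a.2 != 0 ->
  a.2.2 != 0 /\ eps0 <= `|omegah a| <= epsh^-1.
Proof.
move=> /chih_support[h1 h2] a0.
have n0 : 0 < enorm a.2 by rewrite lt0r enorm_eq0 a0 enorm_ge0.
have q0 : 0 < `|a.2.2| by apply: lt_le_trans h2; rewrite mulr_gt0.
have le1 : `|a.2.1| <= enorm a.2.
  by rewrite -sqrtr_sqr ler_sqrt ?addr_ge0 ?sqr_ge0// lerDl sqr_ge0.
have le2 : `|a.2.2| <= enorm a.2.
  by rewrite -sqrtr_sqr ler_sqrt ?addr_ge0 ?sqr_ge0// lerDr sqr_ge0.
split; first by rewrite -normr_gt0.
rewrite /omegah normrM sgn_norm mul1r normrM normfV normr_id.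
apply/andP; split; first by rewrite ler_pdivlMr// (le_trans _ h1)// ler_pM2l.
by rewrite ler_pdivrMr// mulrC ler_pdivlMr// mulrC (le_trans _ h2)// ler_pM2l.
Qed.

End Cutoff.
End Angles.

Section ResonantTriads.
Variable R : realType.


(* With [k1 = w * s], the two resonance conditions say that [w] is proportional
   to the vector of differences of slownesses. *)
Lemma slowness_diff_le (e0 eh wa wb wc sa sb sc : R) : 0 < e0 -> 0 < eh ->
  e0 <= `|wb| -> `|wa| <= eh^-1 -> wa + wb + wc = 0 ->
  wa * sa + wb * sb + wc * sc = 0 ->
  `|sb - sc| <= (e0 * eh)^-1 * `|sc - sa|.
Proof.
move=> e00 eh0 hb ha w0 ws0.
have E : wb * (sb - sc) = wa * (sc - sa).
  have wcE : wc = - wa - wb by lra.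
  by move: ws0; rewrite wcE; lra.
have H : `|wb| * `|sb - sc| = `|wa| * `|sc - sa| by rewrite -!normrM E.
rewrite invfM -mulrA ler_pdivlMl//.
apply: (@le_trans _ _ (`|wb| * `|sb - sc|)); first exact: ler_wpM2r.
by rewrite H ler_wpM2r.
Qed.

(** If [a] and [c] have the same sign, their slownesses differ by at most [|kb|], because
    [ka + kc = - kb]. The other two differences are then comparable to this one, and the sum is
    [3 * sb] minus them. If the signs are opposite, [sa + sc] is itself such a difference. *)
Lemma slowness_sum_le (e0 eh wa wb wc : R) (sga sgb sgc : bool) (ka kb kc : R) :
  0 < e0 -> 0 < eh ->
  e0 <= `|wa| <= eh^-1 -> e0 <= `|wb| <= eh^-1 -> e0 <= `|wc| <= eh^-1 ->
  ka + kb + kc = 0 -> wa + wb + wc = 0 ->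
  wa * (sgn R sga * `|ka|) + wb * (sgn R sgb * `|kb|) + wc * (sgn R sgc * `|kc|) = 0 ->
  `|sgn R sga * `|ka| + sgn R sgb * `|kb| + sgn R sgc * `|kc| |
    <= (3 + 2 * (e0 * eh)^-1) * `|kb|.
Proof.
move=> e00 eh0 /andP[a1 a2] /andP[b1 b2] /andP[c1 c2] k0 w0 ws0.
set sa := sgn R sga * `|ka| in ws0 *; set sb := sgn R sgb * `|kb| in ws0 *.
set sc := sgn R sgc * `|kc| in ws0 *.
have P0 : 0 <= (e0 * eh)^-1 by rewrite invr_ge0 mulr_ge0// ltW.
have nb := normr_ge0 kb.
have tri : `| `|ka| - `|kc| | <= `|kb|.
  have -> : `|kb| = `|ka + kc|.
    by rewrite -normrN; congr (`| _ |); lra.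
  rewrite -(normrN kc); apply: le_trans (ler_dist_dist _ _) _.
  by rewrite opprK.
have [E|NE] := eqVneq sga sgc.
  have dca : `|sc - sa| <= `|kb|.
    by rewrite /sc /sa E -mulrBr normrM sgn_norm mul1r distrC.
  have dbc : `|sb - sc| <= (e0 * eh)^-1 * `|kb|.
    apply: le_trans (slowness_diff_le e00 eh0 b1 a2 w0 ws0) _.
    by rewrite ler_wpM2l.
  have dba : `|sb - sa| <= (e0 * eh)^-1 * `|kb|.
    have := @slowness_diff_le e0 eh wc wb wa sc sb sa e00 eh0 b1 c2.
    move=> /(_ _ _)/le_trans; apply; [lra|lra|].
    by rewrite distrC ler_wpM2l.
  have nsb : `|sb| = `|kb| by rewrite /sb normrM sgn_norm mul1r normr_id.
  have -> : sa + sb + sc = 3 * sb - (sb - sa) - (sb - sc) by lra.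
  apply: le_trans (ler_normB _ _) _.
  apply: (@le_trans _ _ (3 * `|kb| + (e0 * eh)^-1 * `|kb| + (e0 * eh)^-1 * `|kb|)).
    apply: lerD => //; apply: le_trans (ler_normB _ _) _; apply: lerD => //.
    by rewrite normrM nsb ger0_norm.
  lra.
have Esgn : sgn R sgc = - sgn R sga.
  by case: (sga) (sgc) NE => -[]//= _; rewrite ?opprK.
have -> : sa + sb + sc = sgn R sga * (`|ka| - `|kc|) + sb.
  by rewrite /sa /sc Esgn; lra.
apply: le_trans (ler_normD _ _) _; rewrite !normrM !sgn_norm !mul1r normr_id.
apply: (@le_trans _ _ (`|kb| + `|kb|)); first exact: lerD.
by have := mulr_ge0 P0 nb; lra.
Qed.

(** [X] stands for the cross product, [d] for the slowness difference and [S] for the slowness sum.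
    Using the bounds on [X] once each gives [X ^+ 2] a factor [ub * min(ub, uc)], and
    [min(ub, uc) * (ub + uc) <= 2 * ub * uc] cancels the denominator. *)
Lemma cubic_bound (ua ub uc X d S M P : R) : 0 < ua -> 0 < ub -> 0 < uc ->
  0 <= X -> 0 <= d -> 0 <= S -> 0 <= M -> 0 <= P ->
  X <= M * (ua * ub) -> X <= M * (ua * uc) -> d <= ub + uc -> S <= P * ub ->
  X ^+ 2 * d * S ^+ 2 / (ua ^+ 2 * ub * uc) <= 2 * M ^+ 2 * P ^+ 2 * ub ^+ 3.
Proof.
move=> ua0 ub0 uc0 X0 d0 S0 M0 P0 X1 X2 dle Sle.
rewrite ler_pdivrMr ?mulr_gt0 ?exprn_gt0//.
have S2 : S ^+ 2 <= P ^+ 2 * ub ^+ 2.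
  by rewrite -exprMn lerXn2r ?nnegrE// mulr_ge0// ltW.
pose m := Num.min ub uc.
have m0 : 0 < m by rewrite lt_min ub0.
have Xm : X ^+ 2 <= M ^+ 2 * ua ^+ 2 * (ub * m).
  rewrite expr2; apply: le_trans (ler_pM X0 X0 X1 (_ : X <= M * (ua * m))) _.
    by rewrite /m; case: (leP ub uc).
  by rewrite le_eqVlt; apply/orP; left; apply/eqP; ring.
have dm : m * d <= 2 * ub * uc.
  apply: le_trans (ler_wpM2l (ltW m0) dle) _.
  rewrite /m; case: (leP ub uc) => h.
    have := ler_wpM2l (ltW ub0) h; lra.
  have := ler_wpM2l (ltW uc0) (ltW h); lra.
apply: (@le_trans _ _ (M ^+ 2 * ua ^+ 2 * (ub * m) * d * (P ^+ 2 * ub ^+ 2))).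
  apply: ler_pM => //; rewrite ?mulr_ge0 ?sqr_ge0//.
  by apply: ler_wpM2r.
rewrite [leLHS](_ : _ = (M ^+ 2 * ua ^+ 2 * P ^+ 2 * ub ^+ 3) * (m * d)); last by ring.
rewrite [leRHS](_ : _ = (M ^+ 2 * ua ^+ 2 * P ^+ 2 * ub ^+ 3) * (2 * ub * uc)); last by ring.
by apply: ler_wpM2l => //; rewrite !mulr_ge0 ?sqr_ge0// ltW.
Qed.

Lemma cross_le (eh : R) (k k' : R * R) : `|k.1| <= eh^-1 * `|k.2| ->
  `|k'.1| <= eh^-1 * `|k'.2| -> `|cross k k'| <= 2 / eh * (`|k.2| * `|k'.2|).
Proof.
move=> h h'; rewrite /cross; apply: le_trans (ler_normB _ _) _; rewrite !normrM.
have := ler_wpM2r (normr_ge0 k'.2) h; have := ler_wpM2l (normr_ge0 k.2) h'.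
lra.
Qed.

End ResonantTriads.

(** * The weight on the parametrized resonant curve *)

Section CurveWeight.
Variable R : realType.

Section CurveParametrization.
Variables (sb sc : bool) (a : mode R) (y : R).

(* For fixed [y = k.2] the resonance function is affine in [k.1], with this slope. *)
Definition Xih_slope : R := sgn R sb / `|y| - sgn R sc / `|- a.2.2 - y|.

Definition curve_x : R := (sgn R sc * a.2.1 / `|- a.2.2 - y| - omegah a) / Xih_slope.

Definition curve_b : mode R := (sb, (curve_x, y)).
Definition curve_c : mode R := (sc, (- a.2.1 - curve_x, - a.2.2 - y)).

(* Vanishes off the curve: if [y = 0] or [- a.2.2 - y = 0] then [Vtilde] is
   divided by 0, and if the slope is 0 then so is the outer denominator. *)
Definition curve_weight (chi : R -> R) : R :=
  chih chi a * chih chi curve_b * chih chi curve_c *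
  Gammah a curve_b curve_c ^+ 2 * omegah a / `|Xih_slope|.

End CurveParametrization.

(** The first factor comes from [Vtilde ^+ 2 / omegah a]. The second is the constant of
    [cubic_bound], with [M] the cross product bound and [P] that of [slowness_sum_le]. *)
Definition cubic_constant (eps0 epsh : R) : R :=
  pi ^+ 2 * eps0^-1 * (2 * (2 / epsh) ^+ 2 * (3 + 2 * (eps0 * epsh)^-1) ^+ 2).

Section WeightBound.
Variables (eps0 epsh : R) (chi : R -> R).
Hypotheses (e00 : 0 < eps0) (eh0 : 0 < epsh) (chiP : cutoff eps0 epsh chi).
Variables (sb sc : bool) (a : mode R) (y : R).
Local Notation x := (curve_x sb sc a y).
Local Notation r := (- a.2.2 - y).
Local Notation b := (curve_b sb sc a y).
Local Notation c := (curve_c sb sc a y).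
Local Notation slope := (Xih_slope sb sc a y).
Local Notation W := (curve_weight sb sc a y chi).

Lemma cubic_constant_ge0 : 0 <= cubic_constant eps0 epsh.
Proof.
apply: mulr_ge0; first by apply: mulr_ge0; rewrite ?sqr_ge0 ?invr_ge0 ?ltW.
by apply: mulr_ge0; rewrite ?sqr_ge0//; apply: mulr_ge0; rewrite ?sqr_ge0.
Qed.

Hypothesis a0 : a.2 != 0.
Hypothesis W0 : W != 0.

Lemma curve_weight_neq0 :
  [/\ chih chi a != 0, chih chi b != 0 & chih chi c != 0] /\
  [/\ y != 0, r != 0 & slope != 0].
Proof.
move: W0; rewrite /curve_weight.
have [->|ca] := eqVneq (chih chi a) 0; first by rewrite !mul0r eqxx.
have [->|cb] := eqVneq (chih chi b) 0; first by rewrite !mulr0 !mul0r eqxx.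
have [->|cc] := eqVneq (chih chi c) 0; first by rewrite !mulr0 !mul0r eqxx.
have [->|s0] := eqVneq slope 0; first by rewrite normr0 invr0 mulr0 eqxx.
rewrite /Gammah /Vtilde /=.
have [->|y0] := eqVneq y 0.
  by rewrite normr0 mulr0 mul0r invr0 !mulr0 !mul0r expr0n/= mulr0 !mul0r eqxx.
have [->|r0] := eqVneq r 0; last by [].
by rewrite normr0 mulr0 invr0 !mulr0 !mul0r expr0n/= mulr0 !mul0r eqxx.
Qed.

Lemma curve_omegah_bounds : [/\ a.2.2 != 0, eps0 <= `|omegah a| <= epsh^-1,
  eps0 <= `|omegah b| <= epsh^-1 & eps0 <= `|omegah c| <= epsh^-1].
Proof.
have [[ca cb cc] [y0 r0 _]] := curve_weight_neq0.
have [q0 wa] := omegah_bounds e00 eh0 chiP ca a0.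
have b0 : b.2 != 0 by apply: contra_neq y0 => /(congr1 snd).
have c0 : c.2 != 0 by apply: contra_neq r0 => /(congr1 snd).
have [_ wb] := omegah_bounds e00 eh0 chiP cb b0.
by have [_ wc] := omegah_bounds e00 eh0 chiP cc c0.
Qed.

Lemma curve_resonant : slope != 0 -> omegah a + omegah b + omegah c = 0.
Proof.
move=> s0; have : x * slope = sgn R sc * a.2.1 / `|r| - omegah a by rewrite /curve_x divfK.
rewrite /Xih_slope; set w := omegah a; set X := x; move=> H; rewrite /omegah /= -/X.
apply: (@etrans _ _ (X * (sgn R sb / `|y| - sgn R sc / `|r|)
                     - (sgn R sc * a.2.1 / `|r| - w))); first by ring.
by rewrite H subrr.
Qed.

Lemma slowness_omegah (d : mode R) : d.2.2 != 0 -> omegah d * slowness d = d.2.1.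
Proof.
move=> d0; rewrite /omegah /slowness.
rewrite (_ : _ * _ = sgn R d.1 * sgn R d.1 * (d.2.1 / `|d.2.2| * `|d.2.2|)); last by ring.
by rewrite sgn_sqr mul1r divfK// normr_eq0.
Qed.

(** Up to sign the slope is the slowness difference over [|y| * |r|], so dividing by it removes one
    of the two slowness differences in [Gammah ^+ 2]. *)
Lemma curve_weightE : `|W| <= pi ^+ 2 * eps0^-1 *
  (`|cross b.2 c.2| ^+ 2 * `|slowness b - slowness c| *
   `|slowness a + slowness b + slowness c| ^+ 2 / (`|a.2.2| ^+ 2 * `|y| * `|r|)).
Proof.
have [[ca cb cc] [y0 r0 s0]] := curve_weight_neq0.
have [q0 /andP[wa _] _ _] := curve_omegah_bounds.
have wa0 : 0 < `|omegah a| by apply: lt_le_trans wa.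
have slopeE : `|slope| = `|slowness b - slowness c| / (`|y| * `|r|).
  have -> : slope = - (sgn R sb * sgn R sc) * ((slowness b - slowness c) / (`|y| * `|r|)).
    rewrite /Xih_slope /slowness /=.
    have sb2 := sgn_sqr R sb; have sc2 := sgn_sqr R sc.
    rewrite (_ : - (sgn R sb * sgn R sc) * _ =
      (sgn R sb * (sgn R sc * sgn R sc) * `|r| - sgn R sc * (sgn R sb * sgn R sb) * `|y|)
      / (`|y| * `|r|)); last by ring.
    by rewrite sb2 sc2 !mulr1; field; rewrite !normr_eq0 y0 r0.
  by rewrite normrM normrN normrM !sgn_norm !mul1r normrM normfV normrM !normr_id.
have d0 : `|slowness b - slowness c| != 0.
  apply: contra_neq s0 => d0; apply/eqP; rewrite -normr_eq0 slopeE d0 mul0r//.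
have chi1 (d : mode R) : `|chih chi d| <= 1.
  by have /andP[? ?] := chih_bounds chiP d; rewrite ger0_norm.
have H : `|W| <= `|Gammah a b c ^+ 2 * omegah a / `|slope| |.
  rewrite /curve_weight -!mulrA !normrM.
  rewrite -[leRHS]mul1r ler_pM ?mulr_ge0//.
  rewrite -[leRHS]mul1r ler_pM ?mulr_ge0//.
  by rewrite -[leRHS]mul1r ler_pM ?mulr_ge0.
apply: le_trans H _.
have VE : `|Vtilde a b c| = pi * (`|a.2.2| * `|y| * `|r|)^-1 * `|cross b.2 c.2| *
    `|slowness b - slowness c| * `|slowness a + slowness b + slowness c|.
  rewrite /Vtilde !normrM normfV !normrM !sgn_norm !normr_id normrN.
  by rewrite (ger0_norm (pi_ge0 R)) !mul1r.
have -> : `|Gammah a b c ^+ 2 * omegah a / `|slope| |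
    = `|Vtilde a b c| ^+ 2 / `|omegah a| ^+ 2 * `|omegah a| / `|slope|.
  by rewrite /Gammah normrM normfV normr_id normrM normrX normrM normfV expr_div_n.
rewrite VE slopeE.
set X := `|cross _ _|; set d := `|slowness b - _| in d0 *; set S := `|_ + _ + _|.
have u0 : `|a.2.2| != 0 by rewrite normr_eq0.
have v0 : `|y| != 0 by rewrite normr_eq0.
have t0 : `|r| != 0 by rewrite normr_eq0.
rewrite [leLHS](_ : _ = pi ^+ 2 * `|omegah a|^-1 *
   (X ^+ 2 * d * S ^+ 2 / (`|a.2.2| ^+ 2 * `|y| * `|r|))); last first.
  by field; rewrite u0 v0 t0 d0 gt_eqF.
apply: ler_wpM2r.
  by rewrite divr_ge0 ?mulr_ge0 ?exprn_ge0 ?normr_ge0.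
by apply: ler_wpM2l; rewrite ?sqr_ge0// lef_pV2 ?posrE.
Qed.

Lemma curve_weight_le : `|W| <= cubic_constant eps0 epsh * `|y| ^+ 3 /\
  `|W| <= cubic_constant eps0 epsh * `|r| ^+ 3.
Proof.
have [_ [y0 r0 s0]] := curve_weight_neq0.
have [q0 wa wb wc] := curve_omegah_bounds.
have w0 := curve_resonant s0.
have res1 : a.2.1 + b.2.1 + c.2.1 = 0 by rewrite /=; lra.
have res2 : a.2.2 + y + r = 0 by lra.
have ws0 : omegah a * slowness a + omegah b * slowness b + omegah c * slowness c = 0.
  by rewrite !slowness_omegah.
have k1le (d : mode R) : eps0 <= `|omegah d| <= epsh^-1 -> d.2.2 != 0 ->
    `|d.2.1| <= epsh^-1 * `|d.2.2|.
  move=> /andP[_ h] d0; rewrite -(slowness_omegah d0) normrM /slowness.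
  by rewrite [X in _ * X]normrM sgn_norm mul1r normr_id ler_wpM2r.
have ua : 0 < `|a.2.2| by rewrite normr_gt0.
have ub : 0 < `|y| by rewrite normr_gt0.
have uc : 0 < `|r| by rewrite normr_gt0.
have Ka := k1le _ wa q0; have Kb := k1le _ wb y0; have Kc := k1le _ wc r0.
(* Since the three wavevectors sum to 0, their cross products agree up to sign; this yields both
   bounds required by [cubic_bound]. *)
have crossE1 : `|cross b.2 c.2| = `|cross a.2 b.2|.
  by rewrite /cross /=; congr (`| _ |); ring.
have crossE2 : `|cross b.2 c.2| = `|cross a.2 c.2|.
  by rewrite -[RHS]normrN /cross /=; congr (`| _ |); ring.
have X1 := cross_le Ka Kb; have X2 := cross_le Ka Kc.
rewrite -crossE1 in X1; rewrite -crossE2 in X2.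
have dle : `|slowness b - slowness c| <= `|y| + `|r|.
  by apply: le_trans (ler_normB _ _) _; rewrite !normrM !sgn_norm !mul1r !normr_id.
have P0 : 0 <= 3 + 2 * (eps0 * epsh)^-1.
  by rewrite addr_ge0// mulr_ge0// invr_ge0 mulr_ge0// ltW.
have M0 : 0 <= 2 / epsh by rewrite divr_ge0// ltW.
have Sb := slowness_sum_le e00 eh0 wa wb wc res2 w0 ws0.
have Sc : `|slowness a + slowness b + slowness c| <= (3 + 2 * (eps0 * epsh)^-1) * `|r|.
  rewrite addrAC; apply: (slowness_sum_le e00 eh0 wa wc wb).
  - by rewrite addrAC.
  - by rewrite addrAC.
  - by rewrite addrAC.
have c0 : 0 <= pi ^+ 2 * eps0^-1 by rewrite mulr_ge0 ?sqr_ge0// invr_ge0 ltW.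
split; apply: le_trans curve_weightE _; rewrite /cubic_constant -[leRHS]mulrA; apply: ler_wpM2l => //.
  exact: (cubic_bound ua ub uc _ _ _ M0 P0 X1 X2 dle Sb).
rewrite [`|a.2.2| ^+ 2 * _ * _]mulrAC.
by apply: (cubic_bound ua uc ub _ _ _ M0 P0 X2 X1 _ Sc) => //; rewrite [leRHS]addrC.
Qed.

End WeightBound.
End CurveWeight.

(** * Integrability of the decay left after the cubic weight *)

Section DecayProfile.
Variable R : realType.
Local Notation lambda := (@lebesgue_measure R).

Lemma lebesgue_measure_reflect (c : R) (A : set R) : measurable A ->
  lambda ((fun y => c - y) @^-1` A) = lambda A.
Proof.
move=> mA; pose f : measurableTypeR R -> measurableTypeR R := fun y => c - y.
have mf : measurable_fun setT f by exact: measurable_funB.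
pose mu := measure_function_pushforward__canonical__measure_function_Measure
  (@lebesgue_measure R) mf.
apply/esym; refine (@lebesgue_measure_unique R mu _ A mA) => _ [[a b]] _ <-.
rewrite /mu/= /pushforward.
have -> : f @^-1` `]a, b] = `[c - b, c - a[%classic.
  by apply/seteqP; split => y /=; rewrite !in_itv/= /f => /andP[h1 h2]; apply/andP; split; lra.
rewrite !lebesgue_measure_itv/= !lte_fin.
rewrite (_ : (c - b < c - a) = (a < b)); last by apply/idP/idP; lra.
by case: ifP => // _; rewrite -!EFinB; congr EFin; ring.
Qed.

Lemma ge0_integral_reflect (c : R) (f : R -> \bar R) : measurable_fun setT f ->
  (forall y, 0 <= f y)%E ->
  (\int[lambda]_y f (c - y)%R = \int[lambda]_y f y)%E.
Proof.
move=> mf f0.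
pose g : measurableTypeR R -> measurableTypeR R := fun y => c - y.
have mg : measurable_fun setT g by exact: measurable_funB.
have E := @ge0_integral_pushforward _ _ (measurableTypeR R) (measurableTypeR R) R g mg
  (@lebesgue_measure R) setT f measurableT mf (fun y _ => f0 y).
rewrite preimage_setT in E; rewrite -[LHS]E.
by apply: eq_measure_integral => A mA _; exact: lebesgue_measure_reflect.
Qed.

Section Profile.
Variable m : R.
Hypothesis m4 : 4 < m.

(** The cubic weight against the part of the decay that comes from the second component alone. *)
Definition decay_profile (t : R) : R := `|t| ^+ 3 / Num.sqrt (1 + t ^+ 2) `^ m.

Lemma sqrt1_gt0 (t : R) : 0 < Num.sqrt (1 + t ^+ 2).
Proof. by rewrite sqrtr_gt0 ltr_pwDl// sqr_ge0. Qed.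

Lemma decay_profile_ge0 t : 0 <= decay_profile t.
Proof. by rewrite divr_ge0 ?powR_ge0// exprn_ge0. Qed.

Lemma measurable_decay_profile : measurable_fun setT decay_profile.
Proof.
rewrite /decay_profile.
rewrite (_ : (fun t => _) = (fun t => `|t| ^+ 3 * Num.sqrt (1 + t ^+ 2) `^ (- m))); last first.
  by apply/funext => t; rewrite powRN.
apply: measurable_funM; first by apply: measurable_funX; exact: normr_measurable.
apply: (measurableT_comp (measurable_powR (- m))).
apply: (measurableT_comp (continuous_measurable_fun (@sqrt_continuous R))).
by apply: measurable_funD => //; exact: measurable_funX.
Qed.

(** The right-hand side has an explicit primitive. The profile is at most the power [3 - m] of
    [sqrt(1 + t^2)], and [1 + t] is at most twice that root. *)
Lemma decay_profile_le (t : R) : 0 <= t ->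
  decay_profile t <= 2 `^ (m - 3) * (1 + t) `^ (3 - m).
Proof.
move=> t0; have s0 := sqrt1_gt0 t; set s := Num.sqrt _ in s0 *.
have ts : t <= s.
  by rewrite -[leLHS]ger0_norm// -sqrtr_sqr ler_sqrt ?addr_ge0 ?sqr_ge0// lerDr.
have s1 : 1 <= s.
  by rewrite -[leLHS]sqrtr1 ler_sqrt ?addr_ge0 ?sqr_ge0// lerDl sqr_ge0.
rewrite /decay_profile -/s ger0_norm//.
apply: (@le_trans _ _ (s ^+ 3 / s `^ m)).
  by rewrite ler_wpM2r ?invr_ge0 ?powR_ge0// lerXn2r// nnegrE ltW.
have -> : s ^+ 3 / s `^ m = s `^ (3 - m).
  rewrite powRB; last by rewrite (gt_eqF s0) implybT.
  by rewrite -(@powR_mulrn _ s 3)// ltW.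
rewrite (_ : 3 - m = - (m - 3)); last by ring.
rewrite !powRN ler_pdivlMr ?powR_gt0 ?ltr_wpDr// mulrC ler_pdivrMr ?powR_gt0//.
rewrite -powRM//; last exact: ltW.
have le2 : 1 + t <= 2 * s by lra.
have m3 : 0 <= m - 3 by move: m4; lra.
by apply: (ge0_ler_powR m3 _ _ le2); rewrite nnegrE ?addr_ge0// mulr_ge0// ltW.
Qed.

Let is_derive_powR1D (p t : R) : 0 < 1 + t ->
  is_derive t 1 (fun t => (1 + t) `^ p) (p * (1 + t) `^ (p - 1)).
Proof.
move=> t0; have dp := is_derive1_powR p t0.
have d1 : is_derive t 1 (fun t : R => 1 + t) 1.
  by rewrite -[X in is_derive _ _ _ X]add0r; apply: is_deriveD.
have := @is_derive1_comp _ (fun t => t `^ p) (fun t => 1 + t) t _ _ dp d1.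
by rewrite mulr1.
Qed.

(** The primitive [(1 + t) ^ (4 - m) / (4 - m)] tends to 0 at infinity precisely because [m > 4]. *)
Lemma integral_decay_tail : (\int[lambda]_(t in `[0%R, +oo[)
  ((1 + t) `^ (3 - m))%:E < +oo)%E.
Proof.
pose F : R -> R := (4 - m)^-1 \*: (fun t => (1 + t) `^ (4 - m)).
have m4' : 4 - m != 0 by rewrite lt_eqF//; move: m4; lra.
have dF (t : R) : 0 < 1 + t -> is_derive t 1 F ((1 + t) `^ (3 - m)).
  move=> t0; have := @is_deriveZ _ _ _ _ (4 - m)^-1 _ _ _ (is_derive_powR1D (4 - m) t0).
  by rewrite -[_ *: _]/(_ * _) mulrA mulVf// mul1r (_ : 4 - m - 1 = 3 - m)//; ring.
have cont (p t : R) : 0 < 1 + t -> {for t, continuous (fun t : R => (1 + t) `^ p)}.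
  move=> t0; have [d _] := is_derive_powR1D p t0.
  exact/differentiable_continuous/derivable1_diffP.
suff -> : (\int[lambda]_(t in `[0%R, +oo[) ((1 + t) `^ (3 - m))%:E = 0%:E - (F 0)%:E)%E.
  by rewrite -EFinB ltry.
apply: (@ge0_continuous_FTC2y _ (fun t : R => (1 + t) `^ (3 - m)) F 0 0).
- by move=> t _; exact: powR_ge0.
- apply: continuous_in_subspaceT => t; rewrite inE/= in_itv/= andbT => t0.
  by apply: cont; lra.
- apply/cvgrPdist_le => e e0; near=> x.
  have x0 : 0 < 1 + x by rewrite addr_gt0//; near: x; exact: nbhs_pinfty_gt.
  have m4s : 0 < m - 4 by move: m4; lra.
  have -> : `|0 - F x| = (m - 4)^-1 * ((1 + x) `^ (m - 4))^-1.
    have FE : F x = - ((m - 4)^-1 * ((1 + x) `^ (m - 4))^-1).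
      rewrite -powRN (_ : - (m - 4) = 4 - m); last by ring.
      by rewrite /F /= -[_ *: _]/(_ * _) -mulNr -invrN opprB.
    by rewrite FE sub0r opprK ger0_norm// mulr_ge0 ?invr_ge0 ?powR_ge0// ltW.
  rewrite -invfM invf_ple ?posrE ?mulr_gt0 ?powR_gt0//.
  rewrite mulrC -ler_pdivrMr//.
  have -> : e^-1 / (m - 4) = ((e^-1 / (m - 4)) `^ (m - 4)^-1) `^ (m - 4).
    by rewrite -powRrM mulVf ?gt_eqF// powRr1// divr_ge0 ?invr_ge0 ?ltW.
  apply: (ge0_ler_powR (ltW m4s)); rewrite ?nnegrE ?powR_ge0 ?(ltW x0)//.
  rewrite -lerBlDl; near: x; apply: nbhs_pinfty_ge; exact: num_real.
- by move=> t t0; have [] := dF t _; first lra.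
- apply: cvg_at_right_filter.
  have [d _] : is_derive (0 : R) 1 F ((1 + 0) `^ (3 - m)) by apply: dF; rewrite addr0.
  exact/differentiable_continuous/derivable1_diffP.
- move=> t; rewrite in_itv/= andbT => t0; have t1 : 0 < 1 + t by lra.
  by have [_ <-] := dF t t1; rewrite derive1E.
Unshelve. all: by end_near. Qed.

Lemma integral_decay_profile : (\int[lambda]_t (decay_profile t)%:E < +oo)%E.
Proof.
have md : measurable_fun setT (fun t => (decay_profile t)%:E).
  by apply/measurable_EFinP; exact: measurable_decay_profile.
have half : (\int[lambda]_(t in `[0%R, +oo[) (decay_profile t)%:E < +oo)%E.
  apply: (@le_lt_trans _ _ (\int[lambda]_(t in `[0%R, +oo[)
      ((2 `^ (m - 3))%:E * ((1 + t) `^ (3 - m))%:E))%E).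
    apply: ge0_le_integral => //.
    - by move=> t _; rewrite lee_fin decay_profile_ge0.
    - exact: measurable_funTS.
    - apply/measurable_EFinP/measurable_funTS/measurable_funM => //.
      apply: (measurableT_comp (measurable_powR (3 - m))).
      exact: measurable_funD.
    - move=> t /=; rewrite in_itv/= andbT => t0.
      by rewrite -EFinM lee_fin decay_profile_le.
  rewrite ge0_integralZl_EFin ?powR_ge0//.
  - by rewrite lte_mul_pinfty ?lee_fin ?powR_ge0// integral_decay_tail.
  - by move=> t _; rewrite lee_fin powR_ge0.
  - apply/measurable_EFinP/measurable_funTS.
    apply: (measurableT_comp (measurable_powR (3 - m))).
    exact: measurable_funD.
have -> : [set: R] = `]-oo, 0%R] `|` `]0%R, +oo[.
  by apply/seteqP; split=> // t _ /=; rewrite !in_itv/= andbT; have [h|h] := leP t 0; [left|right].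
rewrite ge0_integral_setU//=; last 3 first.
- exact: measurable_funTS.
- by move=> t _; rewrite lee_fin decay_profile_ge0.
- by apply/disj_setPS => t [] /=; rewrite !in_itv/= andbT => h1 h2; have := lt_le_trans h2 h1; rewrite ltxx.
have h0 t : (0 <= (decay_profile t)%:E)%E by rewrite lee_fin decay_profile_ge0.
have half1 : (\int[lambda]_(t in `]-oo, 0%R]) (decay_profile t)%:E < +oo)%E.
  have E := @ge0_integration_by_substitution0 R (fun t => (decay_profile t)%:E) md h0.
  rewrite E in half; apply: le_lt_trans half; rewrite le_eqVlt; apply/orP; left.
  by apply/eqP/eq_integral => t _; rewrite /decay_profile normrN sqrrN.
have half2 : (\int[lambda]_(t in `]0%R, +oo[) (decay_profile t)%:E < +oo)%E.
  apply: le_lt_trans half; apply: ge0_subset_integral => //.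
  - exact: measurable_funTS.
  - by move=> t; rewrite /= !in_itv/= !andbT; exact: ltW.
exact: lte_add_pinfty half1 half2.
Qed.

End Profile.
End DecayProfile.

(** * Weighted estimate of the integrand on the curve *)

Section CurveEstimate.
Variable R : realType.

(** In the product of the values at [b] and [c], [wa <= p * (wb + wc)] uses up one of the two
    decays; in the other two products [fa] absorbs [wa]. Every term thus keeps one decay, at [b] or
    at [c], to pair with [W]; this is the origin of the factor [p + 1]. *)
Lemma trilinear_estimate (p e K W wa wb wc oa ob oc fa fb gb gc M N hy hr : R) :
  0 <= p -> 0 <= e -> 0 <= W -> 0 < wa -> 0 < wb -> 0 < wc -> 0 <= M -> 0 <= N ->
  0 <= fa -> 0 <= fb -> 0 <= gb -> 0 <= gc ->
  oa <= e -> ob <= e -> oc <= e ->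
  wa * fa <= M -> fb <= M / wb -> gb <= N / wb -> gc <= N / wc ->
  W / wb <= K * hy -> W / wc <= K * hr -> wa <= p * (wb + wc) ->
  wa * (W * (oa * (fb * gc) + oc * (fa * gb) + ob * (fa * gc)))
  <= K * e * (p + 1) * (M * N) * (hy + hr).
Proof.
move=> p0 e0 W0 wa0 wb0 wc0 M0 N0 fa0 fb0 gb0 gc0 oae obe oce faM fbM gbN gcN Wb Wc tri.
have T1 : wa * (fb * gc) <= p * (M * N) * (wb^-1 + wc^-1).
  apply: (@le_trans _ _ (p * (wb + wc) * ((M / wb) * (N / wc)))).
    exact: (ler_pM (ltW wa0) (mulr_ge0 fb0 gc0) tri (ler_pM fb0 gc0 fbM gcN)).
  by rewrite le_eqVlt; apply/orP; left; apply/eqP; field; rewrite !gt_eqF.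
have T2 : wa * (fa * gb) <= (M * N) * wb^-1.
  by rewrite mulrA -[leRHS]mulrA; exact: (ler_pM (mulr_ge0 (ltW wa0) fa0) gb0 faM gbN).
have T3 : wa * (fa * gc) <= (M * N) * wc^-1.
  by rewrite mulrA -[leRHS]mulrA; exact: (ler_pM (mulr_ge0 (ltW wa0) fa0) gc0 faM gcN).
have step (o t : R) : 0 <= t -> o <= e -> wa * (o * t) <= e * (wa * t).
  by move=> t0 o1; rewrite mulrCA ler_wpM2r// mulr_ge0// ltW.
have S1 := step oa _ (mulr_ge0 fb0 gc0) oae.
have S2 := step oc _ (mulr_ge0 fa0 gb0) oce.
have S3 := step ob _ (mulr_ge0 fa0 gc0) obe.
have H : wa * (oa * (fb * gc) + oc * (fa * gb) + ob * (fa * gc))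
    <= e * ((p + 1) * (M * N) * (wb^-1 + wc^-1)).
  rewrite 2!mulrDr; apply: le_trans (lerD (lerD S1 S2) S3) _.
  rewrite -[in leLHS]mulrDr -[in leLHS]mulrDr; apply: ler_wpM2l => //; apply: le_trans (lerD (lerD T1 T2) T3) _.
  by rewrite le_eqVlt; apply/orP; left; apply/eqP; ring.
rewrite [leLHS]mulrCA; apply: le_trans (ler_wpM2l W0 H) _.
rewrite [leLHS](_ : _ = (e * ((p + 1) * (M * N))) * (W / wb + W / wc)); last by ring.
rewrite [leRHS](_ : _ = (e * ((p + 1) * (M * N))) * (K * hy + K * hr)); last by ring.
apply: ler_wpM2l; last exact: lerD.
by rewrite !mulr_ge0// addr_ge0.
Qed.

Variable m : R.
Hypothesis m4 : 4 < m.

Definition jweight (a : mode R) : R := japanese a.2 `^ m.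

Definition jbounded (M : R) (f : mode R -> R) := forall a, jweight a * `|f a| <= M.

Let m0 : 0 <= m. Proof. by move: m4; lra. Qed.

Lemma japanese_gt0 (k : R * R) : 0 < japanese k.
Proof. by rewrite sqrtr_gt0 ltr_pwDl// sqr_ge0. Qed.

Lemma jweight_gt0 a : 0 < jweight a.
Proof. by rewrite powR_gt0// japanese_gt0. Qed.

Lemma jbounded_ge0 M f : jbounded M f -> 0 <= M.
Proof. by move/(_ (true, (0, 0))); apply: le_trans; rewrite mulr_ge0// ltW// jweight_gt0. Qed.

Lemma jbounded_le M f a : jbounded M f -> `|f a| <= M / jweight a.
Proof. by move=> fM; rewrite ler_pdivlMr ?jweight_gt0// mulrC. Qed.

Lemma jweight_triangle (a b c : mode R) :
  a.2.1 + b.2.1 + c.2.1 = 0 -> a.2.2 + b.2.2 + c.2.2 = 0 ->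
  jweight a <= 2 `^ m * (jweight b + jweight c).
Proof.
have key (x y z : mode R) : enorm y.2 ^+ 2 <= enorm z.2 ^+ 2 ->
    x.2.1 + y.2.1 + z.2.1 = 0 -> x.2.2 + y.2.2 + z.2.2 = 0 ->
    jweight x <= 2 `^ m * jweight z.
  move=> yz h1 h2; have jz := ltW (japanese_gt0 z.2).
  rewrite /jweight -powRM//.
  have le2 : japanese x.2 <= 2 * japanese z.2.
    rewrite /japanese -[X in X * _](@ger0_norm _ 2)// -sqrtr_sqr -sqrtrM ?sqr_ge0//.
    rewrite ler_sqrt ?mulr_ge0 ?addr_ge0 ?sqr_ge0//.
    move: yz; rewrite !enorm_sqr.
    have -> : x.2.1 = - (y.2.1 + z.2.1) by lra.
    have -> : x.2.2 = - (y.2.2 + z.2.2) by lra.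
    have := sqr_ge0 (y.2.1 - z.2.1); have := sqr_ge0 (y.2.2 - z.2.2).
    rewrite !expr2; lra.
  by apply: (ge0_ler_powR m0 _ _ le2); rewrite nnegrE ?mulr_ge0// ltW ?japanese_gt0.
move=> h1 h2; have p0 : 0 <= 2 `^ m :> R by exact: powR_ge0.
have wb := mulr_ge0 p0 (ltW (jweight_gt0 b)).
have wc := mulr_ge0 p0 (ltW (jweight_gt0 c)).
rewrite mulrDr; have [bc|/ltW cb] := leP (enorm b.2 ^+ 2) (enorm c.2 ^+ 2).
  by apply: le_trans (key _ _ _ bc h1 h2) _; rewrite lerDr; exact: wb.
have h1' : a.2.1 + c.2.1 + b.2.1 = 0 by rewrite addrAC.
have h2' : a.2.2 + c.2.2 + b.2.2 = 0 by rewrite addrAC.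
by apply: le_trans (key _ _ _ cb h1' h2') _; rewrite lerDl; exact: wc.
Qed.

Lemma jweight_ge_sqrt1 (a : mode R) : Num.sqrt (1 + a.2.2 ^+ 2) `^ m <= jweight a.
Proof.
have le1 : Num.sqrt (1 + a.2.2 ^+ 2) <= japanese a.2.
  by rewrite /japanese ler_sqrt ?addr_ge0 ?sqr_ge0// enorm_sqr lerD2l lerDr sqr_ge0.
by apply: (ge0_ler_powR m0 _ _ le1); rewrite nnegrE sqrtr_ge0.
Qed.

Lemma cube_div_jweight (a : mode R) : `|a.2.2| ^+ 3 / jweight a <= decay_profile m a.2.2.
Proof.
rewrite /decay_profile ler_wpM2l ?exprn_ge0// lef_pV2 ?posrE ?jweight_gt0 ?powR_gt0 ?sqrt1_gt0//.
exact: jweight_ge_sqrt1.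
Qed.

Section Estimate.
Variables (eps0 epsh : R) (chi : R -> R).
Hypotheses (e00 : 0 < eps0) (eh0 : 0 < epsh) (chiP : cutoff eps0 epsh chi).
Variables (sb sc : bool) (a : mode R) (y : R).
Hypothesis a0 : a.2 != 0.
Local Notation r := (- a.2.2 - y).
Local Notation b := (curve_b sb sc a y).
Local Notation c := (curve_c sb sc a y).
Local Notation W := (curve_weight sb sc a y chi).

Definition collision_constant : R := cubic_constant eps0 epsh / epsh * (2 `^ m + 1).

Lemma collision_constant_ge0 : 0 <= collision_constant.
Proof.
apply: mulr_ge0; last by rewrite addr_ge0// powR_ge0.
by rewrite divr_ge0 ?cubic_constant_ge0// ltW.
Qed.

(** Absolute values are taken term by term so that the bound also covers [curve_majorant], which
    enters the positivity argument. *)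
Lemma curve_estimate M N (f g : mode R -> R) : jbounded M f -> jbounded N g ->
  jweight a * (`|W| * (`|omegah a| * (`|f b| * `|g c|) + `|omegah c| * (`|f a| * `|g b|)
     + `|omegah b| * (`|f a| * `|g c|)))
  <= collision_constant * (M * N) * (decay_profile m y + decay_profile m r).
Proof.
move=> fM gN.
have M0 := jbounded_ge0 fM; have N0 := jbounded_ge0 gN.
have K0 : 0 <= cubic_constant eps0 epsh by exact: cubic_constant_ge0.
have p0 : 0 <= 2 `^ m :> R by exact: powR_ge0.
have hh0 : 0 <= decay_profile m y + decay_profile m r by rewrite addr_ge0 ?decay_profile_ge0.
(* The bounds on the frequencies are available only where the weight is nonzero. *)
have [W0|W0] := eqVneq W 0.
  rewrite W0 normr0 mul0r mulr0; apply: mulr_ge0 hh0.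
  by apply: mulr_ge0; [exact: collision_constant_ge0|exact: mulr_ge0].
have [_ /andP[_ wa] /andP[_ wb] /andP[_ wc]] := curve_omegah_bounds e00 eh0 chiP a0 W0.
have [Wy Wr] := curve_weight_le e00 eh0 chiP a0 W0.
have wa0 := jweight_gt0 a; have wb0 := jweight_gt0 b; have wc0 := jweight_gt0 c.
have Wb : `|W| / jweight b <= cubic_constant eps0 epsh * decay_profile m y.
  apply: le_trans (ler_wpM2l K0 (cube_div_jweight b)).
  by rewrite mulrA; apply: ler_wpM2r Wy; rewrite invr_ge0; exact: ltW.
have Wc : `|W| / jweight c <= cubic_constant eps0 epsh * decay_profile m r.
  apply: le_trans (ler_wpM2l K0 (cube_div_jweight c)).
  by rewrite mulrA; apply: ler_wpM2r Wr; rewrite invr_ge0; exact: ltW.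
have res1 : a.2.1 + b.2.1 + c.2.1 = 0 by rewrite /=; ring.
have res2 : a.2.2 + b.2.2 + c.2.2 = 0 by rewrite /=; ring.
have tri := jweight_triangle res1 res2.
have e0 : 0 <= epsh^-1 by rewrite invr_ge0; exact: ltW.
exact: (trilinear_estimate p0 e0 (normr_ge0 _) wa0 wb0 wc0 M0 N0 (normr_ge0 _) (normr_ge0 _)
  (normr_ge0 _) (normr_ge0 _) wa wb wc (fM a) (jbounded_le b fM) (jbounded_le b gN)
  (jbounded_le c gN) Wb Wc tri).
Qed.

End Estimate.
End CurveEstimate.

(** * The bilinear collision form *)

Section CutoffMeasurable.
Variable R : realType.

Lemma periodic_int T (f : R -> T) (p : R) : (forall t, f (t + p) = f t) ->
  forall (j : int) t, f (t + j%:~R * p) = f t.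
Proof.
move=> fp; have nat_case (n : nat) t : f (t + n%:R * p) = f t.
  by elim: n => [|n IH]; rewrite ?mul0r ?addr0// -natr1 mulrDl mul1r addrA fp IH.
case=> n t; first by rewrite -pmulrn nat_case.
by rewrite NegzE mulrNz -pmulrn mulNr -[in RHS](subrK (n.+1%:R * p) t) nat_case.
Qed.

Lemma measurable_invr : measurable_fun [set: R] (@GRing.inv R).
Proof.
rewrite (_ : @GRing.inv R = fun x => x * (`|x| `^ (-1)) ^+ 2); last first.
  apply/funext => x; rewrite powR_inv1// exprVn -normrX ger0_norm ?sqr_ge0//.
  have [->|x0] := eqVneq x 0; first by rewrite mul0r invr0.
  by field.
apply: measurable_funM => //; apply: measurable_funX.
by apply: (measurableT_comp (measurable_powR (-1))); exact: normr_measurable.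
Qed.

Section Cutoff.
Variables (eps0 epsh : R) (chi : R -> R).
Hypotheses (e00 : 0 < eps0) (eh0 : 0 < epsh) (chiP : cutoff eps0 epsh chi).

(** [angle] is a choice among polar angles and shows no measurability by itself. But [chi] has
    period pi, and the tangent determines an angle modulo pi. *)
Lemma cutoff_atan (k : R * R) : k.1 != 0 -> chi (angle k) = chi (atan (k.2 / k.1)).
Proof.
move=> k1; set t := angle k.
have kE : k = (enorm k * cos t, enorm k * sin t) := angleP k.
have k1E : k.1 = enorm k * cos t by rewrite {1}kE.
have k2E : k.2 = enorm k * sin t by rewrite {1}kE.
have [n0 c0] : enorm k != 0 /\ cos t != 0.
  by apply/andP; rewrite -negb_or -mulf_eq0 -k1E.
have tanE : tan t = k.2 / k.1 by rewrite k1E k2E /tan -mulf_div divff// mul1r.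
have pi0 : 0 < pi :> R := pi_gt0 R.
(* Half-turns bring the angle into [-pi/2, pi/2[; the left end point is excluded by [cos t != 0], so
   that [tanK] applies. *)
pose j := Num.floor ((t + pi / 2) / pi); pose u := t + (- j)%:~R * pi.
have chiu : chi u = chi t by apply: periodic_int; exact: (cutoff_pi chiP).
have tanu : tan u = tan t by apply: periodic_int; exact: tanDpi.
have cosu : `|cos u| = `|cos t|.
  by apply: (periodic_int (f := fun t => `|cos t|)) => x; rewrite cosDpi normrN.
have uP : - (pi / 2) <= u < pi / 2.
  have /andP[j1 j2] : j%:~R <= (t + pi / 2) / pi < (j + 1)%:~R.
    by rewrite floor_le_tmp floorD1_gt.
  move: j1 j2; rewrite ler_pdivlMr// ltr_pdivrMr// intrD mulr1z (mulrDl j%:~R 1) mul1r => j1 j2.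
  by rewrite /u mulrNz mulNr; apply/andP; split; lra.
have u1 : u != - (pi / 2).
  apply: contraNneq c0 => uE; rewrite -normr_eq0 -cosu uE cosN cos_pihalf normr0//.
have uI : u \in `](- (pi / 2)), (pi / 2)[.
  by rewrite in_itv/= lt_neqAle eq_sym u1.
by rewrite -chiu -tanE -tanu tanK.
Qed.

(** Off the origin, the support condition kills the cut-off on the axis [k.1 = 0]. At the origin the
    value depends on the chosen angle, but it is one constant. *)
Lemma cutoff_angle (k : R * R) : chi (angle k) =
  if k == 0 then chi (angle (0 : R * R)) else
  if k.1 == 0 then 0 else chi (atan (k.2 / k.1)).
Proof.
have [->//|k0] := eqVneq k 0.
have [k1|k1] := eqVneq k.1 0; last exact: cutoff_atan.
apply: contraNeq k0 => chi0; rewrite -enorm_eq0.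
have [h _] := @chih_support _ eps0 epsh chi chiP (true, k) chi0.
move: h; rewrite /= k1 normr0 pmulr_rle0// => h.
by rewrite eq_le h enorm_ge0.
Qed.

Lemma measurable_cutoff : measurable_fun setT chi.
Proof.
apply: continuous_measurable_fun => t.
by have /derivable1_diffP/differentiable_continuous := @cutoff_smooth _ _ _ _ chiP 0%N t.
Qed.

Lemma measurable_cutoff_angle : measurable_fun setT (fun k : R * R => chi (angle k)).
Proof.
have -> : (fun k : R * R => chi (angle k)) = fun k =>
    if (k.1 == 0) && (k.2 == 0) then chi (angle (0 : R * R)) else
    if k.1 == 0 then 0 else chi (atan (k.2 / k.1)).
  by apply/funext => -[k1 k2]; rewrite cutoff_angle.
have m1 : measurable_fun setT (fun k : R * R => k.1 == 0).
  by apply: measurable_fun_eqr => //; exact: measurable_fst.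
have m2 : measurable_fun setT (fun k : R * R => k.2 == 0).
  by apply: measurable_fun_eqr => //; exact: measurable_snd.
apply: measurable_fun_ifT; [exact: measurable_and|exact: measurable_cst|].
apply: measurable_fun_ifT => //; apply: (measurableT_comp measurable_cutoff).
apply: (measurableT_comp (continuous_measurable_fun (@continuous_atan R))).
apply: measurable_funM; first exact: measurable_snd.
exact: (measurableT_comp measurable_invr measurable_fst).
Qed.

End Cutoff.

End CutoffMeasurable.

Section CurveTermMeasurable.
Variable R : realType.
Local Notation lambda := (@lebesgue_measure R).

Definition mode_measurable (f : mode R -> R) :=
  forall s : bool, measurable_fun setT (fun k : R * R => f (s, k)).

Section CurveTerm.
Variables (chi : R -> R) (f g : mode R -> R) (sb sc : bool).

(** A polarization of the collision integrand, linear in [f] and in [g], already divided by the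
    slope. *)
Definition curve_term (a : mode R) (y : R) : R :=
  let b := curve_b sb sc a y in let c := curve_c sb sc a y in
  curve_weight sb sc a y chi *
  (omegah a * (f b * g c) + omegah c * (f a * g b) + omegah b * (f a * g c)).

Section Measurable.
Variables (eps0 epsh : R) (sa : bool).
Hypotheses (e00 : 0 < eps0) (eh0 : 0 < epsh) (chiP : cutoff eps0 epsh chi).
Hypotheses (mf : mode_measurable f) (mg : mode_measurable g).
Local Notation T := ((R * R) * R)%type.

Let mp : measurable_fun [set: T] (fun z => z.1.1).
Proof. exact: (measurableT_comp measurable_fst measurable_fst). Qed.
Let mq : measurable_fun [set: T] (fun z => z.1.2).
Proof. exact: (measurableT_comp measurable_snd measurable_fst). Qed.
Let my : measurable_fun [set: T] (fun z => z.2).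
Proof. exact: measurable_snd. Qed.

Let minv (h : T -> R) : measurable_fun setT h -> measurable_fun setT (fun z => (h z)^-1).
Proof. exact: (measurableT_comp (@measurable_invr R)). Qed.

Let mnorm (h : T -> R) : measurable_fun setT h -> measurable_fun setT (fun z => `|h z|).
Proof. exact: (measurableT_comp (@normr_measurable R setT)). Qed.

Let momega (s : bool) (h1 h2 : T -> R) : measurable_fun setT h1 -> measurable_fun setT h2 ->
  measurable_fun setT (fun z => omegah ((s, (h1 z, h2 z)) : mode R)).
Proof.
move=> m1 m2; rewrite /omegah /=; apply: measurable_funM => //.
by apply: measurable_funM => //; apply: minv; exact: mnorm.
Qed.

Let mslowness (s : bool) (h : T -> R) (h1 : T -> R) : measurable_fun setT h ->
  measurable_fun setT (fun z => slowness ((s, (h1 z, h z)) : mode R)).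
Proof. by move=> mh; rewrite /slowness /=; apply: measurable_funM => //; exact: mnorm. Qed.

Let mr : measurable_fun [set: T] (fun z => - z.1.2 - z.2).
Proof. by apply: measurable_funB => //; exact: measurable_funN. Qed.

Let mode_of (z : T) : mode R := (sa, (z.1.1, z.1.2)).

Let mslope : measurable_fun [set: T] (fun z => Xih_slope sb sc (mode_of z) z.2).
Proof.
rewrite /Xih_slope /=; apply: measurable_funB; apply: measurable_funM => //;
  by apply: minv; exact: mnorm.
Qed.

Let mx : measurable_fun [set: T] (fun z => curve_x sb sc (mode_of z) z.2).
Proof.
rewrite /curve_x /=; apply: measurable_funM; last exact: minv.
apply: measurable_funB; last exact: momega.
apply: measurable_funM; first exact: measurable_funM.
by apply: minv; exact: mnorm.
Qed.

Let mxc : measurable_fun [set: T] (fun z => - z.1.1 - curve_x sb sc (mode_of z) z.2).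
Proof. by apply: measurable_funB => //; exact: measurable_funN. Qed.

Let mmode (h : mode R -> R) (s : bool) (h1 h2 : T -> R) : mode_measurable h ->
  measurable_fun setT h1 -> measurable_fun setT h2 ->
  measurable_fun setT (fun z => h (s, (h1 z, h2 z))).
Proof.
by move=> mh m1 m2; apply: (measurableT_comp (mh s)); exact: measurable_fun_pair.
Qed.

Let mchih : mode_measurable (chih chi).
Proof. by move=> s; exact: (measurable_cutoff_angle e00 chiP). Qed.

Let mweight : measurable_fun [set: T] (fun z => curve_weight sb sc (mode_of z) z.2 chi).
Proof.
have msa := @mslowness sa (fun z => z.1.2) (fun z => z.1.1) mq.
have msb := @mslowness sb (fun z => z.2) (fun z => curve_x sb sc (mode_of z) z.2) my.
have msc := @mslowness sc (fun z => - z.1.2 - z.2)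
  (fun z => - z.1.1 - curve_x sb sc (mode_of z) z.2) mr.
rewrite /curve_weight; apply: measurable_funM; last by apply: minv; exact: mnorm.
apply: measurable_funM; last exact: momega.
apply: measurable_funM.
  by apply: measurable_funM; [apply: measurable_funM|]; exact: mmode.
apply: measurable_funX; rewrite /Gammah /Vtilde; apply: measurable_funM; last first.
  by apply: minv; exact: momega.
apply: measurable_funM; last first.
  exact: (measurable_funD (measurable_funD msa msb) msc).
apply: measurable_funM; last exact: (measurable_funB msb msc).
apply: measurable_funM; last first.
  by apply: measurable_funB; [exact: (measurable_funM mx mr)|exact: (measurable_funM my mxc)].
apply: (measurable_funM (measurable_cst _)).
exact: (measurable_funM (measurable_cst (sgn R sa * sgn R sb * sgn R sc))
  (minv (measurable_funM (measurable_funM (mnorm mq) (mnorm my)) (mnorm mr)))).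
Qed.

(** Joint measurability in the wavevector and [y] is what makes the integral over [y] measurable in
    the mode. *)
Lemma measurable_curve_term :
  measurable_fun [set: T] (fun z => curve_term (sa, z.1) z.2).
Proof.
have -> : (fun z : T => curve_term (sa, z.1) z.2) = fun z => curve_term (mode_of z) z.2.
  by apply/funext => -[[p q] y].
rewrite /curve_term; apply: measurable_funM; first exact: mweight.
apply: measurable_funD; first apply: measurable_funD.
- apply: measurable_funM; first exact: momega.
  by apply: measurable_funM; exact: mmode.
- apply: measurable_funM; first exact: momega.
  by apply: measurable_funM; exact: mmode.
- apply: measurable_funM; first exact: momega.
  by apply: measurable_funM; exact: mmode.
Qed.

End Measurable.
End CurveTerm.
End CurveTermMeasurable.

(** * Absolute convergence and bounds for the bilinear form *)

Section CollisionForm.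
Variable R : realType.
Local Notation lambda := (@lebesgue_measure R).
Local Notation Rint F := (Rintegral lambda setT F).
Local Notation integrableR F := (lambda.-integrable setT (EFin \o F)).

Section Form.
Variable m : R.
Hypothesis m4 : 4 < m.

Definition profile_integral : R := Rint (decay_profile m).

Let mh : measurable_fun setT (decay_profile m) := measurable_decay_profile m.

Let h0 y : (0 <= (decay_profile m y)%:E)%E.
Proof. by rewrite lee_fin decay_profile_ge0. Qed.

Let mhE : measurable_fun setT (fun y => (decay_profile m y)%:E).
Proof. exact/measurable_EFinP. Qed.

Let ih : integrableR (decay_profile m).
Proof.
apply/integrableP; split=> //.
apply: le_lt_trans (integral_decay_profile m4); rewrite le_eqVlt; apply/orP; left.
by apply/eqP/eq_integral => y _ /=; rewrite ger0_norm// decay_profile_ge0.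
Qed.

Let mhr (q : R) : measurable_fun setT (fun y : R => decay_profile m (q - y)).
Proof. by apply: (measurableT_comp mh); exact: measurable_funB. Qed.

Let ihr (q : R) : integrableR (fun y : R => decay_profile m (q - y)).
Proof.
apply/integrableP; split; first by apply/measurable_EFinP; exact: mhr.
apply: le_lt_trans (integral_decay_profile m4).
rewrite -(ge0_integral_reflect q mhE h0) le_eqVlt; apply/orP; left.
by apply/eqP/eq_integral => y _ /=; rewrite ger0_norm// decay_profile_ge0.
Qed.

Lemma profile_pairP (c q : R) :
  integrableR (fun y : R => c * (decay_profile m y + decay_profile m (q - y))) /\
  Rint (fun y : R => c * (decay_profile m y + decay_profile m (q - y))) = c * (2 * profile_integral).
Proof.
have isum : integrableR (fun y : R => decay_profile m y + decay_profile m (q - y)).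
  exact: (integrableD measurableT ih (ihr q)).
split; first exact: (@integrableZl _ _ _ lambda setT measurableT c _ isum).
have E1 := RintegralZl c measurableT isum.
have E2 := RintegralD measurableT ih (ihr q).
have E3 : Rint (fun y : R => decay_profile m (q - y)) = profile_integral.
  exact: (congr1 fine (ge0_integral_reflect q mhE h0)).
refine (etrans E1 (congr1 (fun z => c * z) (etrans E2 _))).
by rewrite E3 /profile_integral; ring.
Qed.

Lemma profile_integral_ge0 : 0 <= profile_integral.
Proof. by apply: Rintegral_ge0 => y _; exact: decay_profile_ge0. Qed.

Variables (eps0 epsh : R) (chi : R -> R).
Hypotheses (e00 : 0 < eps0) (eh0 : 0 < epsh) (chiP : cutoff eps0 epsh chi).
Local Notation CC := (collision_constant m eps0 epsh).

(** Signs are allowed, unlike in [Linfty], since the coefficients of the power series need not be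
    nonnegative. *)
Definition jspace (f : mode R -> R) := mode_measurable f /\ exists M, jbounded m M f.

Definition collision_form (f g : mode R -> R) (a : mode R) : R :=
  \sum_(sb : bool) \sum_(sc : bool) Rint (curve_term chi f g sb sc a).

(** The 8 counts four pairs of signs times the two profiles, at [y] and at its reflection, which
    have equal integrals. *)
Definition form_constant : R := 8 * CC * profile_integral.

Lemma form_constant_ge0 : 0 <= form_constant.
Proof.
apply: mulr_ge0 profile_integral_ge0; apply: mulr_ge0 => //.
exact: collision_constant_ge0.
Qed.

Lemma curve_weight0 sb sc a y : a.2 = 0 -> curve_weight sb sc a y chi = 0.
Proof.
move=> a0; have w0 : omegah a = 0 by rewrite /omegah a0 /= mul0r mulr0.
by rewrite /curve_weight w0 mulr0 mul0r.
Qed.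

(** Besides dominating [curve_term], it measures how far the negative part of a function can push
    the collision term down. *)
Definition curve_majorant (f g : mode R -> R) sb sc (a : mode R) (y : R) : R :=
  let b := curve_b sb sc a y in let c := curve_c sb sc a y in
  `|curve_weight sb sc a y chi| * (`|omegah a| * (`|f b| * `|g c|)
     + `|omegah c| * (`|f a| * `|g b|) + `|omegah b| * (`|f a| * `|g c|)).

Lemma curve_majorant_le M N f g sb sc a y : jbounded m M f -> jbounded m N g ->
  jweight m a * curve_majorant f g sb sc a y <=
  CC * (M * N) * (decay_profile m y + decay_profile m (- a.2.2 - y)).
Proof.
move=> fM gN; have [a0|a0] := eqVneq a.2 0; last exact: curve_estimate.
rewrite /curve_majorant curve_weight0// normr0 mul0r mulr0.
apply: mulr_ge0; last by apply: addr_ge0; exact: decay_profile_ge0.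
apply: mulr_ge0; first exact: collision_constant_ge0.
by apply: mulr_ge0; [exact: jbounded_ge0 fM|exact: jbounded_ge0 gN].
Qed.

Lemma curve_term_norm f g sb sc a y :
  `|curve_term chi f g sb sc a y| <= curve_majorant f g sb sc a y.
Proof.
rewrite /curve_term normrM; apply: ler_wpM2l => //.
by rewrite -!normrM; apply: le_trans (ler_normD _ _) _; apply: lerD => //; exact: ler_normD.
Qed.

Lemma curve_term_le M N f g sb sc a y : jbounded m M f -> jbounded m N g ->
  jweight m a * `|curve_term chi f g sb sc a y| <=
  CC * (M * N) * (decay_profile m y + decay_profile m (- a.2.2 - y)).
Proof.
move=> fM gN; apply: le_trans (curve_majorant_le sb sc a y fM gN).
by apply: ler_wpM2l; [exact/ltW/jweight_gt0|exact: curve_term_norm].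
Qed.

Lemma measurable_curve_term_section f g sb sc a : mode_measurable f -> mode_measurable g ->
  measurable_fun setT (curve_term chi f g sb sc a).
Proof.
case: a => sa k mf mg.
exact: (measurable_fun_pair2 k (measurable_curve_term sb sc sa e00 chiP mf mg)).
Qed.

Lemma integrable_curve_term f g sb sc a : jspace f -> jspace g ->
  integrableR (curve_term chi f g sb sc a).
Proof.
move=> [mf [M fM]] [mg [N gN]].
have w0 := jweight_gt0 m a.
have [iB _] := profile_pairP ((jweight m a)^-1 * (CC * (M * N))) (- a.2.2).
apply: le_integrable iB => //.
  by apply/measurable_EFinP; exact: measurable_curve_term_section.
move=> y _ /=; rewrite lee_fin; apply: le_trans (ler_norm _).
by rewrite -mulrA ler_pdivlMl//; exact: curve_term_le.
Qed.

Lemma Rintegral_curve_term_le M N f g sb sc a : jspace f -> jspace g ->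
  jbounded m M f -> jbounded m N g ->
  jweight m a * `|Rint (curve_term chi f g sb sc a)| <= CC * (M * N) * (2 * profile_integral).
Proof.
move=> Lf Lg fM gN; have w0 := jweight_gt0 m a.
have [iB EB] := profile_pairP ((jweight m a)^-1 * (CC * (M * N))) (- a.2.2).
have it := integrable_curve_term sb sc a Lf Lg.
rewrite -ler_pdivlMl//; apply: (@le_trans _ _ (Rint (fun y : R => (jweight m a)^-1 *
    (CC * (M * N)) * (decay_profile m y + decay_profile m (- a.2.2 - y))))); last first.
  rewrite EB le_eqVlt; apply/orP; left; apply/eqP.
  set w := (jweight m a)^-1; set C := collision_constant _ _ _; ring.
apply: le_trans (le_normr_Rintegral measurableT it) _.
apply: le_Rintegral => //.
  exact: (integrable_norm it).
by move=> y _; rewrite -mulrA ler_pdivlMl//; exact: curve_term_le.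
Qed.

End Form.
End CollisionForm.

Section CollisionFormTheory.
Variable R : realType.
Local Notation lambda := (@lebesgue_measure R).
Local Notation Rint F := (Rintegral lambda setT F).
Local Notation integrableR F := (lambda.-integrable setT (EFin \o F)).

(** Tonelli applies to the positive and negative parts separately, so the statement holds without
    integrability in [y]. *)
Lemma measurable_parametric_Rintegral d (X : measurableType d) (F : X * R -> R) :
  measurable_fun setT F -> measurable_fun setT (fun x => Rint (fun y => F (x, y))).
Proof.
move=> mF.
pose E : X * measurableTypeR R -> \bar R := EFin \o F.
have mE : measurable_fun setT E by exact/measurable_EFinP.
have mp := measurable_fun_fubini_tonelli_F (m2 := @lebesgue_measure R)
  E^\+%E (measurable_funepos mE) (fun z => funepos_ge0 E z).
have mn := measurable_fun_fubini_tonelli_F (m2 := @lebesgue_measure R)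
  E^\-%E (measurable_funeneg mE) (fun z => funeneg_ge0 E z).
have -> : (fun x => Rint (fun y => F (x, y))) =
    fine \o (fubini_F (@lebesgue_measure R) E^\+ \- fubini_F (@lebesgue_measure R) E^\-)%E.
  apply/funext => x; rewrite /Rintegral integralE /= /fubini_F.
  by congr (fine (_ - _)%E); apply: eq_integral => y _; rewrite ?funeposE ?funenegE.
apply: measurableT_comp; first exact: fine_measurable.
exact: emeasurable_funB.
Qed.

Lemma mode_measurableD f g : mode_measurable f -> mode_measurable g ->
  mode_measurable (fun a : mode R => f a + g a).
Proof. by move=> mf mg s; exact: measurable_funD. Qed.

Lemma mode_measurableZ (c : R) f : mode_measurable f -> mode_measurable (fun a : mode R => c * f a).
Proof. by move=> mf s; exact: measurable_funM. Qed.

Lemma mul_ge_negative_parts (x z : R) :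
  - (`|x| * Num.max 0 (- z) + Num.max 0 (- x) * `|z|) <= x * z.
Proof.
have pos (t : R) : 0 <= t -> `|t| = t /\ Num.max 0 (- t) = 0.
  by move=> t0; rewrite ger0_norm// max_l// oppr_le0.
have neg (t : R) : t <= 0 -> `|t| = - t /\ Num.max 0 (- t) = - t.
  by move=> t0; rewrite ler0_norm// max_r// oppr_ge0.
have [/[dup] x0 /pos[-> ->] | /ltW/[dup] x0 /neg[-> ->]] := leP 0 x;
    have [/[dup] z0 /pos[-> ->] | /ltW/[dup] z0 /neg[-> ->]] := leP 0 z.
- by rewrite mulr0 mul0r addr0 oppr0 mulr_ge0.
- by rewrite mul0r addr0 mulrN opprK.
- by rewrite mulr0 add0r mulNr opprK.
- have := mulr_le0 x0 z0; lra.
Qed.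

Section Form.
Variable m : R.
Hypothesis m4 : 4 < m.
Variables (eps0 epsh : R) (chi : R -> R).
Hypotheses (e00 : 0 < eps0) (eh0 : 0 < epsh) (chiP : cutoff eps0 epsh chi).
Local Notation CC := (collision_constant m eps0 epsh).
Local Notation Q := (collision_form chi).
Local Notation jspace := (jspace m).
Local Notation jbounded := (jbounded m).

Lemma jboundedD M N (f g : mode R -> R) : jbounded M f -> jbounded N g ->
  jbounded (M + N) (fun a => f a + g a).
Proof.
move=> fM gN a; apply: le_trans (lerD (fM a) (gN a)); rewrite -mulrDr.
by apply: ler_wpM2l; [exact/ltW/jweight_gt0|exact: ler_normD].
Qed.

Lemma jboundedZ M (c : R) (f : mode R -> R) : jbounded M f ->
  jbounded (`|c| * M) (fun a => c * f a).
Proof. by move=> fM a; rewrite normrM mulrCA; apply: ler_wpM2l => //; exact: fM. Qed.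

Lemma jspaceD f g : jspace f -> jspace g -> jspace (fun a => f a + g a).
Proof.
move=> [mf [M fM]] [mg [N gN]]; split; first exact: mode_measurableD.
by exists (M + N); exact: jboundedD.
Qed.

Lemma jspaceZ c f : jspace f -> jspace (fun a => c * f a).
Proof.
move=> [mf [M fM]]; split; first exact: mode_measurableZ.
by exists (`|c| * M); exact: jboundedZ.
Qed.

Lemma collision_form_bounded M N f g : jspace f -> jspace g ->
  jbounded M f -> jbounded N g -> jbounded (form_constant m eps0 epsh * (M * N)) (Q f g).
Proof.
move=> Lf Lg fM gN a; rewrite /collision_form !big_bool /=.
have w0 := ltW (jweight_gt0 m a).
have H sb sc := Rintegral_curve_term_le m4 e00 eh0 chiP sb sc a Lf Lg fM gN.
move: (H true true) (H true false) (H false true) (H false false).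
set x1 := Rint _; set x2 := Rint _; set x3 := Rint _; set x4 := Rint _ => h1 h2 h3 h4.
have : `|x1 + x2 + (x3 + x4)| <= `|x1| + `|x2| + (`|x3| + `|x4|).
  apply: le_trans (ler_normD _ _) _.
  by apply: lerD; exact: ler_normD.
move/(ler_wpM2l w0)/le_trans; apply; rewrite !mulrDr.
apply: le_trans (lerD (lerD h1 h2) (lerD h3 h4)) _.
rewrite le_eqVlt; apply/orP; left; apply/eqP; rewrite /form_constant.
set C := collision_constant _ _ _; set I := profile_integral _; ring.
Qed.

Lemma mode_measurable_collision_form f g : mode_measurable f -> mode_measurable g ->
  mode_measurable (Q f g).
Proof.
move=> mf mg s; rewrite /collision_form.
have mt sb sc : measurable_fun setT (fun k => Rint (curve_term chi f g sb sc (s, k))).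
  have := measurable_parametric_Rintegral (measurable_curve_term sb sc s e00 chiP mf mg).
  exact.
under eq_fun do rewrite !big_bool /=.
by apply: measurable_funD; exact: measurable_funD.
Qed.

Lemma jspace_collision_form f g : jspace f -> jspace g -> jspace (Q f g).
Proof.
move=> Lf Lg; have [mf [M fM]] := Lf; have [mg [N gN]] := Lg.
split; first exact: mode_measurable_collision_form.
by exists (form_constant m eps0 epsh * (M * N)); exact: collision_form_bounded.
Qed.

Lemma collision_formDl f1 f2 g : jspace f1 -> jspace f2 -> jspace g ->
  forall a, Q (fun a => f1 a + f2 a) g a = Q f1 g a + Q f2 g a.
Proof.
move=> L1 L2 Lg a; rewrite /collision_form -big_split/=; apply: eq_bigr => sb _.
rewrite -big_split/=; apply: eq_bigr => sc _.
have i1 := integrable_curve_term m4 e00 eh0 chiP sb sc a L1 Lg.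
have i2 := integrable_curve_term m4 e00 eh0 chiP sb sc a L2 Lg.
refine (etrans _ (RintegralD measurableT i1 i2)).
by congr (Rint _); apply/funext => y; rewrite /curve_term; ring.
Qed.

Lemma collision_formDr f g1 g2 : jspace f -> jspace g1 -> jspace g2 ->
  forall a, Q f (fun a => g1 a + g2 a) a = Q f g1 a + Q f g2 a.
Proof.
move=> Lf L1 L2 a; rewrite /collision_form -big_split/=; apply: eq_bigr => sb _.
rewrite -big_split/=; apply: eq_bigr => sc _.
have i1 := integrable_curve_term m4 e00 eh0 chiP sb sc a Lf L1.
have i2 := integrable_curve_term m4 e00 eh0 chiP sb sc a Lf L2.
refine (etrans _ (RintegralD measurableT i1 i2)).
by congr (Rint _); apply/funext => y; rewrite /curve_term; ring.
Qed.

Lemma collision_formZl c f g : jspace f -> jspace g ->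
  forall a, Q (fun a => c * f a) g a = c * Q f g a.
Proof.
move=> Lf Lg a; rewrite /collision_form big_distrr/=; apply: eq_bigr => sb _.
rewrite big_distrr/=; apply: eq_bigr => sc _.
have i := integrable_curve_term m4 e00 eh0 chiP sb sc a Lf Lg.
refine (etrans _ (RintegralZl c measurableT i)).
by congr (Rint _); apply/funext => y; rewrite /curve_term; ring.
Qed.

Lemma collision_formZr c f g : jspace f -> jspace g ->
  forall a, Q f (fun a => c * g a) a = c * Q f g a.
Proof.
move=> Lf Lg a; rewrite /collision_form big_distrr/=; apply: eq_bigr => sb _.
rewrite big_distrr/=; apply: eq_bigr => sc _.
have i := integrable_curve_term m4 e00 eh0 chiP sb sc a Lf Lg.
refine (etrans _ (RintegralZl c measurableT i)).
by congr (Rint _); apply/funext => y; rewrite /curve_term; ring.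
Qed.

Definition negative_part (f : mode R -> R) (a : mode R) : R := Num.max 0 (- f a).

(* The gain term has a nonnegative kernel and the loss term is a multiple of
   [f a], so on [f a < 0] only the negative part of [f] pushes [f] down. *)
Lemma curve_term_ge f sb sc a y : f a < 0 ->
  - (curve_majorant chi f (negative_part f) sb sc a y
     + curve_majorant chi (negative_part f) f sb sc a y)
  <= curve_term chi f f sb sc a y.
Proof.
move=> fa0; rewrite /curve_majorant /curve_term /=.
set b := curve_b _ _ _ _; set c := curve_c _ _ _ _; set W := curve_weight _ _ _ _ _.
have np (x : mode R) : `|negative_part f x| = Num.max 0 (- f x).
  by rewrite ger0_norm// /negative_part le_max lexx.
rewrite !np.
have na : Num.max 0 (- f a) = `|f a| by rewrite ltr0_norm// max_r// oppr_ge0 ltW.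
(* The weight carries [omegah a] once and the gain term once more, so the gain kernel contains its
   square. *)
have Wa : 0 <= W * omegah a.
  rewrite /W /curve_weight -/b -/c.
  rewrite (_ : _ * omegah a = (chih chi a * chih chi b * chih chi c) *
    (Gammah a b c ^+ 2 * omegah a ^+ 2 / `|Xih_slope sb sc a y|)); last by ring.
  have chi0 d : 0 <= chih chi d by have /andP[] := chih_bounds chiP d.
  apply: mulr_ge0; first by rewrite !mulr_ge0 ?chi0.
  by apply: divr_ge0 => //; apply: mulr_ge0; exact: sqr_ge0.
have gain : - (`|W| * (`|omegah a| * (`|f b| * Num.max 0 (- f c) + Num.max 0 (- f b) * `|f c|)))
    <= W * omegah a * (f b * f c).
  have -> : `|W| * (`|omegah a| * (`|f b| * Num.max 0 (- f c) + Num.max 0 (- f b) * `|f c|)) =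
      W * omegah a * (`|f b| * Num.max 0 (- f c) + Num.max 0 (- f b) * `|f c|).
    by rewrite mulrA -normrM (ger0_norm Wa).
  rewrite -mulrN; apply: ler_wpM2l => //.
  exact: mul_ge_negative_parts.
have loss (o z : R) : - (`|W| * (`|o| * (`|f a| * `|z|))) <= W * (o * (f a * z)).
  by rewrite -!normrM lerNl -normrN ler_norm.
have l1 := loss (omegah c) (f b); have l2 := loss (omegah b) (f c).
rewrite na.
have P1 : 0 <= `|W| * (`|omegah c| * (`|f a| * Num.max 0 (- f b)) + `|omegah b| * (`|f a| * Num.max 0 (- f c))).
  by rewrite !mulr_ge0 ?addr_ge0 ?mulr_ge0 ?le_max ?lexx.
move: gain l1 l2 P1; rewrite !mulrDr !mulrA; lra.
Qed.

(** [curve_term_ge] subtracts two majorants, each with the bound of the form itself, whence the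
    2. *)
Lemma collision_form_ge M N f a : jspace f -> jbounded M f -> jbounded N (negative_part f) ->
  f a < 0 -> - (2 * form_constant m eps0 epsh * (M * N)) <= jweight m a * Q f f a.
Proof.
move=> Lf fM gN fa0; have w0 := jweight_gt0 m a.
have [iB EB] := profile_pairP m4 ((jweight m a)^-1 * - (2 * (CC * (M * N)))) (- a.2.2).
have key sb sc : (jweight m a)^-1 * - (2 * (CC * (M * N))) * (2 * profile_integral m)
    <= Rint (curve_term chi f f sb sc a).
  rewrite -EB; apply: (le_Rintegral measurableT iB (integrable_curve_term m4 e00 eh0 chiP sb sc a Lf Lf)) => y _.
  apply: le_trans (curve_term_ge sb sc y fa0).
  have h1 := curve_majorant_le m4 e00 eh0 chiP sb sc a y fM gN.
  have h2 := curve_majorant_le m4 e00 eh0 chiP sb sc a y gN fM.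
  rewrite -[leLHS]mulrA ler_pdivrMl// [leRHS]mulrN [leLHS]mulNr lerN2 [leLHS]mulrDr.
  apply: le_trans (lerD h1 h2) _; rewrite [N * M]mulrC.
  by rewrite le_eqVlt; apply/orP; left; apply/eqP; ring.
rewrite -ler_pdivrMl// /collision_form !big_bool/=.
apply: le_trans (lerD (lerD (key true true) (key true false)) (lerD (key false true) (key false false))).
rewrite le_eqVlt; apply/orP; left; apply/eqP; rewrite /form_constant.
set w := (jweight m a)^-1; set C := collision_constant _ _ _; set I := profile_integral _; ring.
Qed.

End Form.
End CollisionFormTheory.

(** * The co-area integral as an integral over the second component *)

Section CurveGeometry.
Variable R : realType.

Lemma is_derive_normr (y : R) : y != 0 -> is_derive y 1 (fun z : R => `|z|) (y / `|y|).
Proof.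
move=> y0; have [yp|yn|/eqP] := ltrgt0P y; last by rewrite (negbTE y0).
- apply: (@near_eq_is_derive _ _ _ (fun z => z)).
    have /cvgr_gt/(_ 0 yp) h := @cvg_id _ (nbhs y).
    by near=> z; rewrite gtr0_norm//; near: z; exact: h.
  by rewrite divff//; exact: is_derive_id.
- apply: (@near_eq_is_derive _ _ _ (fun z => - z)).
    have /cvgr_lt/(_ 0 yn) h := @cvg_id _ (nbhs y).
    by near=> z; rewrite ltr0_norm//; near: z; exact: h.
  by rewrite invrN mulrN divff//; exact: is_deriveN.
Unshelve. all: by end_near. Qed.

Lemma is_derive_normr_reflect (q y : R) : q - y != 0 ->
  is_derive y 1 (fun z : R => `|q - z|) (- ((q - y) / `|q - y|)).
Proof.
move=> r0; have d1 : is_derive y 1 (fun z : R => q - z) (- 1).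
  by rewrite -[X in is_derive _ _ _ X]add0r; apply: is_deriveB.
have := @is_derive1_comp _ (fun z => `|z|) (fun z : R => q - z) y _ _ (is_derive_normr r0) d1.
by rewrite mulrN1.
Qed.

Lemma is_derive_divr (c : R) (f : R -> R) (y df : R) : f y != 0 -> is_derive y 1 f df ->
  is_derive y 1 (fun z => c / f z) (- (c * df / f y ^+ 2)).
Proof.
move=> f0 dfy; have h := @is_deriveZ _ _ _ _ c _ _ _ (is_deriveV f0 dfy).
by apply: (is_derive_eq h); rewrite -[LHS]/(c * (- (f y ^+ 2)^-1 * df)); ring.
Qed.

Section Curve.
Variables (sb sc : bool) (a : mode R).
Local Notation q := (- a.2.2).
Local Notation p := (a.2.1).
Local Notation slope := (Xih_slope sb sc a).
Local Notation x := (curve_x sb sc a).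

Let du y : R := - (sgn R sb * (y / `|y|) / `|y| ^+ 2).
Let dv y : R := - (sgn R sc * - ((q - y) / `|q - y|) / `|q - y| ^+ 2).

Definition curve_dx y : R := (p * dv y - x y * (du y - dv y)) / slope y.

(** Clearing denominators in the condition that the slope exists and is nonzero leaves a continuous
    function, which makes openness immediate. *)
Definition curve_domain : set R :=
  [set y | y * (q - y) * (sgn R sb * `|q - y| - sgn R sc * `|y|) != 0].

Lemma curve_domainP y : curve_domain y <-> [/\ y != 0, q - y != 0 & slope y != 0].
Proof.
rewrite /curve_domain /= !mulf_eq0 !negb_or.
split=> [/andP[/andP[y0 r0] s0]|[y0 r0 s0]]; last first.
  rewrite y0 r0 /=; apply: contra_neq s0 => s0.
  rewrite /Xih_slope.
  rewrite (_ : sgn R sb / `|y| - _ = (sgn R sb * `|q - y| - sgn R sc * `|y|) / (`|y| * `|q - y|)).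
    by rewrite s0 mul0r.
  by field; rewrite !normr_eq0 y0 r0.
split=> //; apply: contra_neq s0 => s0.
rewrite (_ : sgn R sb * `|q - y| - _ = slope y * (`|y| * `|q - y|)); first by rewrite s0 mul0r.
by rewrite /Xih_slope; field; rewrite !normr_eq0 y0 r0.
Qed.

Lemma open_curve_domain : open curve_domain.
Proof.
apply: (@open_comp _ _ (fun y : R => y * (q - y) * (sgn R sb * `|q - y| - sgn R sc * `|y|))
   [set z | z != 0]); last exact: open_neq.
move=> y _.
have c1 : (q - z) @[z --> y] --> q - y by apply: cvgB; [exact: cvg_cst|exact: cvg_id].
apply: cvgM; first by apply: cvgM => //; exact: cvg_id.
apply: cvgB; apply: cvgMl_tmp; apply: cvg_norm => //; exact: cvg_id.
Qed.

Section Point.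
Variable y : R.
Hypothesis Dy : curve_domain y.

Let y0 : y != 0. Proof. by have [] := (curve_domainP y).1 Dy. Qed.
Let r0 : q - y != 0. Proof. by have [] := (curve_domainP y).1 Dy. Qed.
Let s0 : slope y != 0. Proof. by have [] := (curve_domainP y).1 Dy. Qed.
Let ny0 : `|y| != 0. Proof. by rewrite normr_eq0 y0. Qed.
Let nr0 : `|q - y| != 0. Proof. by rewrite normr_eq0 r0. Qed.

Let is_derive_u : is_derive y 1 (fun z => sgn R sb / `|z|) (du y).
Proof. exact: (is_derive_divr (sgn R sb) ny0 (is_derive_normr y0)). Qed.

Let is_derive_v : is_derive y 1 (fun z => sgn R sc / `|q - z|) (dv y).
Proof. exact: (@is_derive_divr (sgn R sc) (fun z => `|q - z|) y _ nr0 (is_derive_normr_reflect r0)). Qed.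

Lemma is_derive_slope : is_derive y 1 slope (du y - dv y).
Proof. exact: (is_deriveB is_derive_u is_derive_v). Qed.

Lemma is_derive_curve_x : is_derive y 1 x (curve_dx y).
Proof.
have dN : is_derive y 1 (fun z => sgn R sc * p / `|q - z| - omegah a) (p * dv y).
  rewrite (_ : (fun z => _) = (p \*: (fun z => sgn R sc / `|q - z|)) - cst (omegah a)).
    apply: is_derive_eq; last exact: subr0.
    exact: (is_deriveB (is_deriveZ p is_derive_v) (is_derive_cst _ _ _)).
  apply/funext => z; rewrite -[RHS]/(p * (sgn R sc / `|q - z|) - omegah a); ring.
have h := is_deriveM dN (is_deriveV s0 is_derive_slope).
apply: (is_derive_eq h).
rewrite -[LHS]/((sgn R sc * p / `|q - y| - omegah a) * (- (slope y ^+ 2)^-1 * (du y - dv y))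
  + (slope y)^-1 * (p * dv y)).
rewrite /curve_dx /curve_x; set N := _ - omegah a.
move: s0; set S := slope y; set A := du y; set B := dv y => S0.
by field.
Qed.

Lemma continuous_curve_dx : {for y, continuous curve_dx}.
Proof.
have [dx _] := is_derive_curve_x; have [ds _] := is_derive_slope.
have cx : x z @[z --> y] --> x y by exact/differentiable_continuous/derivable1_diffP.
have cs : slope z @[z --> y] --> slope y by exact/differentiable_continuous/derivable1_diffP.
have cid : z @[z --> y] --> y by exact: cvg_id.
have cr : (q - z) @[z --> y] --> q - y by apply: cvgB cid; exact: cvg_cst.
have cn : `|z| @[z --> y] --> `|y| by exact: cvg_norm.
have cnr : `|q - z| @[z --> y] --> `|q - y| by exact: cvg_norm.
have n2 : `|y| ^+ 2 != 0 by rewrite expf_neq0.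
have nr2 : `|q - y| ^+ 2 != 0 by rewrite expf_neq0.
have cn2 : `|z| ^+ 2 @[z --> y] --> `|y| ^+ 2 by exact: (cvgM cn cn).
have cnr2 : `|q - z| ^+ 2 @[z --> y] --> `|q - y| ^+ 2 by exact: (cvgM cnr cnr).
have ci : `|z|^-1 @[z --> y] --> `|y|^-1 by exact: (cvgV ny0 cn).
have cir : `|q - z|^-1 @[z --> y] --> `|q - y|^-1 by exact: (cvgV nr0 cnr).
have ci2 : (`|z| ^+ 2)^-1 @[z --> y] --> (`|y| ^+ 2)^-1 by exact: (cvgV n2 cn2).
have cir2 : (`|q - z| ^+ 2)^-1 @[z --> y] --> (`|q - y| ^+ 2)^-1 by exact: (cvgV nr2 cnr2).
have cu : (z / `|z|) @[z --> y] --> y / `|y| by exact: (cvgM cid ci).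
have cv : (- ((q - z) / `|q - z|)) @[z --> y] --> - ((q - y) / `|q - y|).
  by apply: cvgN; exact: (cvgM cr cir).
have cdu : du z @[z --> y] --> du y.
  by apply: cvgN; apply: cvgM ci2; exact: cvgMl_tmp.
have cdv : dv z @[z --> y] --> dv y.
  by apply: cvgN; apply: cvgM cir2; exact: cvgMl_tmp.
have csi : (slope z)^-1 @[z --> y] --> (slope y)^-1 by exact: (cvgV s0 cs).
apply: cvgM csi; apply: cvgB; first exact: cvgMl_tmp.
by apply: cvgM cx _; exact: cvgB.
Qed.

(** By implicit differentiation the gradient on the curve is [slope y] times [(1, - curve_dx y)].
    The square root is the arc length density of the graph, so only [1 / |slope y|] remains in the
    co-area integral. *)
Lemma enorm_gradient_Xih :
  enorm (gradient (Xih a sb sc) (x y, y)) = `|slope y| * Num.sqrt (1 + curve_dx y ^+ 2).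
Proof.
have g1 : (gradient (Xih a sb sc) (x y, y)).1 = slope y.
  rewrite /gradient /= derive1E.
  rewrite (_ : (fun t => _) = (slope y \*: (fun t => t))
      + cst (omegah a - sgn R sc * p / `|q - y|)); last first.
    apply/funext => t.
    rewrite -[RHS]/(slope y * t + (omegah a - sgn R sc * p / `|q - y|)).
    rewrite /Xih /bmode /cmode {2 3}/omegah /= /Xih_slope; ring.
  have h := is_deriveD (is_deriveZ (slope y) (is_derive_id (x y) (1 : R)))
    (is_derive_cst (omegah a - sgn R sc * p / `|q - y|) (x y) (1 : R)).
  by rewrite (@derive_val _ _ _ _ _ _ _ h) -[LHS]/(slope y * 1 + 0) mulr1 addr0.
have g2 : (gradient (Xih a sb sc) (x y, y)).2 = - curve_dx y * slope y.
  rewrite /gradient /= derive1E.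
  rewrite (_ : (fun t => _) = (cst (omegah a) + (x y \*: (fun z => sgn R sb / `|z|)))
      + ((- p - x y) \*: (fun z => sgn R sc / `|q - z|))); last first.
    apply/funext => t.
    rewrite -[RHS]/(omegah a + x y * (sgn R sb / `|t|) + (- p - x y) * (sgn R sc / `|q - t|)).
    rewrite /Xih /bmode /cmode {2 3}/omegah /=; ring.
  have h := is_deriveD (is_deriveD (is_derive_cst (omegah a) y 1) (is_deriveZ (x y) is_derive_u))
     (is_deriveZ (- p - x y) is_derive_v).
  rewrite (@derive_val _ _ _ _ _ _ _ h).
  rewrite -[LHS]/(0 + x y * du y + (- p - x y) * dv y) mulNr /curve_dx divfK//; ring.
rewrite /enorm g1 g2 exprMn sqrrN -[X in X + _]mul1r -mulrDl mulrC sqrtrM ?sqr_ge0//.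
by rewrite sqrtr_sqr.
Qed.

End Point.

End Curve.
End CurveGeometry.

Section CurveIntegralRealization.
Variable R : realType.
Local Notation lambda := (@lebesgue_measure R).
Local Notation Rint F := (Rintegral lambda setT F).

Section CurveIntegral.
Variables (m eps0 epsh : R) (chi : R -> R).
Hypotheses (m4 : 4 < m) (e00 : 0 < eps0) (eh0 : 0 < epsh) (chiP : cutoff eps0 epsh chi).
Variables (n : mode R -> R) (a : mode R) (sb sc : bool).
Hypothesis Ln : jspace m n.
Local Notation D := (curve_domain sb sc a).
Local Notation x := (curve_x sb sc a).
Local Notation dx := (curve_dx sb sc a).
Local Notation slope := (Xih_slope sb sc a).
Local Notation q := (- a.2.2).

Lemma XihE t y : Xih a sb sc (t, y) =
  slope y * t - (sgn R sc * a.2.1 / `|q - y| - omegah a).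
Proof. by rewrite /Xih /bmode /cmode {2 3}/omegah /= /Xih_slope; ring. Qed.

(** Where the slope vanishes, [Xih] is constant in the first component and the curve might contain a
    whole horizontal line. This would force [|q - y| = |a.2.2| = |y|], which neither [y = a.2.2] nor
    [y = - a.2.2] allows. *)
Lemma resonant_slope_neq0 y : a.2.1 != 0 -> a.2.2 != 0 -> y != 0 -> q - y != 0 ->
  slope y = 0 -> sgn R sc * a.2.1 / `|q - y| - omegah a != 0.
Proof.
move=> p0 q0 y0 r0 s0; apply/eqP => /eqP; rewrite subr_eq0 => /eqP /(congr1 Num.norm).
rewrite /omegah !normrM !normfV !normr_id !sgn_norm !mul1r => E.
have np : `|a.2.1| != 0 by rewrite normr_eq0.
have vq : `|q - y| = `|a.2.2| by apply: invr_inj; apply: (mulfI np).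
have /eqP := s0; rewrite /Xih_slope subr_eq0 => /eqP /(congr1 Num.norm).
rewrite !normrM !normfV !normr_id !sgn_norm !mul1r => /invr_inj uv.
have yq : `|y| = `|a.2.2| by rewrite uv.
have : y ^+ 2 = a.2.2 ^+ 2 by rewrite -(real_normK (num_real y)) yq real_normK// num_real.
move/eqP; rewrite eqf_sqr => /orP[] /eqP yE.
  move: vq; rewrite yE -opprD normrN -mulr2n normrMn => /eqP.
  by rewrite -subr_eq0 -[X in _ - X]mulr1n -mulrnBr// mulr1n normr_eq0 (negbTE q0).
by move: r0; rewrite yE subrr eqxx.
Qed.

Lemma resonant_curve_graph : a.2.1 != 0 -> a.2.2 != 0 ->
  resonant_curve a sb sc = (fun y => (x y, y)) @` D.
Proof.
move=> p0 q0; apply/seteqP; split=> [[t y] /= [y0 r0 X0]|_ [y /curve_domainP[y0 r0 s0] <-]].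
  rewrite /= in y0 r0.
  have s0 : slope y != 0.
    apply/eqP => s0; have := resonant_slope_neq0 p0 q0 y0 r0 s0.
    by move: X0; rewrite XihE s0 mul0r sub0r => /eqP; rewrite oppr_eq0 => ->.
  exists y; first exact/curve_domainP.
  congr (_, _); rewrite /curve_x; apply/eqP; rewrite eq_sym -(inj_eq (mulfI s0)).
  by rewrite mulrC [X in _ == X]mulrC divfK// mulrC -subr_eq0 -XihE X0.
by split => //=; rewrite XihE /curve_x mulrC divfK// subrr.
Qed.

Lemma curve_termE y : curve_term chi n n sb sc a y =
  integrand chi n a (curve_b sb sc a y) (curve_c sb sc a y) / `|slope y|.
Proof. by rewrite /curve_term /curve_weight /integrand; ring. Qed.

Lemma curve_term_outside y : ~ D y -> curve_term chi n n sb sc a y = 0.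
Proof.
move=> Dy; have [a0|a0] := eqVneq a.2 0; first by rewrite /curve_term curve_weight0// mul0r.
have [W0|W0] := eqVneq (curve_weight sb sc a y chi) 0; first by rewrite /curve_term W0 mul0r.
by exfalso; apply: Dy; apply/curve_domainP; have [_] := curve_weight_neq0 W0.
Qed.

Lemma curve_integralE : curve_integral chi n a sb sc = (Rint (curve_term chi n n sb sc a))%:E.
Proof.
have it := integrable_curve_term m4 e00 eh0 chiP sb sc a Ln Ln.
have EI : (Rint (curve_term chi n n sb sc a))%:E =
    (\int[lambda]_y (curve_term chi n n sb sc a y)%:E)%E.
  by rewrite /Rintegral fineK//; exact: integrable_fin_num it.
(* The curve is a graph once both components of [a.2] are nonzero, which a nonzero cut-off at [a]
   ensures away from the origin. In the remaining cases both integrands vanish. *)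
have [ca|ca] := eqVneq (chih chi a) 0.
  have t0 y : curve_term chi n n sb sc a y = 0.
    by rewrite /curve_term /curve_weight ca !mul0r.
  rewrite EI /curve_integral !integral0_eq// => [y _|k _]; first by rewrite t0.
  by rewrite /integrand ca !mul0r.
have [a0|a0] := eqVneq a.2 0.
  have t0 y : curve_term chi n n sb sc a y = 0 by rewrite /curve_term curve_weight0// mul0r.
  have w0 : omegah a = 0 by rewrite /omegah a0 /= mul0r mulr0.
  rewrite EI /curve_integral !integral0_eq// => [y _|k _]; first by rewrite t0.
  by rewrite /integrand w0 mulr0 !mul0r.
have [h1 h2] := chih_support chiP ca.
have n0 : 0 < enorm a.2 by rewrite lt0r enorm_eq0 a0 enorm_ge0.
have p0 : a.2.1 != 0 by rewrite -normr_gt0 (lt_le_trans _ h1)// mulr_gt0.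
have q0 : a.2.2 != 0 by rewrite -normr_gt0 (lt_le_trans _ h2)// mulr_gt0.
pose J y := Num.sqrt (1 + dx y ^+ 2).
have J0 y : 0 < J y by rewrite sqrtr_gt0 ltr_pwDl// sqr_ge0.
rewrite EI /curve_integral (resonant_curve_graph p0 q0).
have oD : open D by exact: open_curve_domain.
have mD : measurable D by exact: open_measurable.
have ddx y (Dy : D y) : is_derive y 1 x (dx y) by exact: is_derive_curve_x.
have cdx y (Dy : D y) : {for y, continuous dx} by exact: continuous_curve_dx.
pose t := curve_term chi n n sb sc a.
(* The co-area density on the graph as a function of [y]; the area formula multiplies it back by
   [J]. *)
pose Phi : R -> \bar R := (fun y => (t y / J y)%:E) \_ D.
have PhiE y : D y -> Phi y = (t y / J y)%:E by move=> Dy; rewrite /Phi patchE mem_set.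
have mPhi : measurable_fun setT Phi.
  apply/(measurable_restrictT _ mD)/measurable_EFinP; apply: measurable_funM.
    apply: measurable_funTS; have [mn _] := Ln.
    exact: (measurable_curve_term_section e00 chiP sb sc a mn mn).
  have mdx : measurable_fun D dx.
    by apply: open_continuous_measurable_fun => // y /set_mem; exact: cdx.
  apply: (measurableT_comp (@measurable_invr R)).
  apply: (measurableT_comp (continuous_measurable_fun (@sqrt_continuous R))).
  by apply: measurable_funD => //; exact: measurable_funX.
have graphE (f : R -> \bar R) : measurable_fun setT f -> (forall y, 0 <= f y)%E ->
    (\int[hausdorff1_measure R]_(k in (fun y => (x y, y)) @` D) f k.2
     = \int[lambda]_(y in D) (f y * (J y)%:E))%E.
  by move=> mf f0; exact: (graph_integral oD ddx cdx mf f0).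
have onD (f : R -> \bar R) : (forall y, ~ D y -> f y = 0%E) ->
    (\int[lambda]_(y in D) f y = \int[lambda]_y f y)%E.
  move=> f0; rewrite [LHS]integral_mkcond; congr (integral _ _ _); apply/funext => y.
  by rewrite patchE; case: ifPn => //; rewrite notin_setE => /f0.
transitivity (\int[hausdorff1_measure R]_(k in (fun y => (x y, y)) @` D) Phi k.2)%E.
  apply: eq_integral => k /set_mem[y Dy <-] /=.
  rewrite (enorm_gradient_Xih Dy) PhiE// /t curve_termE; congr EFin.
  by rewrite invfM mulrA.
have tE (y : R) : D y -> (Phi y * (J y)%:E = (t y)%:E)%E.
  by move=> Dy; rewrite PhiE// -EFinM divfK ?gt_eqF.
have outE y : ~ D y -> (t y)%:E = 0%E by move=> /curve_term_outside ty; rewrite /t ty.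
have J_ge0 y : (0 <= (J y)%:E)%E by rewrite lee_fin ltW.
(* The area formula is available for nonnegative functions, so positive and negative parts are
   treated separately. *)
rewrite [LHS]integralE [RHS]integralE; congr (_ - _)%E.
  refine (etrans _ (etrans (graphE _ (measurable_funepos mPhi) (funepos_ge0 Phi)) _)).
    by apply: eq_integral => k _; rewrite !funeposE.
  rewrite -onD; last by move=> y Dy; rewrite funeposE outE// maxxx.
  by apply: eq_integral => y /set_mem Dy; rewrite !funeposE -tE// maxe_pMl// mul0e.
refine (etrans _ (etrans (graphE _ (measurable_funeneg mPhi) (funeneg_ge0 Phi)) _)).
  by apply: eq_integral => k _; rewrite !funenegE.
rewrite -onD; last by move=> y Dy; rewrite funenegE outE// oppe0 maxxx.
by apply: eq_integral => y /set_mem Dy; rewrite !funenegE -tE// maxe_pMl// mul0e mulNe.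
Qed.

End CurveIntegral.
End CurveIntegralRealization.

(** * Quadratic evolution equations *)

Section DerivativeOn.
Variable R : realType.
Implicit Types (f g : R -> R) (T t c : R).

(** A derivative relative to [0, T], hence one-sided at the end points. Without a difference
    quotient, [s = t] is no exception. *)
Definition derivative_on (T : R) (f : R -> R) (t d : R) : Prop :=
  forall e : R, 0 < e -> exists2 r : R, 0 < r & forall s, 0 <= s <= T -> `|s - t| < r ->
    `|f s - f t - d * (s - t)| <= e * `|s - t|.

Lemma derivative_onD T f g t d d' : derivative_on T f t d -> derivative_on T g t d' ->
  derivative_on T (fun s => f s + g s) t (d + d').
Proof.
move=> df dg e e0; have e2 : 0 < e / 2 by rewrite divr_gt0.
have [r r0 fr] := df _ e2; have [r' r'0 gr] := dg _ e2.
exists (Num.min r r'); first by rewrite lt_min r0.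
move=> s sT; rewrite lt_min => /andP[/(fr _ sT) h1 /(gr _ sT) h2].
rewrite (_ : _ - _ = (f s - f t - d * (s - t)) + (g s - g t - d' * (s - t))); last by ring.
apply: le_trans (ler_normD _ _) _; apply: le_trans (lerD h1 h2) _; lra.
Qed.

Lemma derivative_onZ T c f t d : derivative_on T f t d ->
  derivative_on T (fun s => c * f s) t (c * d).
Proof.
move=> df e e0; have c1 : 0 < `|c| + 1 by rewrite ltr_wpDl.
have [r r0 fr] := df _ (divr_gt0 e0 c1); exists r => // s sT sr.
rewrite (_ : _ - _ = c * (f s - f t - d * (s - t))); last by ring.
rewrite normrM; have h := fr _ sT sr.
apply: le_trans (ler_wpM2l (normr_ge0 c) h) _.
rewrite mulrA ler_wpM2r// mulrCA; apply: ler_piMr; first exact: ltW.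
by rewrite ler_pdivrMr// mul1r lerDl.
Qed.

Lemma derivative_on_cst T c t : derivative_on T (fun _ => c) t 0.
Proof.
move=> e e0; exists 1 => // s _ _; rewrite subrr mul0r subr0 normr0.
by rewrite mulr_ge0 ?normr_ge0//; exact: ltW.
Qed.

Lemma derivative_on_is_derive T f t (d : R) : is_derive t 1 f d -> derivative_on T f t d.
Proof.
move=> [df <-] e e0; move: df => /cvgrPdist_le/(_ _ e0)[r /= r0 fr].
exists r => // s _ sr; have [->|st] := eqVneq s t.
  by rewrite !subrr mulr0 subr0 normr0 mulr0.
have st0 : s - t != 0 by rewrite subr_eq0.
have := fr (s - t); rewrite /= sub0r normrN => /(_ sr st0).
rewrite -[_ *: _]/(_ * _) -[_%:A]/((s - t) * 1) mulr1 subrK.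
set D := 'D_1 f t => h; have st1 : 0 < `|s - t| by rewrite normr_gt0.
rewrite -(ler_pM2r st1) -normrM in h.
have E : (D - (s - t)^-1 * (f s - f t)) * (s - t) = - (f s - f t - D * (s - t)).
  by field.
by rewrite E normrN in h.
Qed.

Lemma derivative_on_continuous T f t d (e : R) : derivative_on T f t d -> 0 < e ->
  exists2 r : R, 0 < r & forall s, 0 <= s <= T -> `|s - t| < r -> `|f s - f t| <= e.
Proof.
move=> df e0; have [r r0 fr] := df 1 ltr01.
have d1 : 0 < `|d| + 1 by rewrite ltr_wpDl.
exists (Num.min r (e / (`|d| + 1))); first by rewrite lt_min r0 divr_gt0.
move=> s sT; rewrite lt_min => /andP[/(fr _ sT) h]; rewrite ltr_pdivlMr// => se.
rewrite -[f s - f t](subrK (d * (s - t))); apply: le_trans (ler_normD _ _) _.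
apply: le_trans (lerD h (lexx _)) _; rewrite normrM; lra.
Qed.

(* First-crossing argument applied to [f + eta * (1 + t)], which is positive at 0
   and has a positive derivative wherever it vanishes. *)
Lemma nonneg_barrier T f (d : R -> R) : 0 <= f 0 ->
  (forall t, 0 <= t <= T -> derivative_on T f t (d t)) ->
  (forall t, 0 <= t <= T -> f t < 0 -> 0 <= d t) ->
  forall t, 0 <= t <= T -> 0 <= f t.
Proof.
move=> f0 df d0 t1 /andP[t10 t1T]; rewrite leNgt; apply/negP => ft1.
have t11 : 0 < 1 + t1 by lra.
(* Chosen so that the perturbed function still is negative at [t1], with value [f t1 / 2]. *)
pose eta := - f t1 / (2 * (1 + t1)).
have eta0 : 0 < eta by rewrite divr_gt0 ?mulr_gt0// oppr_gt0.
pose g t := f t + eta * (1 + t).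
have g1 : g t1 < 0.
  have -> : g t1 = f t1 / 2 by rewrite /g /eta; field; rewrite gt_eqF.
  by rewrite pmulr_llt0// invr_gt0.
have dg t : 0 <= t <= T -> derivative_on T g t (d t + eta).
  move=> tT; apply: derivative_onD; first exact: df.
  have : derivative_on T (fun s : R => 1 + s) t 1.
    move=> e e0; exists 1 => // u _ _; rewrite (_ : _ - _ = 0); last by ring.
    by rewrite normr0 mulr_ge0 ?normr_ge0//; exact: ltW.
  by move/(derivative_onZ eta); rewrite mulr1.
pose A : set R := [set t | 0 <= t <= t1 /\ 0 <= g t].
have A0 : A 0 by rewrite /A/= lexx t10 /g addr_ge0// addr0 mulr1 ltW.
have ubA : ubound A t1 by move=> t [/andP[]].
have supA : has_sup A by split; [exists 0|exists t1].
pose s := sup A.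
have s0 : 0 <= s by apply: ub_le_sup => //; exists t1.
have st1 : s <= t1 by apply: ge_sup => //; exists 0.
have sT : 0 <= s <= T by rewrite s0 (le_trans st1).
have gs0 : 0 <= g s.
  rewrite leNgt; apply/negP => gs.
  have gs2 : 0 < - g s / 2 by rewrite divr_gt0// oppr_gt0.
  have [r r0 gr] := derivative_on_continuous (dg _ sT) gs2.
  have [t [/andP[t0 tt1] gt] st] := sup_adherent r0 supA.
  have At : A t by split => //; rewrite t0.
  have ts : t <= s by apply: ub_le_sup => //; exists t1.
  have := gr t; rewrite t0 (le_trans tt1 t1T) => /(_ isT).
  rewrite distrC ger0_norm ?subr_ge0// ltrBlDr -ltrBlDl => /(_ st).
  by rewrite ler_norml => /andP[_]; lra.
have {}st1 : s < t1.
  by rewrite lt_neqAle st1 andbT; apply/eqP => E; move: gs0; rewrite E leNgt g1.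
have right t : s < t -> t <= t1 -> g t < 0.
  move=> st tt1; rewrite ltNge; apply/negP => gt.
  suff : t <= s by rewrite leNgt st.
  by apply: ub_le_sup; [exists t1|split => //; rewrite tt1 (le_trans s0)// ltW].
(* A positive value at [s] persists to the right, against the choice of [s] as a supremum. A zero
   value makes [f s] negative, so the derivative of [g] is at least [eta] and [g] becomes positive
   just after [s]. *)
have [gsp|gsn] := ltP 0 (g s).
  have [r r0 gr] := derivative_on_continuous (dg _ sT) (divr_gt0 gsp (ltr0n _ 2)).
  pose t := s + Num.min (r / 2) (t1 - s).
  have m0 : 0 < Num.min (r / 2) (t1 - s) by rewrite lt_min divr_gt0//= subr_gt0.
  have mr : Num.min (r / 2) (t1 - s) <= r / 2 by rewrite ge_min lexx.
  have ms : Num.min (r / 2) (t1 - s) <= t1 - s by rewrite ge_min lexx orbT.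
  have tt1 : t <= t1 by rewrite /t; lra.
  have st : s < t by rewrite /t; lra.
  have := gr t; rewrite (le_trans s0 (ltW st)) (le_trans tt1 t1T) => /(_ isT).
  have tsr : t - s < r by rewrite /t; lra.
  rewrite gtr0_norm ?subr_gt0// => /(_ tsr); rewrite ler_norml => /andP[+ _].
  by have := right t st tt1; lra.
have eta1s : 0 < eta * (1 + s) by rewrite mulr_gt0// ltr_wpDr.
have fs : f s < 0 by move: gsn; rewrite /g; lra.
have ds := d0 _ sT fs.
have eta2 : 0 < eta / 2 by rewrite divr_gt0.
have [r r0 gr] := dg _ sT _ eta2.
pose t := s + Num.min (r / 2) (t1 - s).
have m0 : 0 < Num.min (r / 2) (t1 - s) by rewrite lt_min divr_gt0//= subr_gt0.
have mr : Num.min (r / 2) (t1 - s) <= r / 2 by rewrite ge_min lexx.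
have ms : Num.min (r / 2) (t1 - s) <= t1 - s by rewrite ge_min lexx orbT.
have tt1 : t <= t1 by rewrite /t; lra.
have st : s < t by rewrite /t; lra.
have := gr t; rewrite (le_trans s0 (ltW st)) (le_trans tt1 t1T) => /(_ isT).
have tsr : t - s < r by rewrite /t; lra.
  rewrite gtr0_norm ?subr_gt0// => /(_ tsr); rewrite ler_norml => /andP[+ _].
have := right t st tt1; have := mulr_ge0 ds (ltW (_ : 0 < t - s)); rewrite subr_gt0 => /(_ st).
have : 0 < eta * (t - s) by rewrite mulr_gt0// subr_gt0.
lra.
Qed.

End DerivativeOn.

(** * Geometric series and elementary power estimates *)

Section Estimates.
Variable R : realType.

Lemma sum_geometric_le (c : R) (v : nat -> R) J n : 0 <= c ->
  (forall j, `|v j| <= c * 2^-1 ^+ j) ->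
  `|\sum_(j < J + n) v j - \sum_(j < J) v j| <= 2 * c * 2^-1 ^+ J.
Proof.
move=> c0 vle.
(* The induction needs the exact telescoping remainder, not only its upper bound. *)
have : `|\sum_(j < J + n) v j - \sum_(j < J) v j|
    <= 2 * c * (2^-1 ^+ J - 2^-1 ^+ (J + n)).
  elim: n => [|n IH]; first by rewrite addn0 !subrr normr0 mulr0.
  rewrite addnS big_ord_recr /= addrAC; apply: le_trans (ler_normD _ _) _.
  apply: le_trans (lerD IH (vle _)) _.
  by rewrite exprS; set z := 2^-1 ^+ (J + n); set z' := 2^-1 ^+ J; lra.
have : 0 <= c * 2^-1 ^+ (J + n) by rewrite mulr_ge0// exprn_ge0.
set z := 2^-1 ^+ (J + n); set z' := 2^-1 ^+ J; lra.
Qed.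

Lemma series_geometric (c : R) (v : nat -> R) : 0 <= c ->
  (forall j, `|v j| <= c * 2^-1 ^+ j) ->
  (\sum_(j < n) v j) @[n --> \oo] --> limn (fun n => \sum_(j < n) v j) /\
  forall J, `|limn (fun n => \sum_(j < n) v j) - \sum_(j < J) v j| <= 2 * c * 2^-1 ^+ J.
Proof.
move=> c0 vle; have cv : cvgn (fun n => \sum_(j < n) v j).
  rewrite (_ : (fun n => _) = series v); last first.
    by apply/funext => n; rewrite /series/= big_mkord.
  have g0 j : 0 <= geometric c 2^-1 j by apply: mulr_ge0 => //; exact: exprn_ge0.
  have gc : cvgn (series (geometric c (2^-1 : R))).
    by apply: is_cvg_geometric_series; rewrite ger0_norm// invf_lt1// ltr1n.
  exact: (normed_cvg (series_le_cvg (fun j => normr_ge0 (v j)) g0 vle gc)).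
split=> // J; set l := limn _.
have cvJ : `|\sum_(j < n) v j - \sum_(j < J) v j| @[n --> \oo] --> `|l - \sum_(j < J) v j|.
  by apply: cvg_norm; apply: cvgB => //; exact: cvg_cst.
rewrite -(cvg_lim _ cvJ)//; apply: limr_le; first by apply/cvg_ex; exists (`|l - \sum_(j < J) v j|).
exists J => // n /= Jn; rewrite -(subnKC Jn); exact: sum_geometric_le.
Qed.

Lemma half_pow_cvg0 (c : R) : (c * 2^-1 ^+ n) @[n --> \oo] --> (0 : R).
Proof.
rewrite -[X in _ --> X](mulr0 c); apply: cvgMl_tmp; apply: cvg_expr.
by rewrite ger0_norm// invf_lt1// ltr1n.
Qed.

Lemma le_of_half_pow (x b c : R) : (forall J : nat, x <= b + c * 2^-1 ^+ J) -> x <= b.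
Proof.
move=> H; have h : (b + c * 2^-1 ^+ n) @[n --> \oo] --> b.
  by rewrite -[X in _ --> X]addr0; apply: cvgD; [exact: cvg_cst|exact: half_pow_cvg0].
rewrite -(cvg_lim _ h)//; apply: limr_ge; first by apply/cvg_ex; exists b.
exact: nearW.
Qed.

(** The factor [T ^+ 2] on the left stands for an exponent [j - 2] on the right, which natural
    exponents do not express for [j < 2]. *)
Lemma pow_taylor2 (T s t : R) (j : nat) : 0 <= s <= T -> 0 <= t <= T ->
  `|s ^+ j - t ^+ j - j%:R * t ^+ j.-1 * (s - t)| * T ^+ 2 <= j%:R ^+ 2 * T ^+ j * (s - t) ^+ 2.
Proof.
move=> /andP[s0 sT] /andP[t0 tT]; have T0 : 0 <= T by exact: le_trans tT.
elim: j => [|j IH].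
  rewrite (_ : _ - _ - _ = 0) ?normr0 ?mul0r; last by rewrite !expr0; ring.
  by apply: mulr_ge0; [apply: mulr_ge0|]; rewrite ?sqr_ge0 ?exprn_ge0.
have E : s ^+ j.+1 - t ^+ j.+1 - j.+1%:R * t ^+ j * (s - t) =
    s * (s ^+ j - t ^+ j - j%:R * t ^+ j.-1 * (s - t)) + j%:R * t ^+ j.-1 * (s - t) ^+ 2.
  case: j {IH} => [|j] /=; first by rewrite !expr0 !expr1; ring.
  by rewrite !exprS -(natr1 j.+1); ring.
have tj : j%:R * t ^+ j.-1 * T ^+ 2 <= j%:R * T ^+ j.+1.
  case: j {IH E} => [|j] /=; first by rewrite !mul0r.
  rewrite -mulrA; apply: ler_wpM2l => //; rewrite (_ : T ^+ j.+2 = T ^+ j * T ^+ 2); last first.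
    by rewrite -exprD addn2.
  by apply: ler_wpM2r; [exact: sqr_ge0|apply: lerXn2r; rewrite ?nnegrE].
rewrite /= E.
set A := s ^+ j - _ - _ in IH *.
have sq := sqr_ge0 (s - t).
have h1 : `|s * A + j%:R * t ^+ j.-1 * (s - t) ^+ 2|
    <= T * `|A| + j%:R * t ^+ j.-1 * (s - t) ^+ 2.
  apply: le_trans (ler_normD _ _) _; apply: lerD.
    by rewrite normrM (ger0_norm s0) ler_wpM2r.
  by rewrite ger0_norm//; apply: mulr_ge0 sq; apply: mulr_ge0 => //; exact: exprn_ge0.
apply: le_trans (ler_wpM2r (sqr_ge0 T) h1) _; rewrite mulrDl.
have h2 := ler_wpM2l T0 IH; have h3 := ler_wpM2r sq tj.
have h4 : 0 <= T ^+ j.+1 * (s - t) ^+ 2 by apply: mulr_ge0 sq; exact: exprn_ge0.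
have h5 : 0 <= j%:R * (T ^+ j.+1 * (s - t) ^+ 2) by rewrite mulr_ge0.
apply: (@le_trans _ _ (T * (j%:R ^+ 2 * T ^+ j * (s - t) ^+ 2) + j%:R * T ^+ j.+1 * (s - t) ^+ 2)).
  apply: lerD; first by rewrite -[leLHS]mulrA.
  by rewrite [leLHS]mulrAC.
rewrite -natr1 (_ : T * _ + _ = (j%:R ^+ 2 + j%:R) * (T ^+ j.+1 * (s - t) ^+ 2)).
  by rewrite -mulrA; apply: ler_wpM2r => //; rewrite sqrrD; have : 0 <= j%:R :> R by []; lra.
by rewrite (exprS T j); ring.
Qed.

(** This is why the existence time makes the terms decay like [4^-1 ^+ j]: after a factor [j ^+ 2]
    is absorbed, [2^-1 ^+ j] is still left. *)
Lemma sqr_le_pow2 (j : nat) : (j%:R : R) ^+ 2 <= 2 * 2 ^+ j.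
Proof.
rewrite -exprS -!natrX ler_nat.
have [j3|] := leqP 3 j; last by case: j => [|[|[|]]].
elim: j j3 => // j IH; rewrite leq_eqVlt => /orP[/eqP <-//|j3].
have {}IH := IH j3; rewrite expnS; apply: leq_trans (leq_mul (leqnn 2) IH).
have : (2 * j + 1 <= j * j)%N by nia.
rewrite -!mulnn; lia.
Qed.

End Estimates.

(** Puts a truncated Cauchy product on the index square of the full product, so that their
    difference is the sum over [i + l >= J]. *)
Lemma sum_triangle (V : zmodType) (F : nat -> nat -> V) J :
  \sum_(j < J) \sum_(i < j.+1) F i (j - i)%N =
  \sum_(i < J) \sum_(l < J) (if (i + l < J)%N then F i l else 0).
Proof.
elim: J => [|J IH]; first by rewrite !big_ord0.
rewrite big_ord_recr /= IH.
have split_lt (i : 'I_J.+1) : \sum_(l < J.+1) (if (i + l < J.+1)%N then F i l else 0) =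
    \sum_(l < J) (if (i + l < J)%N then F i l else 0) + F i (J - i)%N.
  have iJ : (J - i < J.+1)%N by rewrite ltnS leq_subr.
  rewrite (bigD1 (Ordinal iJ)) //= subnKC ?ltnSn; last by rewrite -ltnS.
  rewrite addrC; congr (_ + _).
  rewrite (eq_bigr (fun l : 'I_J.+1 => if (i + l < J)%N then F i l else 0)).
    rewrite big_mkcond big_ord_recr /=.
    rewrite [X in _ + X](_ : _ = 0) ?addr0.
      apply: eq_bigr => l _; case: eqVneq => //= El.
      have := congr1 val El; rewrite /= => ->; rewrite subnKC ?ltnn//.
      by rewrite -ltnS.
    by case: ifP => // _; rewrite ltnNge leq_addl.
  move=> l lN; rewrite ltnS leq_eqVlt; case: eqVneq => //= E.
  exfalso; move/negP: lN; apply; apply/eqP/val_inj => /=.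
  by move: E; lia.
rewrite (eq_bigr _ (fun i _ => split_lt i)) big_split /=; congr (_ + _).
rewrite big_ord_recr /= [X in _ + X]big1 ?addr0// => l _.
by rewrite ltnNge leq_addr.
Qed.

(** * Power series solutions for an abstract quadratic form *)

Section QuadraticForm.
Variables (R : realType) (X : Type) (w : X -> R).
Implicit Types (f g h : X -> R).

Definition wbounded (M : R) f := forall a, w a * `|f a| <= M.

(** The interface needed to solve n' = Q(n, n). [qf_lim] takes the place of completeness, and
    [qf_ge] is the quasi-positivity behind preservation of nonnegative data. *)
Record quadratic_form (L : (X -> R) -> Prop) (Q : (X -> R) -> (X -> R) -> X -> R)
    (K : R) : Prop := QuadraticForm {
  qf_weight : forall a, 0 < w a ;
  qf_const : 0 < K ;
  qf_bounded : forall f, L f -> exists M, wbounded M f ;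
  qf_add : forall f g, L f -> L g -> L (fun a => f a + g a) ;
  qf_scale : forall c f, L f -> L (fun a => c * f a) ;
  qf_lim : forall (f : nat -> X -> R) g M, (forall n, L (f n)) ->
    (forall a, f n a @[n --> \oo] --> g a) -> wbounded M g -> L g ;
  qf_stable : forall f g, L f -> L g -> L (Q f g) ;
  qf_addl : forall f f' g, L f -> L f' -> L g -> forall a,
    Q (fun a => f a + f' a) g a = Q f g a + Q f' g a ;
  qf_addr : forall f g g', L f -> L g -> L g' -> forall a,
    Q f (fun a => g a + g' a) a = Q f g a + Q f g' a ;
  qf_scalel : forall c f g, L f -> L g -> forall a, Q (fun a => c * f a) g a = c * Q f g a ;
  qf_scaler : forall c f g, L f -> L g -> forall a, Q f (fun a => c * g a) a = c * Q f g a ;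
  qf_le : forall M N f g, L f -> L g -> wbounded M f -> wbounded N g ->
    wbounded (K * (M * N)) (Q f g) ;
  qf_ge : forall M N f a, L f -> wbounded M f ->
    wbounded N (fun a => Num.max 0 (- f a)) -> f a < 0 ->
    - (2 * K * (M * N)) <= w a * Q f f a }.

Section Theory.
Variables (L : (X -> R) -> Prop) (Q : (X -> R) -> (X -> R) -> X -> R) (K : R).
Hypothesis H : quadratic_form L Q K.

Let w0 a : 0 < w a. Proof. exact: (qf_weight H). Qed.
Let K0 : 0 < K. Proof. exact: (qf_const H). Qed.

Lemma qf_sub f g : L f -> L g -> L (fun a => f a - g a).
Proof.
move=> Lf Lg; rewrite (_ : (fun a => _) = fun a => f a + -1 * g a).
  by apply: (qf_add H) => //; exact: (qf_scale H).
by apply/funext => a; rewrite mulN1r.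
Qed.

Lemma quadratic_lipschitz M d f g : L f -> L g -> wbounded M f -> wbounded M g ->
  wbounded d (fun a => f a - g a) ->
  wbounded (2 * K * (M * d)) (fun a => Q f f a - Q g g a).
Proof.
move=> Lf Lg fM gM dfg a; pose h a := f a - g a.
have Lh : L h by exact: qf_sub.
have fE : f = fun a => h a + g a by apply/funext => x; rewrite /h subrK.
have -> : Q f f a - Q g g a = Q h f a + Q g h a.
  have E1 : Q f f a = Q h f a + Q g f a by rewrite {1}fE (qf_addl H).
  have E2 : Q g f a = Q g h a + Q g g a by rewrite {1}fE (qf_addr H).
  by rewrite E1 E2; ring.
apply: le_trans (ler_wpM2l (ltW (w0 a)) (ler_normD _ _)) _; rewrite mulrDr.
apply: le_trans (lerD (qf_le H Lh Lf dfg fM a) (qf_le H Lg Lh gM dfg a)) _.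
by rewrite le_eqVlt; apply/orP; left; apply/eqP; ring.
Qed.

Section PowerSeries.
Variable g : X -> R.

(* Course-of-values recursion: [picard_coefs n] is the table of the first [n + 1]
   coefficients, so only its values at [j <= n] matter. *)
Fixpoint picard_coefs (n : nat) : nat -> X -> R :=
  if n is n'.+1 then fun j =>
    if (j <= n')%N then picard_coefs n' j else
    fun a => n'.+1%:R^-1 * \sum_(i < n'.+1) Q (picard_coefs n' i) (picard_coefs n' (n' - i)%N) a
  else fun=> g.

Definition picard_coef (j : nat) : X -> R := picard_coefs j j.

Lemma picard_coefsE n j : (j <= n)%N -> picard_coefs n j = picard_coef j.
Proof.
elim: n => [|n IH]; first by rewrite leqn0 => /eqP ->.
rewrite leq_eqVlt ltnS => /orP[/eqP ->//|jn]; rewrite /= jn; exact: IH.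
Qed.

Lemma picard_coefS j a : j.+1%:R * picard_coef j.+1 a =
  \sum_(i < j.+1) Q (picard_coef i) (picard_coef (j - i)%N) a.
Proof.
rewrite /picard_coef /= ltnn mulrA divff ?mul1r// ?pnatr_eq0//.
apply: eq_bigr => i _; rewrite !picard_coefsE ?leq_subr//.
by rewrite -ltnS.
Qed.

Definition picard_sum (J : nat) (t : R) (a : X) : R := \sum_(j < J) t ^+ j * picard_coef j a.

Definition power_solution (t : R) (a : X) : R := limn (fun J => picard_sum J t a).

Variables (rho T : R).
Hypotheses (Lg : L g) (grho : wbounded rho g) (rho0 : 0 < rho) (T0 : 0 < T).
Hypothesis small : K * rho * T <= 4^-1.

Lemma qf_sum_gen n (c : nat -> R) (f : nat -> X -> R) : (forall i, (i < n)%N -> L (f i)) ->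
  L (fun a => \sum_(i < n) c i * f i a).
Proof.
elim: n => [|n IH] Lf.
  rewrite (_ : (fun a => _) = fun a => 0 * g a); first exact: (qf_scale H).
  by apply/funext => a; rewrite big_ord0 mul0r.
rewrite (_ : (fun a => _) = fun a => (\sum_(i < n) c i * f i a) + c n * f n a).
  apply: (qf_add H); last by apply: (qf_scale H); exact: Lf.
  by apply: IH => i ni; apply: Lf; rewrite ltnS ltnW.
by apply/funext => a; rewrite big_ord_recr.
Qed.

(** The recursion has [j + 1] terms, all with the same bound, and the division by [j + 1] averages
    them; the bounds therefore grow only geometrically. *)
Lemma picard_coefP j : L (picard_coef j) /\ wbounded (rho * (K * rho) ^+ j) (picard_coef j).
Proof.
elim/ltn_ind: j => -[_|j IH]; first by rewrite expr0 mulr1.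
have LQ i : (i < j.+1)%N -> L (Q (picard_coef i) (picard_coef (j - i)%N)).
  move=> ij; apply: (qf_stable H); first exact: (IH _ ij).1.
  by apply: (IH _ _).1; rewrite ltnS leq_subr.
have uE : picard_coef j.+1 = fun a =>
    \sum_(i < j.+1) j.+1%:R^-1 * Q (picard_coef i) (picard_coef (j - i)%N) a.
  by apply/funext => a; rewrite -mulr_sumr -picard_coefS mulKf// pnatr_eq0.
split.
  by rewrite uE; apply: (@qf_sum_gen j.+1 (fun=> j.+1%:R^-1)
    (fun i => Q (picard_coef i) (picard_coef (j - i)%N))).
move=> a; have j0 : (0 : R) < j.+1%:R by rewrite ltr0n.
rewrite -(ler_pM2l j0) mulrCA -[X in _ * (X * _)]gtr0_norm// -normrM picard_coefS.
apply: le_trans (ler_wpM2l (ltW (w0 a)) (ler_norm_sum _ _ _)) _.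
rewrite mulr_sumr.
apply: (@le_trans _ _ (\sum_(i < j.+1) rho * (K * rho) ^+ j.+1)); last first.
  by rewrite sumr_const card_ord mulr_natl.
apply: ler_sum => i _.
have [Li bi] := IH _ (ltn_ord i).
have ji : (j - i < j.+1)%N by rewrite ltnS leq_subr.
have [Lji bji] := IH _ ji.
apply: le_trans (qf_le H Li Lji bi bji a) _.
rewrite -[in leRHS](subnKC (_ : (i <= j)%N)) -1?ltnS//.
rewrite exprS exprD le_eqVlt; apply/orP; left; apply/eqP; ring.
Qed.

Let K_ge0 : 0 <= K. Proof. exact: ltW. Qed.
Let rho_ge0 : 0 <= rho. Proof. exact: ltW. Qed.
Let theta_ge0 : 0 <= K * rho. Proof. exact: mulr_ge0. Qed.

Lemma picard_term_le j t a : 0 <= t <= T ->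
  w a * `|t ^+ j * picard_coef j a| <= rho * 4^-1 ^+ j.
Proof.
move=> /andP[t0 tT]; have [_ /(_ a) uj] := picard_coefP j.
rewrite normrM ger0_norm ?exprn_ge0// mulrCA.
apply: le_trans (ler_wpM2l (exprn_ge0 j t0) uj) _.
rewrite mulrCA -exprMn ler_wpM2l// lerXn2r ?nnegrE ?mulr_ge0//.
rewrite mulrC; apply: le_trans small; exact: ler_wpM2l.
Qed.

Lemma picard_term_half j t a : 0 <= t <= T ->
  `|w a * (t ^+ j * picard_coef j a)| <= rho * 2^-1 ^+ j.
Proof.
move=> tT; rewrite normrM gtr0_norm//; apply: le_trans (picard_term_le j a tT) _.
rewrite ler_wpM2l// lerXn2r ?nnegrE// lef_pV2 ?posrE// ler_nat//.
Qed.

Lemma picard_sumP J t : 0 <= t <= T -> L (picard_sum J t) /\ wbounded (2 * rho) (picard_sum J t).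
Proof.
move=> tT; split.
  by apply: (@qf_sum_gen J (fun j => t ^+ j) picard_coef) => i _; exact: (picard_coefP i).1.
move=> a; have := @sum_geometric_le _ rho (fun j => w a * (t ^+ j * picard_coef j a)) 0 J
  rho_ge0 (fun j => picard_term_half j a tT).
by rewrite big_ord0 subr0 expr0 mulr1 add0n -mulr_sumr normrM gtr0_norm.
Qed.

Lemma power_solution_tail t a : 0 <= t <= T ->
  picard_sum J t a @[J --> \oo] --> power_solution t a /\
  forall J, w a * `|power_solution t a - picard_sum J t a| <= 2 * rho * 2^-1 ^+ J.
Proof.
move=> tT; have c0 : 0 <= rho / w a by rewrite divr_ge0// ltW.
have vle j : `|t ^+ j * picard_coef j a| <= rho / w a * 2^-1 ^+ j.
  by rewrite mulrAC ler_pdivlMr// mulrC -(gtr0_norm (w0 a)) -normrM picard_term_half.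
have [cv tail] := series_geometric c0 vle; split => // J.
rewrite mulrC -ler_pdivlMr//; apply: le_trans (tail J) _.
by rewrite le_eqVlt; apply/orP; left; apply/eqP; ring.
Qed.

Lemma power_solutionP t : 0 <= t <= T ->
  L (power_solution t) /\ wbounded (2 * rho) (power_solution t).
Proof.
move=> tT; have b : wbounded (2 * rho) (power_solution t).
  move=> a; have [_ /(_ 0%N)] := power_solution_tail a tT.
  by rewrite /picard_sum big_ord0 subr0 expr0 mulr1.
split => //; apply: (qf_lim H (fun J => (picard_sumP J tT).1) _ b) => a.
exact: (power_solution_tail a tT).1.
Qed.

Lemma power_solution0 a : power_solution 0 a = g a.
Proof.
have tT : (0 : R) <= 0 <= T by rewrite lexx; exact: ltW.
have [_ tail] := power_solution_tail a tT.
have P J : picard_sum J.+1 0 a = g a.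
  rewrite /picard_sum big_ord_recl /= expr0 mul1r big1 ?addr0// => i _.
  by rewrite exprS mul0r mul0r.
apply/eqP; rewrite -subr_eq0 -normr_le0 -(pmulr_rle0 _ (w0 a)).
apply: (@le_of_half_pow _ _ 0 (2 * rho)) => J; rewrite add0r.
apply: le_trans (le_trans (tail J.+1) _); first by rewrite P.
by rewrite ler_wpM2l ?mulr_ge0// exprS ler_piMl ?exprn_ge0// invf_le1// ler1n.
Qed.

(** The formal time derivative of [picard_sum J.+1]. *)
Definition picard_deriv (J : nat) (t : R) (a : X) : R :=
  \sum_(j < J) t ^+ j * (j.+1%:R * picard_coef j.+1 a).

Let Lsum n (c : nat -> R) : L (fun a => \sum_(i < n) c i * picard_coef i a).
Proof. by apply: qf_sum_gen => i _; exact: (picard_coefP i).1. Qed.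

Lemma qf_suml n (c : nat -> R) f a : L f ->
  Q (fun a => \sum_(i < n) c i * picard_coef i a) f a = \sum_(i < n) c i * Q (picard_coef i) f a.
Proof.
move=> Lf; elim: n => [|n IH].
  rewrite (_ : (fun a => _) = fun a => 0 * g a); first by rewrite (qf_scalel H)// mul0r big_ord0.
  by apply/funext => x; rewrite big_ord0 mul0r.
rewrite (_ : (fun a => _) = fun a => (\sum_(i < n) c i * picard_coef i a) + c n * picard_coef n a).
  have Ln := (picard_coefP n).1.
  rewrite (qf_addl H)//; last exact: (qf_scale H).
  by rewrite IH (qf_scalel H)// big_ord_recr.
by apply/funext => x; rewrite big_ord_recr.
Qed.

Lemma qf_sumr n (c : nat -> R) f a : L f ->
  Q f (fun a => \sum_(i < n) c i * picard_coef i a) a = \sum_(i < n) c i * Q f (picard_coef i) a.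
Proof.
move=> Lf; elim: n => [|n IH].
  rewrite (_ : (fun a => _) = fun a => 0 * g a); first by rewrite (qf_scaler H)// mul0r big_ord0.
  by apply/funext => x; rewrite big_ord0 mul0r.
rewrite (_ : (fun a => _) = fun a => (\sum_(i < n) c i * picard_coef i a) + c n * picard_coef n a).
  have Ln := (picard_coefP n).1.
  rewrite (qf_addr H)//; last exact: (qf_scale H).
  by rewrite IH (qf_scaler H)// big_ord_recr.
by apply/funext => x; rewrite big_ord_recr.
Qed.

(** By the recursion [picard_deriv] is the Cauchy product truncated at total degree below [J]. At
    most [J ^+ 2] terms are missing, each of order [4^-1 ^+ J]. *)
Lemma picard_deriv_approx J t a : 0 <= t <= T ->
  w a * `|Q (picard_sum J t) (picard_sum J t) a - picard_deriv J t a|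
    <= 2 * (K * rho ^+ 2) * 2^-1 ^+ J.
Proof.
move=> tT; have /andP[t0 _] := tT.
pose F i l := t ^+ (i + l) * Q (picard_coef i) (picard_coef l) a.
have -> : Q (picard_sum J t) (picard_sum J t) a = \sum_(i < J) \sum_(l < J) F i l.
  rewrite /picard_sum qf_suml//; apply: eq_bigr => i _.
  rewrite (qf_sumr _ _ _ (picard_coefP i).1) mulr_sumr; apply: eq_bigr => l _.
  by rewrite mulrA -exprD.
have -> : picard_deriv J t a = \sum_(j < J) \sum_(i < j.+1) F i (j - i)%N.
  apply: eq_bigr => j _; rewrite picard_coefS mulr_sumr; apply: eq_bigr => i _.
  by rewrite /F subnKC// -ltnS.
have Fle i l : w a * `|F i l| <= K * rho ^+ 2 * 4^-1 ^+ (i + l).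
  have [Li bi] := picard_coefP i; have [Ll bl] := picard_coefP l.
  rewrite normrM ger0_norm ?exprn_ge0// mulrCA.
  apply: le_trans (ler_wpM2l (exprn_ge0 _ t0) (qf_le H Li Ll bi bl a)) _.
  rewrite [leLHS](_ : _ = K * rho ^+ 2 * (t * (K * rho)) ^+ (i + l)); last first.
    by move: (K * rho) => th; rewrite (exprMn (i + l) t th) !exprD; ring.
  rewrite ler_wpM2l ?mulr_ge0 ?sqr_ge0// lerXn2r ?nnegrE ?mulr_ge0//.
  by rewrite mulrC; apply: le_trans small; apply: ler_wpM2l => //; have /andP[] := tT.
rewrite sum_triangle -sumrB.
apply: le_trans (ler_wpM2l (ltW (w0 a)) (ler_norm_sum _ _ _)) _; rewrite mulr_sumr.
apply: (@le_trans _ _ (\sum_(i < J) \sum_(l < J) K * rho ^+ 2 * 4^-1 ^+ J)).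
  apply: ler_sum => i _; rewrite -sumrB.
  apply: le_trans (ler_wpM2l (ltW (w0 a)) (ler_norm_sum _ _ _)) _; rewrite mulr_sumr.
  apply: ler_sum => l _; have c0 : 0 <= K * rho ^+ 2 by rewrite mulr_ge0 ?sqr_ge0.
  case: ltnP => ilJ; first by rewrite subrr normr0 mulr0 mulr_ge0 ?exprn_ge0.
  rewrite subr0; apply: le_trans (Fle i l) _; rewrite ler_wpM2l//.
  by apply: ler_wiXn2l => //; rewrite invf_le1// ler1n.
have c0 : 0 <= K * rho ^+ 2 by rewrite mulr_ge0 ?sqr_ge0.
have -> : \sum_(i < J) \sum_(l < J) K * rho ^+ 2 * 4^-1 ^+ J =
    K * rho ^+ 2 * (J%:R ^+ 2 * 4^-1 ^+ J).
  by rewrite !sumr_const !card_ord -mulrnA -[LHS]mulr_natr natrM; ring.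
rewrite -[leRHS]mulrA [leRHS]mulrCA; apply: ler_wpM2l => //.
have -> : 4^-1 = 2^-1 * 2^-1 :> R by field.
have p0 : 0 <= 2^-1 ^+ J :> R by rewrite exprn_ge0.
have pp : 2 ^+ J * 2^-1 ^+ J = 1 :> R by rewrite -exprMn mulfV// expr1n.
rewrite exprMn mulrA; apply: ler_wpM2r => //.
apply: le_trans (ler_wpM2r p0 (sqr_le_pow2 R J)) _.
by rewrite -mulrA pp mulr1.
Qed.

End PowerSeries.
End Theory.
End QuadraticForm.

Section PowerSolutionDerivative.
Variables (R : realType) (X : Type) (w : X -> R).
Variables (L : (X -> R) -> Prop) (Q : (X -> R) -> (X -> R) -> X -> R) (K : R).
Hypothesis H : quadratic_form w L Q K.

Let w0 a : 0 < w a. Proof. exact: (qf_weight H). Qed.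
Let K0 : 0 < K. Proof. exact: (qf_const H). Qed.

Section Derivative.
Variables (g : X -> R) (rho T : R).
Hypotheses (Lg : L g) (grho : wbounded w rho g) (rho0 : 0 < rho) (T0 : 0 < T).
Hypothesis small : K * rho * T <= 4^-1.

Let rho_ge0 : 0 <= rho. Proof. exact: ltW. Qed.

Lemma picard_sum_taylor J s t a : 0 <= s <= T -> 0 <= t <= T ->
  w a * `|picard_sum Q g J.+1 s a - picard_sum Q g J.+1 t a - (s - t) * picard_deriv Q g J t a|
    <= 4 * rho / T ^+ 2 * (s - t) ^+ 2.
Proof.
move=> sT tT.
have T20 : 0 < T ^+ 2 by rewrite exprn_gt0.
have sq := sqr_ge0 (s - t).
pose v j := w a * ((s ^+ j - t ^+ j - j%:R * t ^+ j.-1 * (s - t)) * picard_coef Q g j a).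
have c0 : 0 <= 2 * rho / T ^+ 2 * (s - t) ^+ 2.
  by apply: mulr_ge0 => //; rewrite divr_ge0 ?mulr_ge0// ltW.
have vle j : `|v j| <= 2 * rho / T ^+ 2 * (s - t) ^+ 2 * 2^-1 ^+ j.
  have [_ /(_ a) b] := picard_coefP H Lg grho j.
  rewrite /v normrM gtr0_norm// normrM mulrCA.
  have h := pow_taylor2 j sT tT; rewrite -ler_pdivlMr// in h.
  apply: le_trans (ler_pM _ _ h b) _ => //; first by rewrite mulr_ge0// ltW.
  have kT : (K * rho * T) ^+ j <= 4^-1 ^+ j.
    by apply: lerXn2r => //; rewrite nnegrE// !mulr_ge0// ltW.
  have j2 := sqr_le_pow2 R j.
  have pw0 : (0 : R) <= 4^-1 ^+ j by exact: exprn_ge0.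
  have h1 : j%:R ^+ 2 * (K * rho * T) ^+ j <= 2 * 2^-1 ^+ j.
    apply: le_trans (ler_wpM2l (sqr_ge0 _) kT) _.
    apply: le_trans (ler_wpM2r pw0 j2) _.
    have -> : 4^-1 = 2^-1 * 2^-1 :> R by field.
    rewrite exprMn -[leLHS]mulrA; apply: ler_wpM2l => //.
    by rewrite mulrA -exprMn mulfV// expr1n mul1r.
  have c1 : 0 <= rho / T ^+ 2 * (s - t) ^+ 2.
    by apply: mulr_ge0 => //; rewrite divr_ge0// ltW.
  have := ler_wpM2l c1 h1; move: (2^-1 ^+ j) => z.
  rewrite (exprMn j (K * rho) T); move: ((K * rho) ^+ j) (T ^+ j) => y x.
  move: (T ^- 2) => i; move: (j%:R ^+ 2) ((s - t) ^+ 2) => J2 S2.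
  move=> h2; rewrite (_ : 2 * rho * i * S2 * z = rho * i * S2 * (2 * z)); last by ring.
  by apply: le_trans h2; rewrite le_eqVlt; apply/orP; left; apply/eqP; ring.
have := @sum_geometric_le _ _ v 0 J.+1 c0 vle.
rewrite big_ord0 subr0 expr0 mulr1 add0n.
rewrite (_ : 2 * (_ * _) = 4 * rho / T ^+ 2 * (s - t) ^+ 2); last by ring.
apply: le_trans; rewrite /v -mulr_sumr normrM (gtr0_norm (w0 a)).
rewrite le_eqVlt; apply/orP; left; apply/eqP; congr (_ * `|_|).
have -> : picard_deriv Q g J t a = \sum_(j < J.+1) j%:R * t ^+ j.-1 * picard_coef Q g j a.
  rewrite big_ord_recl /= mul0r mul0r add0r; apply: eq_bigr => j _ /=.
  by rewrite /bump /= add1n mulrCA -mulrA mulrCA.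
rewrite /picard_sum mulr_sumr -!sumrB; apply: eq_bigr => j _; ring.
Qed.

(** The bound is uniform in [a], so it gives the derivative in the weighted norm and not only
    pointwise. It passes to the limit from partial sums, at the cost of errors of order
    [2^-1 ^+ J]. *)
Lemma power_solution_taylor s t a : 0 <= s <= T -> 0 <= t <= T ->
  w a * `|power_solution Q g s a - power_solution Q g t a
          - (s - t) * Q (power_solution Q g t) (power_solution Q g t) a|
    <= 4 * rho / T ^+ 2 * (s - t) ^+ 2.
Proof.
move=> sT tT.
have [_ tails] := power_solution_tail H Lg grho rho0 small a sT.
have [_ tailt] := power_solution_tail H Lg grho rho0 small a tT.
have [Lt bt] := power_solutionP H Lg grho rho0 small tT.
(* The two tails at [s] and [t], then, multiplied by [|s - t|], the Lipschitz error of [Q] and the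
   error of [picard_deriv_approx]. *)
apply: (@le_of_half_pow _ _ _ (2 * rho + 2 * rho
   + `|s - t| * (2 * K * (2 * rho * (2 * rho)) + 2 * (K * rho ^+ 2)))) => J.
have [LP bP] := picard_sumP H Lg grho rho0 small J tT.
have h1 := picard_sum_taylor J a sT tT.
have dfg : wbounded w (2 * rho * 2^-1 ^+ J)
    (fun b => power_solution Q g t b - picard_sum Q g J t b).
  by move=> b; exact: (power_solution_tail H Lg grho rho0 small b tT).2.
have h2 := quadratic_lipschitz H Lt LP bt bP dfg a.
have h3 := picard_deriv_approx H Lg grho rho0 small J a tT.
have half (x : R) : x <= 2 * rho * 2^-1 ^+ J.+1 -> x <= 2 * rho * 2^-1 ^+ J.
  move=> h; apply: le_trans h _; rewrite ler_wpM2l ?mulr_ge0// exprS.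
  by apply: ler_piMl; rewrite ?exprn_ge0// invf_le1// ler1n.
have h4 := half _ (tails J.+1); have h5 := half _ (tailt J.+1).
move: h1 h2 h3 h4 h5.
set Qn := Q (power_solution Q g t) _ a; set QP := Q (picard_sum Q g J t) _ a.
set ns := power_solution Q g s a; set nt := power_solution Q g t a.
set Ps := picard_sum Q g J.+1 s a; set Pt := picard_sum Q g J.+1 t a.
set D := picard_deriv Q g J t a; set z := 2^-1 ^+ J => h1 h2 h3 h4 h5.
have E : ns - nt - (s - t) * Qn = (Ps - Pt - (s - t) * D) + (ns - Ps) - (nt - Pt)
    - (s - t) * (Qn - QP) - (s - t) * (QP - D) by ring.
rewrite {}E.
apply: le_trans (ler_wpM2l (ltW (w0 a)) (ler_normB _ _)) _.
rewrite mulrDr; apply: le_trans (lerD (ler_wpM2l (ltW (w0 a)) (ler_normB _ _)) (lexx _)) _.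
rewrite mulrDr; apply: le_trans (lerD (lerD (ler_wpM2l (ltW (w0 a)) (ler_normB _ _)) (lexx _)) (lexx _)) _.
rewrite mulrDr; apply: le_trans (lerD (lerD (lerD (ler_wpM2l (ltW (w0 a)) (ler_normD _ _)) (lexx _)) (lexx _)) (lexx _)) _.
rewrite mulrDr !normrM.
have g2 := ler_wpM2l (normr_ge0 (s - t)) h2; have g3 := ler_wpM2l (normr_ge0 (s - t)) h3.
rewrite mulrCA in g2; rewrite mulrCA in g3.
apply: le_trans (lerD (lerD (lerD (lerD h1 h4) h5) g2) g3) _.
by rewrite le_eqVlt; apply/orP; left; apply/eqP; ring.
Qed.

End Derivative.
End PowerSolutionDerivative.

(** * Stability and positivity of bounded solutions *)

Section QuadraticFlow.
Variable R : realType.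

Lemma derivative_on_expR (T lam t : R) :
  derivative_on T (fun s => expR (lam * s)) t (lam * expR (lam * t)).
Proof.
apply: derivative_on_is_derive.
have d : is_derive t 1 ( *%R lam) lam.
  by apply: is_derive_eq; rewrite -[_ *: _]/(_ * _) mulr1.
rewrite (mulrC lam); exact: (is_derive1_comp (is_derive_expR _) d).
Qed.

(* For [E] the supremum of [expR (- lam * t) * phi t a], the hypothesis gives
   [E <= D0 + E / 2]. *)
Lemma gronwall_halving (X : Type) (phi : R -> X -> R) (T lam M D0 : R) :
  0 <= lam -> 0 <= D0 ->
  (forall t a, 0 <= t <= T -> 0 <= phi t a <= M) ->
  (forall E, 0 <= E -> (forall t a, 0 <= t <= T -> phi t a <= E * expR (lam * t)) ->
     forall t a, 0 <= t <= T -> phi t a <= D0 + E / 2 * expR (lam * t)) ->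
  forall t a, 0 <= t <= T -> phi t a <= 2 * D0 * expR (lam * t).
Proof.
move=> lam0 D00 phiM step t a tT.
pose A : set R := [set x | exists s b, 0 <= s <= T /\ x = expR (- (lam * s)) * phi s b].
have ubA : ubound A M.
  move=> _ [s [b [sT ->]]]; have /andP[p0 pM] := phiM s b sT.
  apply: le_trans pM; apply: ler_piMl => //; rewrite -expR0 ler_expR oppr_le0.
  by rewrite mulr_ge0//; case/andP: sT.
have A0 : A (expR (- (lam * t)) * phi t a) by exists t, a.
have supA : has_sup A by split; [exists (expR (- (lam * t)) * phi t a)|exists M].
have leE s b : 0 <= s <= T -> phi s b <= sup A * expR (lam * s).
  move=> sT; rewrite -ler_pdivrMr ?expR_gt0// -expRN mulrC.
  by apply: ub_le_sup; [exists M|exists s, b].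
have E0 : 0 <= sup A.
  apply: le_trans (ub_le_sup _ A0); last by exists M.
  by rewrite mulr_ge0 ?expR_ge0//; case/andP: (phiM t a tT).
have half : sup A <= D0 + sup A / 2.
  apply: ge_sup; first by exists (expR (- (lam * t)) * phi t a).
  move=> _ [s [b [sT ->]]]; have h := step _ E0 leE s b sT.
  rewrite mulrC expRN ler_pdivrMr ?expR_gt0//; apply: le_trans h _.
  rewrite mulrDl lerD2r; apply: ler_peMr => //; rewrite -expR0 ler_expR.
  by rewrite mulr_ge0//; case/andP: sT.
apply: le_trans (leE t a tT) _; apply: ler_wpM2r; first exact: expR_ge0.
by move: half; lra.
Qed.

Variables (X : Type) (w : X -> R).
Variables (L : (X -> R) -> Prop) (Q : (X -> R) -> (X -> R) -> X -> R) (K : R).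
Hypothesis H : quadratic_form w L Q K.

Let w0 a : 0 < w a. Proof. exact: (qf_weight H). Qed.
Let K0 : 0 < K. Proof. exact: (qf_const H). Qed.

Record quadratic_flow (T M : R) (n : R -> X -> R) : Prop := QuadraticFlow {
  flow_mem : forall t, 0 <= t <= T -> L (n t) ;
  flow_bounded : forall t, 0 <= t <= T -> wbounded w M (n t) ;
  flow_derivative : forall t, 0 <= t <= T -> forall a,
    derivative_on T (fun s => n s a) t (Q (n t) (n t) a) }.

Variables (T M : R).
Hypotheses (T0 : 0 <= T) (M0 : 0 <= M).

Let lam_ge0 : 0 <= 4 * K * M. Proof. by rewrite !mulr_ge0// ltW. Qed.

(** The rate [4 * K * M] is twice the Lipschitz constant of the quadratic map on the ball of radius
    [M]. Hence the derivative of [E / 2 * expR (4 * K * M * t)] equals the bound on the difference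
    of the collision terms. *)
Lemma flow_difference_le n n' D0 E : quadratic_flow T M n -> quadratic_flow T M n' ->
  wbounded w D0 (fun a => n 0 a - n' 0 a) -> 0 <= E ->
  (forall t, 0 <= t <= T -> wbounded w (E * expR (4 * K * M * t)) (fun a => n t a - n' t a)) ->
  forall t a, 0 <= t <= T ->
    w a * (n t a - n' t a) <= D0 + E / 2 * expR (4 * K * M * t).
Proof.
move=> fn fn' nD0 E0 nE t a tT.
pose f s := D0 + E / 2 * expR (4 * K * M * s) + - w a * (n s a + -1 * n' s a).
pose d s := 0 + E / 2 * (4 * K * M * expR (4 * K * M * s))
  + - w a * (Q (n s) (n s) a + -1 * Q (n' s) (n' s) a).
suff : 0 <= f t by rewrite /f mulN1r mulNr subr_ge0.
apply: (@nonneg_barrier R T f d _ _ _ t tT).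
- have h : w a * (n 0 a - n' 0 a) <= D0.
    by apply: le_trans (nD0 a); apply: ler_wpM2l; [exact: ltW|exact: ler_norm].
  rewrite /f mulr0 expR0 mulr1 mulN1r mulNr.
  by move: h; set x := w a * _; lra.
- move=> s sT; apply: derivative_onD.
    by apply: derivative_onD; [exact: derivative_on_cst|apply: derivative_onZ; exact: derivative_on_expR].
  apply: derivative_onZ; apply: derivative_onD; first exact: (flow_derivative fn).
  by apply: derivative_onZ; exact: (flow_derivative fn').
move=> s sT _.
have h := quadratic_lipschitz H (flow_mem fn sT) (flow_mem fn' sT)
  (flow_bounded fn sT) (flow_bounded fn' sT) (nE s sT) a.
rewrite /d; set q := Q (n s) _ a in h *; set q' := Q (n' s) _ a in h *.
have : w a * (q - q') <= 2 * K * (M * (E * expR (4 * K * M * s))).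
  by apply: le_trans h; apply: ler_wpM2l; [exact: ltW|exact: ler_norm].
move: (expR _) => x h'.
rewrite (_ : _ + _ = 2 * K * (M * (E * x)) - w a * (q - q')); first by rewrite subr_ge0.
by field.
Qed.

Lemma flow_stability n n' D0 : quadratic_flow T M n -> quadratic_flow T M n' ->
  wbounded w D0 (fun a => n 0 a - n' 0 a) ->
  forall t, 0 <= t <= T ->
    wbounded w (2 * D0 * expR (4 * K * M * t)) (fun a => n t a - n' t a).
Proof.
move=> fn fn' nD0 t tT a.
have D00 : 0 <= D0 by apply: le_trans (nD0 a); rewrite mulr_ge0// ltW.
apply: (@gronwall_halving X (fun t a => w a * `|n t a - n' t a|) T _ (2 * M) D0 lam_ge0 D00 _ _ t a tT).
- move=> s b sT; apply/andP; split; first by apply: mulr_ge0 => //; exact: ltW.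
  apply: le_trans (ler_wpM2l (ltW (w0 b)) (ler_normB _ _)) _; rewrite mulrDr.
  by rewrite (_ : 2 * M = M + M) ?lerD ?(flow_bounded fn sT b) ?(flow_bounded fn' sT b)//; ring.
move=> E E0 nE s b sT.
have nE' s' (s'T : 0 <= s' <= T) : wbounded w (E * expR (4 * K * M * s')) (fun a => n s' a - n' s' a).
  by move=> c; exact: nE.
have h1 := flow_difference_le fn fn' nD0 E0 nE' b sT.
have h2 : w b * (n' s b - n s b) <= D0 + E / 2 * expR (4 * K * M * s).
  apply: (flow_difference_le fn' fn _ E0 _ b sT) => [c|s' s'T c]; rewrite distrC//.
  exact: nE'.
by case: (ger0P (n s b - n' s b)) => _ //; rewrite opprB.
Qed.

(** The halving argument for the negative part, with [D0 = 0]. Where the barrier function is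
    negative, [n] is negative too, as [qf_ge] requires. *)
Lemma flow_ge0 n : quadratic_flow T M n -> (forall a, 0 <= n 0 a) ->
  forall t a, 0 <= t <= T -> 0 <= n t a.
Proof.
move=> fn n00 t a tT.
have neg_ge0 x : 0 <= Num.max 0 x :> R by rewrite le_max lexx.
have : w a * Num.max 0 (- n t a) <= 2 * 0 * expR (4 * K * M * t).
  apply: (@gronwall_halving X (fun t a => w a * Num.max 0 (- n t a)) T _ M 0 lam_ge0 (lexx 0) _ _ t a tT).
    move=> s b sT; apply/andP; split; first by apply: mulr_ge0 => //; exact: ltW.
    apply: le_trans (flow_bounded fn sT b); apply: ler_wpM2l; first exact: ltW.
    by rewrite ge_max normr_ge0 -normrN ler_norm.
  move=> E E0 nE s b sT; rewrite add0r.
  pose f s := E / 2 * expR (4 * K * M * s) + w b * n s b.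
  pose d s := E / 2 * (4 * K * M * expR (4 * K * M * s)) + w b * Q (n s) (n s) b.
  have e0 s' : 0 <= E / 2 * expR (4 * K * M * s') by rewrite mulr_ge0 ?expR_ge0// divr_ge0.
  suff fs : 0 <= f s.
    have [n0|n0] := leP (- n s b) 0; first by rewrite mulr0.
    by rewrite mulrN; move: fs; rewrite /f; lra.
  apply: (@nonneg_barrier R T f d _ _ _ s sT).
  - by rewrite /f addr_ge0// mulr_ge0// ltW.
  - move=> u uT; apply: derivative_onD; apply: derivative_onZ; first exact: derivative_on_expR.
    exact: (flow_derivative fn).
  move=> u uT fu.
  have nu : n u b < 0.
    by rewrite -(pmulr_rlt0 _ (w0 b)); move: fu (e0 u); rewrite /f; lra.
  have uE : wbounded w (E * expR (4 * K * M * u)) (fun a => Num.max 0 (- n u a)).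
    by move=> c; rewrite ger0_norm//; exact: nE.
  have := qf_ge H (flow_mem fn uT) (flow_bounded fn uT) uE nu.
  rewrite /d; move: (expR _) (w b * Q _ _ b) => x q h.
  rewrite (_ : _ + q = q - - (2 * K * (M * (E * x)))); first by rewrite subr_ge0.
  by field.
rewrite mulr0 mul0r pmulr_rle0//; rewrite ge_max lexx/= oppr_le0 //.
Qed.

End QuadraticFlow.

(** * The collision operator on weighted spaces *)

Section CollisionOperator.
Variables (R : realType) (m : R).
Implicit Types (f g n : mode R -> R) (M : R).

Lemma Lnorm_infty_leP f M : (Lnorm_infty m (EFin \o f) <= M%:E)%E <-> jbounded m M f.
Proof.
split=> [h a|h].
  rewrite -lee_fin; apply: le_trans h; apply: ereal_sup_ubound.
  by exists a => //; rewrite abse_EFin -EFinM.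
apply: ge_ereal_sup => _ [a _ <-]; rewrite abse_EFin -EFinM lee_fin; exact: h.
Qed.

Lemma Lnorm_infty_ge0 (f : mode R -> \bar R) : (0 <= Lnorm_infty m f)%E.
Proof.
have h : (0 <= (japanese (0%R : R * R) `^ m)%:E * `|f (true, 0%R)|)%E.
  by rewrite mule_ge0 ?lee_fin ?powR_ge0.
by apply: le_trans h _; apply: ereal_sup_ubound; exists (true, 0).
Qed.

Lemma Linfty_jspace n : Linfty m n -> jspace m n.
Proof.
move=> [mn _ fn]; split => //.
have h0 := Lnorm_infty_ge0 (EFin \o n); exists (fine (Lnorm_infty m (EFin \o n))).
by apply/Lnorm_infty_leP; rewrite fineK// ge0_fin_numE.
Qed.

Lemma jspace_Linfty n : jspace m n -> (forall a, 0 <= n a) -> Linfty m n.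
Proof.
move=> [mn [M nM]] n0; split => //; apply: le_lt_trans (ltry M).
exact/Lnorm_infty_leP.
Qed.

Lemma jspace_lim (f : nat -> mode R -> R) g M : (forall i, jspace m (f i)) ->
  (forall a, f i a @[i --> \oo] --> g a) -> jbounded m M g -> jspace m g.
Proof.
move=> Lf fg gM; split; last by exists M.
move=> s; apply: (@measurable_fun_cvg _ _ _ setT (fun i k => f i (s, k))).
  by move=> i; exact: (Lf i).1.
by move=> k _; exact: fg.
Qed.

Section Form.
Variables (eps0 epsh : R) (chi : R -> R).
Hypotheses (m4 : 4 < m) (e00 : 0 < eps0) (eh0 : 0 < epsh) (chiP : cutoff eps0 epsh chi).

Lemma collisionE n : jspace m n -> collision chi n = EFin \o collision_form chi n n.
Proof.
move=> Ln; apply/funext => a; rewrite /collision; case: eqP => [a0|_].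
  rewrite /= /collision_form big1// => sb _; rewrite big1// => sc _.
  rewrite /Rintegral integral0_eq// => y _.
  by rewrite /curve_term curve_weight0// mul0r.
rewrite /= /collision_form -sumEFin; apply: eq_bigr => sb _.
by rewrite -sumEFin; apply: eq_bigr => sc _; rewrite (curve_integralE m4 e00 eh0 chiP).
Qed.

(** Adding 1 makes the constant strictly positive, so that it can be inverted in the existence
    time. *)
Lemma collision_quadratic_form :
  quadratic_form (jweight m) (jspace m) (collision_form chi) (form_constant m eps0 epsh + 1).
Proof.
have K0 := form_constant_ge0 m e00 eh0.
split.
- exact: jweight_gt0.
- by rewrite ltr_wpDl.
- by move=> f [].
- by move=> f g; exact: jspaceD.
- by move=> c f; exact: jspaceZ.
- by move=> f g M; exact: jspace_lim.
- by move=> f g; exact: (jspace_collision_form m4 e00 eh0 chiP).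
- by move=> *; apply: (collision_formDl m4 e00 eh0 chiP).
- by move=> *; apply: (collision_formDr m4 e00 eh0 chiP).
- by move=> *; apply: (collision_formZl m4 e00 eh0 chiP).
- by move=> *; apply: (collision_formZr m4 e00 eh0 chiP).
- move=> M N f g Lf Lg fM gN a; have M0 := jbounded_ge0 fM; have N0 := jbounded_ge0 gN.
  apply: le_trans (collision_form_bounded m4 e00 eh0 chiP Lf Lg fM gN a) _.
  by apply: ler_wpM2r; [exact: mulr_ge0|rewrite lerDl].
move=> M N f a Lf fM fN fa; have M0 := jbounded_ge0 fM; have N0 := jbounded_ge0 fN.
apply: le_trans (collision_form_ge m4 e00 eh0 chiP Lf fM fN fa).
rewrite lerN2; apply: ler_wpM2r; first exact: mulr_ge0.
by apply: ler_wpM2l => //; rewrite lerDl.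
Qed.

Lemma collision_bound n : Linfty m n ->
  (Lnorm_infty m (collision chi n)
    <= (form_constant m eps0 epsh)%:E * Lnorm_infty m (EFin \o n) ^+ 2)%E.
Proof.
move=> Ln; have Jn := Linfty_jspace Ln.
have h0 := Lnorm_infty_ge0 (EFin \o n).
have /fineK <- : Lnorm_infty m (EFin \o n) \is a fin_num.
  by rewrite ge0_fin_numE//; exact: Linfty_fin.
have nN : jbounded m (fine (Lnorm_infty m (EFin \o n))) n.
  by apply/Lnorm_infty_leP; rewrite fineK// ge0_fin_numE//; exact: Linfty_fin.
rewrite collisionE// -EFin_expe -EFinM expr2; apply/Lnorm_infty_leP.
exact: (collision_form_bounded m4 e00 eh0 chiP).
Qed.

End Form.
End CollisionOperator.

Section Flow.
Variables (R : realType) (X : Type) (w : X -> R).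
Variables (L : (X -> R) -> Prop) (Q : (X -> R) -> (X -> R) -> X -> R) (K : R).
Hypothesis H : quadratic_form w L Q K.
Variables (g : X -> R) (rho T : R).
Hypotheses (Lg : L g) (grho : wbounded w rho g) (rho0 : 0 < rho) (T0 : 0 < T).
Hypothesis small : K * rho * T <= 4^-1.

Let w0 a : 0 < w a. Proof. exact: (qf_weight H). Qed.
Let C0 : 0 < 4 * rho / T ^+ 2.
Proof. by rewrite divr_gt0 ?mulr_gt0// exprn_gt0. Qed.

Lemma power_solution_flow : quadratic_flow w L Q T (2 * rho) (power_solution Q g).
Proof.
split=> t tT; [|exact: (power_solutionP H Lg grho rho0 small tT).2|].
  exact: (power_solutionP H Lg grho rho0 small tT).1.
move=> a e e0; exists (e * w a / (4 * rho / T ^+ 2)); first by apply: divr_gt0 => //; exact: mulr_gt0.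
move=> s sT; rewrite ltr_pdivlMr// => /ltW st.
have := power_solution_taylor H Lg grho rho0 T0 small a sT tT.
rewrite [(s - t) * _]mulrC => h; rewrite -(ler_pM2l (w0 a)); apply: le_trans h _.
rewrite -[(s - t) ^+ 2]ger0_norm ?sqr_ge0// normrX expr2 !mulrA.
by apply: ler_wpM2r => //; rewrite mulrC [w a * e]mulrC.
Qed.

Lemma power_solution_lipschitz s t : 0 <= s <= T -> 0 <= t <= T ->
  wbounded w ((K * (2 * rho * (2 * rho)) + 4 * rho / T ^+ 2 * T) * `|s - t|)
    (fun a => power_solution Q g s a - power_solution Q g t a).
Proof.
move=> sT tT a; have [Lt bt] := power_solutionP H Lg grho rho0 small tT.
have h1 := power_solution_taylor H Lg grho rho0 T0 small a sT tT.
have h2 := qf_le H Lt Lt bt bt a.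
move: h1 h2; set q := Q _ _ a; set x := power_solution Q g s a - _ => h1 h2.
have -> : x = (x - (s - t) * q) + (s - t) * q by rewrite subrK.
apply: le_trans (ler_wpM2l (ltW (w0 a)) (ler_normD _ _)) _; rewrite mulrDr.
have st : `|s - t| <= T.
  by move: sT tT => /andP[? ?] /andP[? ?]; rewrite ler_norml; lra.
have h3 : 4 * rho / T ^+ 2 * (s - t) ^+ 2 <= 4 * rho / T ^+ 2 * T * `|s - t|.
  rewrite -[(s - t) ^+ 2]ger0_norm ?sqr_ge0// normrX expr2 -[leRHS]mulrA.
  by apply: ler_wpM2l; [exact: ltW|exact: ler_wpM2r].
rewrite [leRHS]mulrDl [leLHS]addrC; apply: lerD; last exact: le_trans h3.
by rewrite normrM mulrCA mulrC; apply: ler_wpM2r.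
Qed.

End Flow.

Section Neighborhoods.
Variables (R : realType).

Lemma cvg0e_near (F : set_system R) (FF : Filter F) (f : R -> \bar R) :
  (forall s, (0 <= f s)%E) ->
  (f s @[s --> F] --> 0%E) <-> (forall e : R, 0 < e -> \forall s \near F, (f s <= e%:E)%E).
Proof.
move=> f0; split=> [cf e e0|H A].
  apply: (cf [set x | (x <= e%:E)%E]).
  exists e => //= x /=; rewrite sub0r normrN lee_fin => /ltW; apply: le_trans.
  exact: ler_norm.
move=> [e /= e0 eA]; have := H (e / 2) (divr_gt0 e0 (ltr0n _ 2)); apply: filterS => s fs.
rewrite -[_ s]/(A (f s)); move: (f0 s) fs; case: (f s) => // r; rewrite !lee_fin => r0 re.
by apply: (eA r); rewrite /= sub0r normrN ger0_norm//; lra.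
Qed.

Lemma near_segmentP (T t : R) (P : R -> Prop) :
  (\forall s \near within `[0, T] (nbhs t), P s) <->
  exists2 r : R, 0 < r & forall s, 0 <= s <= T -> `|s - t| < r -> P s.
Proof.
split=> [[r /= r0 H]|[r r0 H]]; exists r => //= s.
  by move=> sT st; apply: H; rewrite /= ?in_itv// distrC.
by rewrite /= in_itv/= distrC => st sT; exact: H.
Qed.

Lemma near_dsegmentP (T t : R) (P : R -> Prop) :
  (\forall s \near within `[0, T] t^', P s) <->
  exists2 r : R, 0 < r & forall s, 0 <= s <= T -> s != t -> `|s - t| < r -> P s.
Proof.
split=> [[r /= r0 H]|[r r0 H]]; exists r => //= s.
  by move=> sT neq st; apply: H; rewrite /= ?in_itv// distrC.
by rewrite /= in_itv/= distrC => st neq sT; exact: H.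
Qed.

End Neighborhoods.

(** * From abstract flows to solutions of the kinetic equation *)

Section WellPosedness.
Variables (R : realType) (m eps0 epsh : R) (chi : R -> R).
Hypotheses (m4 : 4 < m) (e00 : 0 < eps0) (eh0 : 0 < epsh) (chiP : cutoff eps0 epsh chi).
Implicit Types (g : mode R -> R) (n : R -> mode R -> R) (T : R).

Let K : R := form_constant m eps0 epsh + 1.
Let Q := @collision_form R chi.
Let QF : quadratic_form (jweight m) (jspace m) Q K.
Proof. exact: collision_quadratic_form. Qed.

(** Stability needs one bound for all times. The norm is continuous along a solution and so attains
    its maximum on [0, T]. *)
Lemma solution_bounded T g n : 0 < T -> solution chi m T g n ->
  exists2 M, 0 <= M & forall t, 0 <= t <= T -> jbounded m M (n t).
Proof.
move=> T0 sol; pose N t := fine (Lnorm_infty m (EFin \o n t)).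
have NP t : 0 <= t <= T -> jbounded m (N t) (n t).
  move=> tT; apply/Lnorm_infty_leP; rewrite fineK// ge0_fin_numE ?Lnorm_infty_ge0//.
  exact: (Linfty_fin (solution_space sol tT)).
have Nle t s e : 0 <= s <= T -> 0 <= t <= T -> (Ldist m (n s) (n t) <= e%:E)%E ->
    N s <= N t + e.
  move=> sT tT /Lnorm_infty_leP h.
  rewrite -lee_fin /N fineK; last first.
    rewrite ge0_fin_numE ?Lnorm_infty_ge0//; exact: (Linfty_fin (solution_space sol sT)).
  apply/Lnorm_infty_leP => a; have h1 := h a; have h2 := NP t tT a.
  rewrite -[n s a](subrK (n t a)) addrC.
  apply: le_trans (ler_wpM2l (ltW (jweight_gt0 m a)) (ler_normD _ _)) _.
  by rewrite mulrDr; exact: lerD.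
have distC f g' : Ldist m f g' = Ldist m g' f.
  congr ereal_sup; apply/seteqP; split=> _ [a _ <-]; exists a => //=;
    by rewrite -EFinM distrC.
have cN : {within `[0, T], continuous N}.
  apply/subspace_continuousP => t; rewrite /= in_itv /= => tT.
  apply/cvgrPdist_le => e e0; apply/near_segmentP.
  have /(cvg0e_near _ (fun s => Lnorm_infty_ge0 m _))/(_ e e0)/near_segmentP[r r0 rP] :=
    solution_continuous sol tT.
  exists r => // s sT st; have h : (Ldist m (n s) (n t) <= e%:E)%E := rP s sT st.
  have h1 := Nle t s e sT tT h; rewrite distC in h; have h2 := Nle s t e tT sT h.
  have h3 : `|N t - N s| <= e by rewrite ler_norml; lra.
  exact: h3.
have [c cT cmax] := EVT_max (ltW T0) cN.
have c0 : 0 <= c <= T by move: cT; rewrite in_itv.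
exists (N c); first exact: jbounded_ge0 (NP c c0).
move=> t tT a; apply: le_trans (NP t tT a) _; apply: cmax; rewrite in_itv//.
Qed.

Lemma solution_flow T g n : 0 < T -> solution chi m T g n ->
  exists2 M, 0 <= M & quadratic_flow (jweight m) (jspace m) Q T M n.
Proof.
move=> T0 sol; have [M M0 nM] := solution_bounded T0 sol; exists M => //.
split=> // t tT; first exact: Linfty_jspace (solution_space sol tT).
move=> a e e0; have w0 := jweight_gt0 m a.
have Lt := Linfty_jspace (solution_space sol tT).
have /(cvg0e_near _ (fun s => Lnorm_infty_ge0 m _))/(_ _ (mulr_gt0 w0 e0))/near_dsegmentP[r r0 rP] :=
  solution_derivative sol tT.
exists r => // s sT st; have [->|neq] := eqVneq s t.
  by rewrite !subrr mulr0 subr0 normr0 mulr0.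
have := rP s sT neq st; rewrite (collisionE m4 e00 eh0 chiP Lt) => /Lnorm_infty_leP/(_ a).
rewrite ler_pM2l// => h.
have st0 : s - t != 0 by rewrite subr_eq0.
rewrite (_ : _ - _ = ((n s a - n t a) / (s - t) - Q (n t) (n t) a) * (s - t)); last by field.
by rewrite normrM; apply: ler_wpM2r.
Qed.

Lemma power_solution_solution g rho T : Linfty m g -> jbounded m rho g -> 0 < rho -> 0 < T ->
  K * rho * T <= 4^-1 -> solution chi m T g (power_solution Q g).
Proof.
move=> Lg grho rho0 T0 small; have Jg := Linfty_jspace Lg.
have fl := power_solution_flow QF Jg grho rho0 T0 small.
have rho2 : 0 <= 2 * rho by rewrite mulr_ge0// ltW.
split.
- move=> t tT; apply: jspace_Linfty; first exact: (flow_mem fl tT).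
  move=> a; apply: (flow_ge0 QF rho2 fl _ a tT) => b.
  rewrite (power_solution0 QF Jg grho rho0 T0 small); exact: (Linfty_ge0 Lg).
- move=> t tT; apply/(cvg0e_near _ (fun s => Lnorm_infty_ge0 m _)) => e e0.
  apply/near_segmentP; pose C := K * (2 * rho * (2 * rho)) + 4 * rho / T ^+ 2 * T.
  have K0 := qf_const QF.
  have C0 : 0 < C by rewrite addr_gt0 ?mulr_gt0 ?invr_gt0 ?exprn_gt0//.
  exists (e / C); first exact: divr_gt0.
  move=> s sT; rewrite ltr_pdivlMr// => /ltW st; apply/Lnorm_infty_leP => a.
  apply: le_trans (power_solution_lipschitz QF Jg grho rho0 T0 small sT tT a) _.
  by rewrite mulrC.
- move=> t tT; apply/(cvg0e_near _ (fun s => Lnorm_infty_ge0 m _)) => e e0.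
  apply/near_dsegmentP; pose C := 4 * rho / T ^+ 2.
  have C0 : 0 < C by rewrite divr_gt0 ?mulr_gt0 ?exprn_gt0//.
  exists (e / C); first exact: divr_gt0.
  move=> s sT neq; rewrite ltr_pdivlMr// => /ltW st.
  rewrite (collisionE m4 e00 eh0 chiP (flow_mem fl tT)); apply/Lnorm_infty_leP => a.
  have st0 : s - t != 0 by rewrite subr_eq0.
  have st1 : 0 < `|s - t| by rewrite normr_gt0.
  rewrite -(ler_pM2r st1) -mulrA -normrM.
  have -> : ((power_solution Q g s a - power_solution Q g t a) / (s - t)
      - collision_form chi (power_solution Q g t) (power_solution Q g t) a) * (s - t)
    = power_solution Q g s a - power_solution Q g t a
      - (s - t) * Q (power_solution Q g t) (power_solution Q g t) a.
    by rewrite /Q; field.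
  apply: le_trans (power_solution_taylor QF Jg grho rho0 T0 small a sT tT) _.
  rewrite -[(s - t) ^+ 2]ger0_norm ?sqr_ge0// normrX expr2 mulrA.
  by apply: ler_wpM2r => //; rewrite mulrC.
exact: (power_solution0 QF Jg grho rho0 T0 small).
Qed.

Lemma collision_locally_well_posed : locally_well_posed chi m.
Proof.
move=> n0 Ln0; have K0 : 0 < K := qf_const QF.
have N0 := Lnorm_infty_ge0 m (EFin \o n0).
have Nfin : Lnorm_infty m (EFin \o n0) \is a fin_num.
  by rewrite ge0_fin_numE//; exact: Linfty_fin.
(* The extra 1 is the radius of the ball of data. The existence time depends on [rho] only, so it is
   common to the whole ball. *)
pose rho := fine (Lnorm_infty m (EFin \o n0)) + 1.
have rho0 : 0 < rho by rewrite ltr_wpDl// fine_ge0.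
have rho2 : 0 <= 2 * rho by rewrite mulr_ge0// ltW.
pose T := (4 * (K * rho))^-1.
have T0 : 0 < T by rewrite invr_gt0 !mulr_gt0.
have small : K * rho * T <= 4^-1.
  by rewrite /T invfM mulrCA divff ?mulr1// gt_eqF// mulr_gt0.
have near_bounded g : Linfty m g /\ (Ldist m g n0 < 1%:E)%E -> jbounded m rho g.
  move=> [Lg /ltW/Lnorm_infty_leP gn0] a.
  have n0b : jbounded m (fine (Lnorm_infty m (EFin \o n0))) n0.
    by apply/Lnorm_infty_leP; rewrite fineK.
  rewrite -[g a](subrK (n0 a)) addrC.
  apply: le_trans (ler_wpM2l (ltW (jweight_gt0 m a)) (ler_normD _ _)) _.
  by rewrite mulrDr; apply: lerD; [exact: n0b|exact: gn0].
exists T, 1, (power_solution Q); split => //.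
- move=> g ng; exact: (power_solution_solution ng.1 (near_bounded g ng) rho0 T0 small).
- move=> g n ng sol t tT a.
  have Jg := Linfty_jspace ng.1; have bg := near_bounded g ng.
  have [M M0 fn] := solution_flow T0 sol.
  have fS := power_solution_flow QF Jg bg rho0 T0 small.
  (* The given solution is bounded by some [M] of its own; the comparison runs with a bound common
     to both solutions. *)
  have MM0 : 0 <= Num.max M (2 * rho) by rewrite le_max M0.
  have widen M' M'' n' : M' <= M'' -> quadratic_flow (jweight m) (jspace m) Q T M' n' ->
      quadratic_flow (jweight m) (jspace m) Q T M'' n'.
    move=> MM [h1 h2 h3]; split => // u uT b; exact: le_trans (h2 u uT b) MM.
  have fn' : quadratic_flow (jweight m) (jspace m) Q T (Num.max M (2 * rho)) n.
    by apply: widen fn; rewrite le_max lexx.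
  have fS' : quadratic_flow (jweight m) (jspace m) Q T (Num.max M (2 * rho)) (power_solution Q g).
    by apply: widen fS; rewrite le_max lexx orbT.
  have D0 : wbounded (jweight m) 0 (fun b => n 0 b - power_solution Q g 0 b).
    move=> b; rewrite (power_solution0 QF Jg bg rho0 T0 small) (solution_initial sol).
    by rewrite subrr normr0 mulr0.
  have := flow_stability QF MM0 fn' fS' D0 tT a.
  rewrite mulr0 mul0r pmulr_rle0 ?jweight_gt0// normr_le0 subr_eq0 => /eqP.
  by [].
(* Inverts the stability factor at the final time [T], for solutions bounded by [2 * rho]. *)
move=> g ng e e0; pose d := e / (2 * expR (4 * K * (2 * rho) * T)).
have ex0 : 0 < 2 * expR (4 * K * (2 * rho) * T) by rewrite mulr_gt0// expR_gt0.
exists d; first exact: divr_gt0.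
move=> h nh /ltW/Lnorm_infty_leP hd t tT; apply/Lnorm_infty_leP => a.
have Jg := Linfty_jspace ng.1; have bg := near_bounded g ng.
have Jh := Linfty_jspace nh.1; have bh := near_bounded h nh.
have fg := power_solution_flow QF Jg bg rho0 T0 small.
have fh := power_solution_flow QF Jh bh rho0 T0 small.
have D0 : wbounded (jweight m) d (fun b => power_solution Q h 0 b - power_solution Q g 0 b).
  move=> b; rewrite (power_solution0 QF Jg bg rho0 T0 small) (power_solution0 QF Jh bh rho0 T0 small).
  exact: hd.
apply: le_trans (flow_stability QF rho2 fh fg D0 tT a) _.
rewrite mulrAC mulrC -ler_pdivlMr ?mulr_gt0 ?expR_gt0//; rewrite /d; apply: ler_wpM2l; first exact: ltW.
rewrite lef_pV2 ?posrE// ?mulr_gt0 ?expR_gt0// ler_pM2l// ler_expR.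
by apply: ler_wpM2l; [rewrite !mulr_ge0// ltW|case/andP: tT].
Qed.

End WellPosedness.

Theorem proposition8p3 (R : realType) (m eps0 epsh : R) (hm : 4 < m)
    (heps0 : 0 < eps0 < 1) (hepsh : 0 < epsh < 1)
    (heps : eps0 ^+ 2 + epsh ^+ 2 < 1) :
  (exists C : R, forall chi : R -> R, cutoff eps0 epsh chi ->
     forall n : mode R -> R, Linfty m n ->
       (Lnorm_infty m (collision chi n)
          <= C%:E * Lnorm_infty m (EFin \o n) ^+ 2)%E) /\
  (forall chi : R -> R, cutoff eps0 epsh chi -> locally_well_posed chi m).
Proof.
have [/andP[e00 _] /andP[eh0 _]] := (heps0, hepsh); split.
  by exists (form_constant m eps0 epsh) => chi chiP n; exact: collision_bound.
by move=> chi chiP; exact: (collision_locally_well_posed hm e00 eh0 chiP).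
Qed.
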